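(* Let $H\in(0,1/2)$ and $\lambda(d\rho)=c_H\rho^{-H-1/2}d\rho$ on $\mathbb{R}_+$ with $c_H=\frac1{\Gamma(H+1/2)\Gamma(1/2-H)}$. Assume that $M_1$ and $M_2$ are (bounded and) $\mathcal{C}^4$ with bounded derivatives. Let $T>0$. For $\beta\in(0,1)$, $K>1$ and $n\in\mathbb{N}^*$, let $\hat G^K_j(t)=\int_{\mathbb{R}_+}e^{-\rho t}M_j(\rho)\hat\lambda^S(d\rho)$, $j\in\{1,2\}$, with $$\hat\lambda^S=\sum_{i=1}^n\lambda(I^{K^\beta}_{i,n})\,\delta_{\rho^{K^\beta}_{i,n}}+\frac{c_H(K-K^\beta)}{6n}\sum_{i=1}^n\Big[(\rho^K_{i,n,0})^{-H-\frac12}\delta_{\rho^K_{i,n,0}}+4(\rho^K_{i,n,1})^{-H-\frac12}\delta_{\rho^K_{i,n,1}}+(\rho^K_{i,n,2})^{-H-\frac12}\delta_{\rho^K_{i,n,2}}\Big],$$ where $I^{K^\beta}_{i,n}=[\frac{i-1}nK^\beta,\frac inK^\beta)$, $\rho^{K^\beta}_{i,n}\in I^{K^\beta}_{i,n}$ is an arbitrary point, $\rho^K_{i,n,0}=K^\beta+\frac{(i-1)(K-K^\beta)}n$, $\rho^K_{i,n,1}=K^\beta+\frac{(2i-1)(K-K^\beta)}{2n}$ and $\rho^K_{i,n,2}=K^\beta+\frac{i(K-K^\beta)}n$. Let $X$ be the solution of $$X_t=x_0+\int_0^tG_1(t-s)b(X_s)ds+\int_0^tG_2(t-s)\sigma(X_s)dW_s$$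 and $\hat X^K$ the solution of the same equation with $G_1,G_2$ replaced by $\hat G^K_1,\hat G^K_2$. If $\beta=\frac{10-6H}{13-6H}$ and $K=K_n\sim n^{\frac{13-6H}{15-6H}}$ as $n\to\infty$, then there exists a constant $C>0$ (not depending on $n$) such that $$\forall t\in[0,T],\quad \mathbb{E}[|\hat X^K_t-X_t|^2]\le C\,n^{-2H\times\frac{13-6H}{15-6H}} .$$
   Context: Fix $d\ge1$, a deterministic $x_0\in\mathbb{R}^d$ and a standard $d$-dimensional Brownian motion $W$ on a filtered probability space. $\mathcal{M}_d(\mathbb{R})$ is the space of real $d\times d$ matrices with the Frobenius norm $\|\cdot\|$, $|\cdot|$ is the Euclidean norm on $\mathbb{R}^d$; $\mathbb{R}_+=[0,\infty)$; $\delta_x$ is the Dirac mass at $x$. The coefficients $b:\mathbb{R}^d\to\mathbb{R}^d$ and $\sigma:\mathbb{R}^d\to\mathcal{M}_d(\mathbb{R})$ are globally Lipschitz. $M_1,M_2:\mathbb{R}_+\to\mathcal{M}_d(\mathbb{R})$ are bounded (standing assumption), and $G_j(t)=\int_{\mathbb{R}_+}e^{-\rho t}M_j(\rho)\lambda(d\rho)$ for $t>0$. A solution of a stochastic Volterra equation is an adapted measurable process with second moments bounded on compact time intervals satisfying the equation almost surely for each $t$; existence and uniqueness of strong solutions under these assumptions is known (X. Zhang). *)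

(* Defs.v *)
From HB Require Import structures.
From mathcomp Require Import all_boot all_order all_algebra.
From mathcomp Require Import all_classical all_reals all_analysis.
From mathcomp Require Import measurable_realfun.

Set Implicit Arguments.
Unset Strict Implicit.
Unset Printing Implicit Defensive.
Import Order.TTheory GRing.Theory Num.Theory.
Import numFieldNormedType.Exports.

Local Open Scope classical_set_scope.
Local Open Scope ring_scope.

(* The library's norm on matrices is the sup norm; this one is Euclidean on
   column vectors and Frobenius on square matrices. *)
Definition frob (R : realType) (m n : nat) (A : 'M[R]_(m, n)) : R :=
  Num.sqrt (\sum_i \sum_j A i j ^+ 2).

Definition globally_lipschitz (R : realType) (m n p q : nat)
    (f : 'M[R]_(m, n) -> 'M[R]_(p, q)) : Prop :=
  exists L : R, forall x y, frob (f x - f y) <= L * frob (x - y).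

Definition bounded_on_Rplus (R : realType) (d : nat) (M : R -> 'M[R]_d) : Prop :=
  exists c : R, forall r : R, 0 <= r -> frob (M r) <= c.

(* f is C^k on the closed half-line [0, +oo[ (derivatives at 0 are one-sided)
   and its derivatives of orders 1, ..., k are bounded; D j is the j-th
   derivative. *)
Definition Ck_bounded_derivatives (R : realType) (k : nat) (f : R -> R) : Prop :=
  exists D : nat -> R -> R,
  [/\ forall x : R, 0 <= x -> D 0%N x = f x,
      forall (j : nat) (x : R), (j < k)%N -> 0 <= x ->
        (D j y - D j x) / (y - x) @[y --> within [set y : R | 0 <= y] x^']
          --> D j.+1 x,
      {within [set x : R | 0 <= x], continuous (D k)} &
      forall j, (0 < j <= k)%N ->
        exists c : R, forall x : R, 0 <= x -> `|D j x| <= c].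

Definition Ck_bounded_derivatives_mx (R : realType) (k d : nat)
    (M : R -> 'M[R]_d) : Prop :=
  forall i j, Ck_bounded_derivatives k (fun r => M r i j).

Section stochastic_volterra.
Context {R : realType} {dO : measure_display} {Omega : measurableType dO}.
Variable P : probability Omega R.

Definition is_filtration (Ft : R -> set (set Omega)) : Prop :=
  (forall t : R, 0 <= t ->
     sigma_algebra [set: Omega] (Ft t) /\ Ft t `<=` measurable) /\
  (forall s t : R, 0 <= s -> s <= t -> Ft s `<=` Ft t).

Definition sub_measurable (F : set (set Omega)) (m n : nat)
    (Z : Omega -> 'M[R]_(m, n)) : Prop :=
  forall i j (B : set R), measurable B -> F ((fun w => Z w i j) @^-1` B).

Definition adapted (Ft : R -> set (set Omega)) (m n : nat)
    (X : R -> Omega -> 'M[R]_(m, n)) : Prop :=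
  forall t : R, 0 <= t -> sub_measurable (Ft t) (X t).

Definition jointly_measurable (D : set R) (m n : nat)
    (X : R -> Omega -> 'M[R]_(m, n)) : Prop :=
  forall i j, measurable_fun (D `*` [set: Omega])
    (fun p : R * Omega => X p.1 p.2 i j).

(* The second field says both that W t - W s is independent of Ft s and that
   its coordinates are independent with law N(0, t - s); the second parameter
   of normal_prob is the standard deviation. *)
Record brownian_motion (d : nat) (Ft : R -> set (set Omega))
    (W : R -> Omega -> 'cV[R]_d) : Prop := BrownianMotion {
  bm_start : {ae P, forall w, W 0 w = 0} ;
  bm_increments : forall s t : R, 0 <= s -> s < t ->
    forall (A : set Omega) (B : 'I_d -> set R), Ft s A ->
      (forall i, measurable (B i)) ->
      P (A `&` \bigcap_(i in [set: 'I_d])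
                 [set w | B i (W t w i 0 - W s w i 0)]) =
      (P A * \prod_(i < d) normal_prob 0 (Num.sqrt (t - s)) (B i))%E ;
  bm_adapted : adapted Ft W ;
  bm_continuous : {ae P, forall w, forall i,
    {within [set t : R | 0 <= t], continuous (fun t : R => W t w i 0)}} }.

(* The elementary integrand xi * 1_{]a, b]} with xi bounded and
   Ft a - measurable. *)
Record elementary (d : nat) (Ft : R -> set (set Omega)) := Elementary {
  el_start : R ;
  el_end : R ;
  el_coef : Omega -> 'M[R]_d ;
  el_times : 0 <= el_start <= el_end ;
  el_measurable : sub_measurable (Ft el_start) el_coef ;
  el_bounded : exists c : R, forall w, frob (el_coef w) <= c }.

(* A sequence of elementary integrands stands for their sum. *)
Definition simple_process (d : nat) (Ft : R -> set (set Omega))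
    (Phi : seq (elementary d Ft)) (s : R) (w : Omega) : 'M[R]_d :=
  \sum_(e <- Phi) (if el_start e < s <= el_end e then el_coef e w else 0).

Definition simple_integral (d : nat) (Ft : R -> set (set Omega))
    (W : R -> Omega -> 'cV[R]_d) (Phi : seq (elementary d Ft))
    (t : R) (w : Omega) : 'cV[R]_d :=
  \sum_(e <- Phi) el_coef e w *m
    (W (Num.min (el_end e) t) w - W (Num.min (el_start e) t) w).

(* Y is (a version of) the Ito integral of A dW over [0, t]: the L^2 limit of
   the integrals of simple processes converging to A in L^2([0, t] x Omega). *)
Definition ito_integral (d : nat) (Ft : R -> set (set Omega))
    (W : R -> Omega -> 'cV[R]_d) (A : R -> Omega -> 'M[R]_d) (t : R)
    (Y : Omega -> 'cV[R]_d) : Prop :=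
  [/\ jointly_measurable `[0, t] A,
      sub_measurable measurable Y &
      exists Phi : nat -> seq (elementary d Ft),
        (\int[P]_w \int[lebesgue_measure]_(s in `[0%R, t])
            (frob (simple_process (Phi n) s w - A s w) ^+ 2)%:E)%E
          @[n --> \oo] --> 0%E /\
        'E_P[fun w => (frob (simple_integral W (Phi n) t w - Y w) ^+ 2)%R]%E
          @[n --> \oo] --> 0%E].

(* Solutions of
   X_t = x0 + \int_0^t G1(t-s) b(X_s) ds + \int_0^t G2(t-s) sigma(X_s) dW_s. *)
Record volterra_solution (d : nat) (Ft : R -> set (set Omega))
    (W : R -> Omega -> 'cV[R]_d) (x0 : 'cV[R]_d)
    (b : 'cV[R]_d -> 'cV[R]_d) (sigma : 'cV[R]_d -> 'M[R]_d)
    (G1 G2 : R -> 'M[R]_d) (X : R -> Omega -> 'cV[R]_d) : Prop :=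
  VolterraSolution {
  vs_measurable : jointly_measurable [set t : R | 0 <= t] X ;
  vs_adapted : adapted Ft X ;
  vs_moments : forall T : R, 0 <= T -> exists c : R, forall t : R, 0 <= t <= T ->
    ('E_P[(fun w => frob (X t w) ^+ 2)%R] <= c%:E)%E ;
  vs_equation : forall t : R, 0 <= t -> exists Y : Omega -> 'cV[R]_d,
    ito_integral Ft W (fun s w => G2 (t - s) *m sigma (X s w)) t Y /\
    {ae P, forall w, X t w = x0
      + \col_i (\int[lebesgue_measure]_(s in `[0%R, t])
                  (G1 (t - s) *m b (X s w)) i 0)
      + Y w} }.

End stochastic_volterra.

Definition laplace_kernel (R : realType) (d : nat)
    (mu : {measure set R -> \bar R}) (M : R -> 'M[R]_d) (t : R) : 'M[R]_d :=
  \matrix_(i, j) \int[mu]_(rho in [set rho : R | 0 <= rho])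
    (expR (- rho * t) * M rho i j).

(* Euler's Gamma function at z > 0 (a junk value where the integral
   diverges). *)
Definition Gamma (R : realType) (z : R) : R :=
  \int[lebesgue_measure]_(u in [set u : R | 0 < u]) (u `^ (z - 1) * expR (- u)).

Definition c_ (R : realType) (H : R) : R :=
  (Gamma (H + 2^-1) * Gamma (2^-1 - H))^-1.

Lemma Gamma_ge0 (R : realType) (z : R) : 0 <= Gamma z.
Proof.
by apply: Rintegral_ge0 => u _; rewrite mulr_ge0 ?powR_ge0 ?expR_ge0.
Qed.

Lemma c_ge0 (R : realType) (H : R) : 0 <= c_ H.
Proof. by rewrite invr_ge0 mulr_ge0 ?Gamma_ge0. Qed.

Section fractional_measure.
Context {R : realType}.
Variable H : R.

Definition frac_measure (A : set R) : \bar R :=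
  (\int[lebesgue_measure]_(rho in A `&` [set rho : R | (0 <= rho)%R])
     (c_ H * rho `^ (- H - 2^-1))%:E)%E.

Let density_ge0 (rho : R) : (0 <= (c_ H * rho `^ (- H - 2^-1))%:E)%E.
Proof. by rewrite lee_fin mulr_ge0 ?c_ge0 ?powR_ge0. Qed.

Let measurable_density (D : set R) :
  measurable_fun D (fun rho : R => (c_ H * rho `^ (- H - 2^-1))%:E).
Proof.
apply/measurable_EFinP; apply: measurable_funTS.
by apply: measurable_funM => //; exact: measurable_powR.
Qed.

Let measurable_Rplus : measurable [set rho : R | 0 <= rho].
Proof.
rewrite (_ : [set rho : R | 0 <= rho] = [set` `[0, +oo[%R]); last first.
  by apply/seteqP; split => x /=; rewrite in_itv/= andbT.
exact: measurable_itv.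
Qed.

Let frac_measure0 : frac_measure set0 = 0%E.
Proof. by rewrite /frac_measure set0I integral_set0. Qed.

Let frac_measure_ge0 A : (0 <= frac_measure A)%E.
Proof. exact: integral_ge0. Qed.

Let frac_measure_sigma_additive : semi_sigma_additive frac_measure.
Proof.
move=> F mF tF mUF; rewrite /frac_measure setI_bigcupl ge0_integral_bigcup//=.
- apply: is_cvg_ereal_nneg_natsum_cond => n _ _; exact: integral_ge0.
- by move=> k; apply: measurableI; [exact: mF|exact: measurable_Rplus].
- exact: measurable_density.
- by apply: trivIset_setIr.
Qed.

HB.instance Definition _ := isMeasure.Build _ _ _ frac_measure
  frac_measure0 frac_measure_ge0 frac_measure_sigma_additive.

End fractional_measure.

Section quadrature.
Context {R : realType}.
Variables (H beta K : R) (n : nat).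

(* For 1 <= i <= n. *)
Definition cell (i : nat) : set R :=
  `[i.-1%:R / n%:R * K `^ beta, i%:R / n%:R * K `^ beta[.

(* The points of index 0, 1, 2 in the i-th subinterval of [K^beta, K],
   1 <= i <= n. *)
Definition simpson_pt0 (i : nat) : R :=
  K `^ beta + i.-1%:R * (K - K `^ beta) / n%:R.
Definition simpson_pt1 (i : nat) : R :=
  K `^ beta + (2 * i).-1%:R * (K - K `^ beta) / (2 * n%:R).
Definition simpson_pt2 (i : nat) : R :=
  K `^ beta + i%:R * (K - K `^ beta) / n%:R.

Definition simpson_scale : R := c_ H * (K - K `^ beta) / (6 * n%:R).

Lemma simpson_scale_ge0 : 0 < beta < 1 -> 1 < K -> 0 <= simpson_scale.
Proof.
move=> /andP[_ b1] K1; rewrite divr_ge0 ?mulr_ge0 ?c_ge0// subr_ge0.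
by rewrite -[leRHS](@powRr1 _ K) ?ler_powR// ltW// (lt_trans ltr01).
Qed.

Lemma cell_mass_ge0 (i : nat) : 0 <= fine (frac_measure H (cell i)).
Proof. by rewrite fine_ge0. Qed.

Lemma simpson_density_ge0 (x : R) : 0 <= x `^ (- H - 2^-1).
Proof. exact: powR_ge0. Qed.

Lemma simpson_density4_ge0 (x : R) : 0 <= 4 * x `^ (- H - 2^-1).
Proof. by rewrite mulr_ge0 ?powR_ge0. Qed.

(* msum ranges over 0 <= k < n; the indices of the mathematical sums are
   i = k.+1. *)
Definition quad_measure (beta01 : 0 < beta < 1) (K_gt1 : 1 < K)
    (rho : nat -> R) : {measure set R -> \bar R} :=
  measure_add
    (msum (fun k => mscale (NngNum (cell_mass_ge0 k.+1)) \d_(rho k.+1)) n)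
    (mscale (NngNum (simpson_scale_ge0 beta01 K_gt1))
      (msum (fun k => measure_add
         (measure_add
           (mscale (NngNum (simpson_density_ge0 (simpson_pt0 k.+1)))
             \d_(simpson_pt0 k.+1))
           (mscale (NngNum (simpson_density4_ge0 (simpson_pt1 k.+1)))
             \d_(simpson_pt1 k.+1)))
         (mscale (NngNum (simpson_density_ge0 (simpson_pt2 k.+1)))
           \d_(simpson_pt2 k.+1))) n)).

End quadrature.

(* Main.v *)
(* The density x^(-H-1/2) is cut at K. By the choice of beta, the sums over the
   cells of [0, K^beta[ and Simpson's rule on [K^beta, K] both approximate the
   Laplace integrals up to n^(-H g), g = (13-6H)/(15-6H), while the tail beyond K
   is at most C t^(-p) K^(1/2-H-p), because exp(-xt) <= (xt)^(-p) for
   0 <= p <= 1. Taking p below 1/2 when t K <= 1 and above 1/2 otherwise, the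
   squared kernel error is dominated by a function h_n with integral over [0, T]
   of order K^(-2H), that is n^(-2H g).

   Let h dominate |G_1|^2 + |G_2|^2. The Ito isometry and the Lipschitz
   property yield, for D(t) = E|Xhat_t - X_t|^2,
     D(t) <= C \int_0^t (h_n(t-s) + (h_n + h)(t-s) D(s)) ds.
   For theta large, \int_0^T h(s) exp(-theta s) ds is small, so this inequality is
   a contraction for the norm sup_t exp(-theta t) D(t) as soon as \int_0^T h_n is
   small, and D is then of the order of \int_0^T h_n. The finitely many remaining
   n are absorbed by the moment bounds of the solutions. *)

Require Import Defs.
From HB Require Import structures.
From mathcomp Require Import all_boot all_order all_algebra.
From mathcomp Require Import all_classical all_reals all_analysis.
From mathcomp Require Import measurable_realfun.
From mathcomp Require Import ring lra.
Set Implicit Arguments.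
Unset Strict Implicit.
Unset Printing Implicit Defensive.
Import Order.TTheory GRing.Theory Num.Theory.
Import numFieldNormedType.Exports.
Local Open Scope classical_set_scope.
Local Open Scope ring_scope.

(** * Integrals against densities and powers *)

(** The parameters come from balancing three errors, with [a = - H - 1/2]: K^(beta (a + 2)) / n on
    the cells, n^(-4) K^(5 + beta a) for Simpson's rule, and K^(-H) for the tail, in mean square
    over [0, T]. With K of order n^g, the two resulting equations are linear in [g] and [beta * g].
    The tail resists a single exponent: its squared bound t^(-2p) K^(1 - 2H - 2p) reaches K^(-2H) at
    p = 1/2, exactly where t^(-2p) ceases to be integrable at 0; a different p on each side of t =
    1/K avoids the logarithm. The other obstacle is that the moment bound of Xhat may depend on n.
    The coefficients at Xhat are therefore compared with those at X, so that only moments of X and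
    the unknown D occur. For large n, the bound on D that depends on n merely starts an iteration
    which halves it up to a fixed term, and it disappears from the final constant. No constant is
    sharp: the variance of the standard normal law stays a symbol, and the Ito isometry enters as an
    inequality up to a factor. *)

Section density.
Local Open Scope ereal_scope.
Import HBNNSimple.
Context d (T : measurableType d) (R : realType).
Variables (mu nu : {measure set T -> \bar R}) (g : T -> R).
Hypotheses (mg : measurable_fun [set: T] g) (g_ge0 : forall x, (0 <= g x)%R).
Hypothesis nuE : forall A, measurable A -> nu A = \int[mu]_(x in A) (g x)%:E.

(** A simple function is a finite combination of indicators, so linearity reduces the claim to [nuE]
    on its level sets. *)
Let integral_density_nnsfun (f : {nnsfun T >-> R}) :
  \int[nu]_x (f x)%:E = \int[mu]_x ((f x)%:E * (g x)%:E).
Proof.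
have mgE : measurable_fun [set: T] (EFin \o g) by exact/measurable_EFinP.
under eq_integral do rewrite fimfunE -fsumEFin//.
rewrite ge0_integral_fsum//; last 2 first.
  - by move=> r; exact/measurable_EFinP/measurableT_comp.
  - by move=> n x _; rewrite EFinM nnfun_muleindic_ge0.
transitivity (\int[mu]_x
    (\sum_(r \in range f) (r * \1_(f @^-1` [set r]) x)%:E * (g x)%:E)).
  rewrite ge0_integral_fsum//; last 2 first.
  - move=> r; apply: emeasurable_funM => //.
    exact/measurable_EFinP/measurableT_comp.
  - move=> r x _; apply: mule_ge0; last by rewrite lee_fin.
    by rewrite EFinM nnfun_muleindic_ge0.
  apply: eq_fsbigr => r _.
  rewrite (_ : (fun x => _ * (g x)%:E) =
      fun x => r%:E * ((\1_(f @^-1` [set r]) x)%:E * (g x)%:E)); last first.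
    by apply/funext => x; rewrite EFinM muleA.
  rewrite [LHS]integralZl_indic_nnsfun//= integral_indic// setIT.
  (* Level sets at negative values are empty; the scalar is pulled out by [ge0_integralZl] only for
     [r >= 0]. *)
  have [r0|r0] := ltP r 0%R.
    rewrite preimage_nnfun0// measure0 mule0.
    rewrite (_ : (fun x => _) = cst 0) ?integral0//.
    by apply/funext => x; rewrite indicE in_set0 mul0e mule0.
  rewrite ge0_integralZl//; last 2 first.
  - apply: emeasurable_funM => //; exact/measurable_EFinP/measurable_indic.
  - by move=> x _; rewrite mule_ge0 ?lee_fin ?g_ge0.
  congr (_ * _); rewrite nuE// integral_mkcond.
  apply: eq_integral => x _; rewrite /= patchE indicE.
  by case: ifPn => _; rewrite ?mul1e ?mul0e.
apply: eq_integral => x _.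
by rewrite [in RHS]fimfunE -fsumEFin// [RHS]ge0_mule_fsuml// => r;
  rewrite EFinM nnfun_muleindic_ge0.
Qed.

(** Monotone approximation by simple functions extends [integral_density_nnsfun]. Both the normal
    law and [frac_measure] are reduced to Lebesgue measure in this way. *)
Lemma ge0_integral_density (f : T -> \bar R) :
  measurable_fun [set: T] f -> (forall x, 0 <= f x) ->
  \int[nu]_x f x = \int[mu]_x (f x * (g x)%:E).
Proof.
move=> mf f0; pose f_ := nnsfun_approx measurableT mf.
have fcvg x : (f_ n x)%:E @[n --> \oo] --> f x.
  exact: cvg_nnsfun_approx.
have mgE : measurable_fun [set: T] (EFin \o g) by exact/measurable_EFinP.
transitivity (lim (\int[nu]_x (f_ n x)%:E @[n --> \oo])).
  rewrite -monotone_convergence//=.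
  - by apply: eq_integral => x _; apply/esym/cvg_lim.
  - by move=> n; exact/measurable_EFinP/measurable_funTS.
  - by move=> n ? _; rewrite lee_fin.
  - by move=> ? _ ? ? mn; rewrite lee_fin; exact/lefP/nd_nnsfun_approx.
under eq_fun do rewrite integral_density_nnsfun.
rewrite -monotone_convergence//=.
- apply: eq_integral => x _; apply/cvg_lim => //.
  by under eq_fun do rewrite muleC; rewrite muleC; apply: cvgeZl.
- by move=> n; apply: emeasurable_funM => //;
    exact/measurable_EFinP/measurable_funTS.
- by move=> n x _; rewrite mule_ge0// lee_fin.
- move=> x _ m n mn; apply: lee_wpmul2r; first by rewrite lee_fin.
  by rewrite lee_fin; exact/lefP/nd_nnsfun_approx.
Qed.

Lemma integral_density (f : T -> \bar R) :
  measurable_fun [set: T] f ->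
  \int[nu]_x f x = \int[mu]_x (f x * (g x)%:E).
Proof.
move=> mf; rewrite !(integralE _ _ (fun x => f x)) [in RHS]integralE.
rewrite !ge0_integral_density//; last 2 first.
- exact: measurable_funeneg.
- exact: measurable_funepos.
(* Multiplication by [g x >= 0] commutes with taking positive and negative parts. *)
congr (_ - _); apply: eq_integral => x _.
- by rewrite [RHS]funeposE [in LHS]funeposE maxe_pMl ?lee_fin// mul0e.
- by rewrite [RHS]funenegE [in LHS]funenegE maxe_pMl ?lee_fin// mul0e mulNe.
Qed.

End density.

Section reflection.
Local Open Scope ereal_scope.
Context {R : realType}.
Local Notation mu := (@lebesgue_measure R).

(** Lebesgue measure is determined by its values on the intervals ]a, b], whose preimage [t - b, t -
    a[ has the same length. *)
Lemma lebesgue_measure_reflect (t : R) (A : set R) : measurable A ->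
  pushforward mu ((fun s => t - s)%R : _ -> measurableTypeR R) A = mu A.
Proof.
have mr : measurable_fun [set: measurableTypeR R]
    ((fun s => t - s)%R : measurableTypeR R -> measurableTypeR R).
  by apply: measurable_funB.
move=> mA; apply/esym/lebesgue_measure_unique => //= _ [[a b]] _ <-.
rewrite /pushforward.
rewrite (_ : _ @^-1` _ = `[t - b, t - a[%classic)%R; last first.
  apply/seteqP; split => x /=; rewrite !in_itv/=; lra.
rewrite !lebesgue_measure_itv/= !lte_fin.
have -> : (t - b < t - a)%R = (a < b)%R by apply/idP/idP; lra.
by case: ifPn => // _; rewrite -!EFinB; congr EFin; lra.
Qed.

(** This removes the convolution variable [t - s] once the integrand depends on it alone. *)
Lemma ge0_integral_reflect (t : R) (f : R -> \bar R) :
  measurable_fun [set: R] f -> (forall r, 0 <= f r) ->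
  \int[mu]_(s in `[0%R, t]) f (t - s)%R = \int[mu]_(s in `[0%R, t]) f s.
Proof.
move=> mf f0.
have mr : measurable_fun [set: measurableTypeR R]
    ((fun s => t - s)%R : measurableTypeR R -> measurableTypeR R).
  by apply: measurable_funB.
rewrite [in LHS](_ : `[0%R, t]%classic =
    ((fun s => t - s)%R : _ -> measurableTypeR R) @^-1` `[0%R, t]); last first.
  by apply/seteqP; split => x /=; rewrite !in_itv/=; lra.
rewrite -(ge0_integral_pushforward mr)//=; last exact: measurable_funS mf.
by apply: eq_measure_integral => //= A mA AS; exact/lebesgue_measure_reflect.
Qed.

End reflection.

(** Monotone convergence along an exhaustion. Integrals of powers over compact intervals of positive
    numbers thereby bound those that reach 0 or infinity. *)
Lemma ge0_integral_bigcup_le d (T : measurableType d) (R : realType)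
    (mu : {measure set T -> \bar R}) (F : (set T)^nat) (f : T -> \bar R) c :
  nondecreasing_seq F -> (forall n, measurable (F n)) ->
  (forall n, measurable_fun (F n) f) -> (forall n x, F n x -> 0 <= f x)%E ->
  (forall n, \int[mu]_(x in F n) f x <= c)%E ->
  (\int[mu]_(x in \bigcup_n F n) f x <= c)%E.
Proof.
move=> ndF mF mf f0 Fc.
have h := @ge0_nondecreasing_set_cvg_integral _ _ _ _ _ mu ndF mF mf f0.
by apply: (cvge_to_le h); exact: nearW.
Qed.

Section powR_integrals.
Context {R : realType}.
Local Notation mu := (@lebesgue_measure R).
Implicit Types a p x y u v : R.

Lemma ge0_measurable_powRE (D : set R) a :
  measurable_fun D (fun x => (x `^ a)%:E).
Proof. by apply/measurable_EFinP; apply: measurable_funTS; exact: measurable_powR. Qed.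

Lemma is_derive_powR_div a x : a + 1 != 0 -> 0 < x ->
  is_derive x 1 (fun y => y `^ (a + 1) / (a + 1)) (x `^ a).
Proof.
move=> a1 x0; have := is_derive1_powR (a + 1) x0.
move=> /(is_deriveZ (a + 1)^-1) h.
have -> : (fun y => y `^ (a + 1) / (a + 1)) =
          (a + 1)^-1 \*: (@powR R ^~ (a + 1)).
  by apply/funext => y /=; rewrite mulrC.
apply: is_derive_eq h _.
by rewrite /GRing.scale /= mulrA mulVf// mul1r addrK.
Qed.

Lemma integral_powR a u v : a + 1 != 0 -> 0 < u -> u <= v ->
  (\int[mu]_(x in `[u, v]) (x `^ a)%:E =
   ((v `^ (a + 1) - u `^ (a + 1)) / (a + 1))%:E)%E.
Proof.
move=> a1 u0; rewrite le_eqVlt => /predU1P[<-|uv].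
  by rewrite set_itv1 integral_set1 subrr mul0r.
have cts b x : 0 < x -> {for x, continuous (fun y : R => y `^ b)}.
  move=> x0; have := is_derive1_powR b x0 => -[d _].
  by apply: differentiable_continuous; exact/derivable1_diffP.
have ctsF x : 0 < x -> {for x, continuous (fun y : R => y `^ (a + 1) / (a + 1))}.
  by move=> x0; apply: cvgMr_tmp; exact: cts.
rewrite (@continuous_FTC2 _ _ (fun y => y `^ (a + 1) / (a + 1)))//.
- by rewrite -EFinB mulrBl.
- apply: continuous_in_subspaceT => x; rewrite inE/= in_itv/= => /andP[ux _].
  by apply: cts; exact: lt_le_trans ux.
- split.
  + move=> x; rewrite in_itv/= => /andP[ux _].
    by have [] := is_derive_powR_div a1 (lt_trans u0 ux).
  + by apply: cvg_at_right_filter; exact: ctsF.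
  + by apply: cvg_at_left_filter; apply: ctsF; exact: lt_trans uv.
- move=> x; rewrite in_itv/= => /andP[ux _]; rewrite derive1E.
  by have [_ ->] := is_derive_powR_div a1 (lt_trans u0 ux).
Qed.

Lemma integral_powR_near0 a x : -1 < a -> 0 < x ->
  (\int[mu]_(y in `]0%R, x]) (y `^ a)%:E <= (x `^ (a + 1) / (a + 1))%:E)%E.
Proof.
move=> a1 x0; have a10 : 0 < a + 1 by lra.
pose F (n : nat) := `[x / n.+1%:R, x]%classic.
have F0 n : 0 < x / n.+1%:R by rewrite divr_gt0.
have -> : `]0, x]%classic = \bigcup_n F n.
  apply/seteqP; split => y /=; rewrite in_itv/=.
    move=> /andP[y0 yx]; exists (Num.bound (x / y)) => //.
    rewrite /F/= in_itv/= yx andbT ler_pdivrMr// mulrC -ler_pdivrMr//.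
    rewrite (le_trans (ltW (archi_boundP _)))//; first by rewrite divr_ge0 ?ltW.
    by rewrite ler_nat.
  move=> [n _]; rewrite /F/= in_itv/= => /andP[xy ->]; rewrite andbT.
  exact: lt_le_trans xy.
apply: (@ge0_integral_bigcup_le _ _ _ mu F (fun y => (y `^ a)%:E)).
- apply/nondecreasing_seqP => n; apply/subsetPset => y; rewrite /F/= !in_itv/=.
  move=> /andP[h ->]; rewrite andbT; apply: le_trans h.
  by rewrite ler_pM2l// lef_pV2 ?posrE// ler_nat.
- by move=> n; exact: measurable_itv.
- by move=> n; exact: ge0_measurable_powRE.
- by move=> n y _; rewrite lee_fin powR_ge0.
- move=> n; rewrite integral_powR ?gt_eqF//; last first.
    by rewrite ler_pdivrMr// ler_pMr// ler1n.
  by rewrite lee_fin ler_pM2r ?invr_gt0// lerBlDr lerDl powR_ge0.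
Qed.

Lemma integral_powR_nearoo a x : a < -1 -> 0 < x ->
  (\int[mu]_(y in `[x, +oo[) (y `^ a)%:E <= (x `^ (a + 1) / (- (a + 1)))%:E)%E.
Proof.
move=> a1 x0; have a10 : a + 1 < 0 by lra.
pose F (n : nat) := `[x, x + n%:R]%classic.
have -> : `[x, +oo[%classic = \bigcup_n F n.
  apply/seteqP; split => y /=; rewrite in_itv/=.
    move=> /andP[xy _]; exists (Num.bound (y - x)) => //.
    rewrite /F/= in_itv/= xy/= -lerBlDl ltW// archi_boundP//.
    by rewrite subr_ge0.
  by move=> [n _]; rewrite /F/= in_itv/= andbT => /andP[].
apply: (@ge0_integral_bigcup_le _ _ _ mu F (fun y => (y `^ a)%:E)).
- apply/nondecreasing_seqP => n; apply/subsetPset => y; rewrite /F/= !in_itv/=.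
  move=> /andP[-> h] /=; apply: le_trans h _.
  by rewrite lerD2l ler_nat.
- by move=> n; exact: measurable_itv.
- by move=> n; exact: ge0_measurable_powRE.
- by move=> n y _; rewrite lee_fin powR_ge0.
- move=> n; rewrite integral_powR ?lt_eqF ?lerDl//.
  rewrite lee_fin invrN mulrN -mulNr ler_nM2r ?invr_lt0// lerBrDr.
  by rewrite addrC subrr powR_ge0.
Qed.

(** After inversion the claim is x^p <= exp x. For [p] in [0, 1], x^p is at most 1 or at most x,
    hence at most 1 + x. *)
Lemma expRN_le_powR x p : 0 < x -> 0 <= p <= 1 -> expR (- x) <= x `^ (- p).
Proof.
move=> x0 /andP[p0 p1]; rewrite expRN powRN lef_pV2 ?posrE ?expR_gt0 ?powR_gt0//.
apply: (@le_trans _ _ (1 + x)); last exact: expR_ge1Dx.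
have [x1|x1] := leP x 1.
  apply: (@le_trans _ _ 1); last by rewrite lerDl ltW.
  rewrite (_ : 1 = 1 `^ p); last by rewrite powR1.
  by apply: ge0_ler_powR => //; rewrite nnegrE ?ltW.
by rewrite (le_trans (ler1_powR (ltW x1) p1))// lerDr.
Qed.

End powR_integrals.

(** * Moments of increments and the Ito isometry *)

Section normal_moments.
Context {R : realType}.
Local Notation mu := (@lebesgue_measure R).

Lemma ge0_integral_normal (s : R) (f : R -> \bar R) :
  measurable_fun [set: R] f -> (forall x, 0 <= f x)%E ->
  (\int[normal_prob 0 s]_x f x = \int[mu]_x (f x * (normal_pdf 0 s x)%:E))%E.
Proof.
move=> mf f0; apply: ge0_integral_density => //.
- exact: measurable_normal_pdf.
- exact: normal_pdf_ge0.
Qed.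

Lemma ge0_integralN (f : R -> \bar R) :
  measurable_fun [set: R] f -> (forall x, 0 <= f x)%E ->
  (\int[mu]_x f x = \int[mu]_x f (- x)%R)%E.
Proof.
move=> mf f0.
transitivity (\int[pushforward mu (-%R : R -> measurableTypeR R)]_x f x)%E.
  by apply: eq_measure_integral => A mA _; exact/esym/lebesgue_measureN.
by rewrite ge0_integral_pushforward.
Qed.

(** Half of the Gaussian exponent absorbs the factor x^2; the other half is, up to a constant, the
    density with variance 2 s^2. *)
Lemma normal_sqr_lty (s : R) : s != 0 ->
  (\int[normal_prob 0 s]_x (x ^+ 2)%:E < +oo)%E.
Proof.
move=> s0; have s20 : 0 < s ^+ 2 by rewrite exprn_even_gt0.
have r20 : Num.sqrt 2 * s != 0 by rewrite mulf_neq0// gt_eqF// sqrtr_gt0.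
have r2s : (Num.sqrt 2 * s) ^+ 2 = 2 * s ^+ 2 by rewrite exprMn sqr_sqrtr.
rewrite ge0_integral_normal//; last 2 first.
- by apply/measurable_EFinP; exact: measurable_funX.
- by move=> x; rewrite lee_fin sqr_ge0.
have pk0 := normal_peak_gt0 r20.
(* From x^2 exp(- x^2 / (4 s^2)) <= 4 s^2; the quotient exchanges the normalizing factors of the two
   densities. *)
pose C := 4 * s ^+ 2 * normal_peak s / normal_peak (Num.sqrt 2 * s).
have C0 : 0 <= C.
  apply: divr_ge0; last exact: normal_peak_ge0.
  by apply: mulr_ge0; [rewrite mulr_ge0 ?sqr_ge0|exact: normal_peak_ge0].
apply: (@le_lt_trans _ _
    (\int[mu]_x (C%:E * (normal_pdf 0 (Num.sqrt 2 * s) x)%:E))%E).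
  apply: ge0_le_integral => //.
  - by move=> x _; rewrite mule_ge0// lee_fin ?sqr_ge0 ?normal_pdf_ge0.
  - apply: emeasurable_funM; first by apply/measurable_EFinP; exact: measurable_funX.
    by apply/measurable_EFinP; exact: measurable_normal_pdf.
  - apply: emeasurable_funM => //.
    by apply/measurable_EFinP; exact: measurable_normal_pdf.
  - move=> x _; rewrite -!EFinM lee_fin !normal_pdfE// /C.
    rewrite mulrA [leRHS]mulrA divfK ?gt_eqF// ![_ * normal_peak s * _]mulrAC.
    rewrite ler_wpM2r ?normal_peak_ge0//.
    have -> : normal_fun 0 s x =
        expR (- (x ^+ 2 / (4 * s ^+ 2))) * normal_fun 0 (Num.sqrt 2 * s) x.
      rewrite /normal_fun r2s subr0 -expRD; congr expR.
      rewrite !mulr2n; field; apply/and3P; split => //; rewrite gt_eqF//; lra.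
    rewrite mulrA ler_wpM2r ?expR_ge0// expRN ler_pdivrMr ?expR_gt0//.
    have s40 : 0 < 4 * s ^+ 2 by rewrite mulr_gt0.
    rewrite -ler_pdivrMl// mulrC (le_trans _ (expR_ge1Dx _))//.
    by rewrite lerDr.
rewrite ge0_integralZl//; last 2 first.
- by apply/measurable_EFinP; exact: measurable_normal_pdf.
- by move=> x _; rewrite lee_fin normal_pdf_ge0.
by rewrite integral_normal_pdf mule1 ltry.
Qed.

Lemma normal_integrable_sqr (s : R) : s != 0 ->
  (normal_prob 0 s).-integrable [set: R] (fun x => (x ^+ 2)%:E).
Proof.
move=> s0; apply/integrableP; split.
  by apply/measurable_EFinP; exact: measurable_funX.
under eq_integral do rewrite gee0_abs ?lee_fin ?sqr_ge0//.
exact: normal_sqr_lty.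
Qed.

Lemma normal_integrable_id (s : R) : s != 0 ->
  (normal_prob 0 s).-integrable [set: R] (fun x => x%:E).
Proof.
move=> s0; have : (normal_prob 0 s).-integrable [set: R]
    (fun x => (1 + x ^+ 2)%:E).
  under eq_fun do rewrite EFinD.
  apply: integrableD => //; last exact: normal_integrable_sqr.
  exact: finite_measure_integrable_cst.
apply: le_integrable => //; first exact/measurable_EFinP.
move=> x _; rewrite lee_fin [leRHS]ger0_norm; last by rewrite addr_ge0 ?sqr_ge0.
by rewrite ler_norml; nra.
Qed.

(** By reflection the positive and negative parts have the same integral, which is finite, so the
    difference of the two is meaningful and vanishes. *)
Lemma normal_mean0 (s : R) : s != 0 -> (\int[normal_prob 0 s]_x x%:E = 0)%E.
Proof.
move=> s0; rewrite integralE.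
have mE : measurable_fun [set: R] (@EFin R) by exact/measurable_EFinP.
have := integrable_pos_fin_num measurableT (normal_integrable_id s0).
rewrite !ge0_integral_normal//; last 2 first.
- exact: measurable_funeneg.
- exact: measurable_funepos.
rewrite ge0_integralN; last 2 first.
- apply: emeasurable_funM; first exact: measurable_funepos.
  by apply/measurable_EFinP; exact: measurable_normal_pdf.
- by move=> x; rewrite mule_ge0// lee_fin normal_pdf_ge0.
set a := (X in (X - _)%E); set b := (X in (_ - X)%E).
have ab : a = b.
  apply: eq_integral => x _; rewrite funeposE funenegE !normal_pdfE//.
  by rewrite /normal_fun !subr0 sqrrN EFinN.
by move=> afin; rewrite -ab subee.
Qed.

(** The number 1, kept as a nonnegative symbol that enters the final constant. *)
Definition normal_second_moment : R :=
  fine (\int[normal_prob 0 (1 : R)]_x (x ^+ 2)%:E)%E.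

Lemma normal_second_moment_ge0 : 0 <= normal_second_moment.
Proof. by apply: fine_ge0; apply: integral_ge0 => x _; rewrite lee_fin sqr_ge0. Qed.

(** The substitution x / s turns the centred normal density of standard deviation [s] into the
    standard one. *)
Lemma normal_variance (s : R) : 0 < s ->
  (\int[normal_prob 0 s]_x (x ^+ 2)%:E = (s ^+ 2 * normal_second_moment)%:E)%E.
Proof.
move=> s0; have s1 : s^-1 * s = 1 by rewrite mulVf// gt_eqF.
have mX : measurable_fun [set: R] (fun x => (x ^+ 2)%:E).
  by apply/measurable_EFinP; exact: measurable_funX.
rewrite EFinM /normal_second_moment fineK; last first.
  by rewrite ge0_fin_numE ?normal_sqr_lty ?oner_neq0//;
    apply: integral_ge0 => x _; rewrite lee_fin sqr_ge0.
have X0 x : (0 <= (x ^+ 2)%:E :> \bar R)%E by rewrite lee_fin sqr_ge0.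
rewrite !ge0_integral_normal//.
rewrite -ge0_integralZl//; last 2 first.
- apply: emeasurable_funM => //.
  by apply/measurable_EFinP; exact: measurable_normal_pdf.
- by move=> x _; rewrite mule_ge0// lee_fin normal_pdf_ge0.
pose F (x : R) := s^-1 * x.
have dF (x : R) : is_derive x 1 F s^-1.
  rewrite /F; apply: is_derive_eq.
  by rewrite /GRing.scale/= mulr1.
have F'E : F^`()%classic = cst s^-1.
  by apply/funext => x; rewrite derive1E; have [_ ->] := dF x.
pose G (x : R) := s ^+ 2 * (x ^+ 2 * normal_pdf 0 1 x).
transitivity (\int[mu]_x (G x)%:E)%E; last by [].
rewrite (@increasing_ge0_integration_by_substitutionT _ F G).
- apply: eq_integral => x _; rewrite F'E/= -EFinM; congr EFin.
  rewrite /G /F /= !normal_pdfE ?gt_eqF//.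
  have -> : normal_peak s = normal_peak 1 * s^-1.
    rewrite /normal_peak expr1n mul1r -invfM -mulrnAr sqrtrM ?sqr_ge0//.
    by rewrite sqrtr_sqr gtr0_norm// mulrC.
  have -> : normal_fun 0 s x = normal_fun 0 1 (s^-1 * x).
    rewrite /normal_fun !subr0 expr1n; congr expR; rewrite !mulr2n.
    by field; rewrite ?gt_eqF//; do ?[apply/andP; split]; rewrite ?gt_eqF//; nra.
  by rewrite !fctE /=; field; rewrite gt_eqF.
- by move=> x y xy; rewrite /F ltr_pM2l// invr_gt0.
- by rewrite F'E => x; exact: cvg_cst.
- by rewrite F'E; exact: is_cvg_cst.
- by rewrite F'E; exact: is_cvg_cst.
- by move=> x; have [] := dF x.
- by apply: gt0_cvgMrNy; [rewrite invr_gt0|exact: cvg_id].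
- by apply: gt0_cvgMry; [rewrite invr_gt0|exact: cvg_id].
- move=> x; apply: cvgMl_tmp; apply: cvgM.
    exact: exprn_continuous.
  by apply: continuous_normal_pdf; exact: oner_neq0.
- by move=> x; apply: mulr_ge0; rewrite ?sqr_ge0// mulr_ge0 ?sqr_ge0 ?normal_pdf_ge0.
Qed.

End normal_moments.

(** * Independence and product laws *)

Section independence.
Local Open Scope ereal_scope.
Context d (T : measurableType d) d2 (T2 : measurableType d2) (R : realType).
Variables (P : probability T R) (N : probability T2 R).
Variables (Z : {mfun T >-> R}) (D : {mfun T >-> T2}).
Hypothesis indep : forall (A : set R) (B : set T2), measurable A -> measurable B ->
  P (Z @^-1` A `&` D @^-1` B) = P (Z @^-1` A) * N B.

Definition pair_rv (w : T) : R * T2 := (Z w, D w).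

Lemma measurable_pair_rv : measurable_fun [set: T] pair_rv.
Proof. by apply: measurable_fun_pair. Qed.

HB.instance Definition _ := isMeasurableFun.Build _ _ _ _ _ measurable_pair_rv.

(** Independence fixes the joint law on rectangles, and a product measure is determined there.
    Tonelli and Fubini then give the integral formulas of this section. *)
Lemma joint_law X : measurable X ->
  (distribution P Z \x N) X = pushforward P pair_rv X.
Proof.
apply: product_measure_unique => A B mA mB.
by rewrite -indep.
Qed.

Lemma ge0_integral_indep (f : R * T2 -> \bar R) :
  measurable_fun [set: R * T2] f ->
  (forall x, 0 <= f x) ->
  \int[P]_w f (Z w, D w) = \int[P]_w \int[N]_y f (Z w, y).
Proof.
move=> mf f0.
transitivity (\int[pushforward P pair_rv]_z f z).
  by rewrite ge0_integral_pushforward.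
transitivity (\int[distribution P Z \x N]_z f z).
  by apply: eq_measure_integral => A mA _; exact/esym/joint_law.
rewrite fubini_tonelli1// ge0_integral_distribution//.
  exact: measurable_fun_fubini_tonelli_F.
by move=> y; exact: integral_ge0.
Qed.

Variables (h : T2 -> R).
Hypotheses (mh : measurable_fun [set: T2] h)
  (iZ : P.-integrable [set: T] (EFin \o Z))
  (ih : N.-integrable [set: T2] (EFin \o h)).

Let f (z : R * T2) : \bar R := (z.1 * h z.2)%:E.

Let mf : measurable_fun [set: R * T2] f.
Proof.
apply/measurable_EFinP; apply: measurable_funM; first exact: measurable_fst.
by apply: measurableT_comp => //; exact: measurable_snd.
Qed.

Lemma integrable_indep :
  P.-integrable [set: T] (fun w => (Z w * h (D w))%:E).
Proof.
apply/integrableP; split.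
  apply/measurable_EFinP; apply: measurable_funM => //.
  exact: measurableT_comp.
rewrite (ge0_integral_indep (f := abse \o f))//=; last first.
  exact: measurableT_comp.
under eq_integral => w _.
  under eq_integral do rewrite normrM EFinM.
  rewrite ge0_integralZl_EFin//; last first.
    by apply/measurable_EFinP; exact: measurableT_comp.
  over.
move/integrableP : iZ => [_ iZ']; move/integrableP : ih => [mhE ih'].
rewrite ge0_integralZr//.
- by rewrite lte_mul_pinfty//; [exact: integral_ge0|rewrite ge0_fin_numE//; exact: integral_ge0].
- by apply/measurable_EFinP; exact: measurableT_comp.
- exact: integral_ge0.
Qed.

Lemma integral_indep :
  \int[P]_w (Z w * h (D w))%:E = \int[P]_w (Z w)%:E * \int[N]_y (h y)%:E.
Proof.
have iP : (pushforward P pair_rv).-integrable setT f.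
  by apply: integrable_pushforward => //; exact: integrable_indep.
transitivity (\int[pushforward P pair_rv]_z f z).
  by rewrite integral_pushforward//; exact: integrable_indep.
transitivity (\int[distribution P Z \x N]_z f z).
  by apply: eq_measure_integral => A mA _; exact/esym/joint_law.
have iPN : (distribution P Z \x N).-integrable setT f.
  move/integrableP : iP => [_ ifp]; apply/integrableP; split => //.
  apply: le_lt_trans ifp; rewrite le_eqVlt; apply/orP; left; apply/eqP.
  by apply: eq_measure_integral => A mA _; exact/joint_law.
rewrite -integral12_prod_meas1//.
have hf : \int[N]_y (h y)%:E \is a fin_num by exact: integrable_fin_num.
rewrite (eq_integral (fun x : R => x%:E * \int[N]_y (h y)%:E)); last first.
  by move=> z _; rewrite -integralZl.
rewrite -(fineK hf) integralZr//; last first.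
  by apply: integrable_pushforward.
by rewrite integral_distribution.
Qed.

End independence.

(** This passes from unbundled measurability to the bundled functions on which the independence
    lemmas are stated. *)
Lemma mfun_of_measurable d d' (T : measurableType d) (T' : measurableType d')
    (f : T -> T') : measurable_fun [set: T] f ->
  exists g : {mfun T >-> T'}, g = f :> (T -> T').
Proof.
by move=> mf; exists
  (MeasurableFun.Pack (MeasurableFun.Class (isMeasurableFun.Build _ _ _ _ _ mf))).
Qed.

Section sub_sigma_algebra.
Context d (T : measurableType d) (R : realType).
Variable F : set (set T).
Hypothesis sF : sigma_algebra [set: T] F.

Definition submeas (Z : T -> R) := forall S : set R, measurable S -> F (Z @^-1` S).

(** Since [F] is already a sigma-algebra, the one it generates is [F] itself; the algebraic closure
    properties of [submeas] follow from ordinary measurability. *)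
Lemma submeasP (Z : T -> R) :
  submeas Z <-> measurable_fun [set: g_sigma_algebraType F] Z.
Proof.
have mE : @measurable _ (g_sigma_algebraType F) = F.
  exact: sigma_algebra_id.
split => [h _ S mS|h S mS]; first by rewrite setTI mE; exact: h.
by have := h measurableT S mS; rewrite setTI mE.
Qed.

Lemma submeasM (Z Z' : T -> R) : submeas Z -> submeas Z' ->
  submeas (fun w => Z w * Z' w).
Proof. by rewrite !submeasP => mZ mZ'; exact: measurable_funM. Qed.

Lemma submeasB (Z Z' : T -> R) : submeas Z -> submeas Z' ->
  submeas (fun w => Z w - Z' w).
Proof. by rewrite !submeasP => mZ mZ'; exact: measurable_funB. Qed.

Lemma submeasN (Z : T -> R) : submeas Z -> submeas (fun w => - Z w).
Proof. by rewrite !submeasP => mZ; exact: measurableT_comp. Qed.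

End sub_sigma_algebra.

Section has_mean.
Context d (T : measurableType d) (R : realType) (P : {measure set T -> \bar R}).

(** Integrability is carried along with the value, so that double sums of products of increments can
    be averaged term by term. *)
Definition has_mean (X : T -> R) (v : R) :=
  P.-integrable [set: T] (EFin \o X) /\ (\int[P]_w (X w)%:E = v%:E)%E.

Lemma eq_has_mean (X Y : T -> R) (u v : R) : X =1 Y -> u = v ->
  has_mean X u -> has_mean Y v.
Proof. by move=> /funext -> ->. Qed.

Lemma has_meanD (X Y : T -> R) (u v : R) : has_mean X u -> has_mean Y v ->
  has_mean (fun w => X w + Y w) (u + v).
Proof.
move=> [iX EX] [iY EY]; split; first exact: (integrableD measurableT iX iY).
by under eq_integral do rewrite EFinD; rewrite integralD// EX EY.
Qed.

Lemma has_meanZ (X : T -> R) (u k : R) : has_mean X u ->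
  has_mean (fun w => k * X w) (k * u).
Proof.
move=> [iX EX]; split; first exact: (integrableZl measurableT k iX).
by under eq_integral do rewrite EFinM; rewrite integralZl// EX.
Qed.

Lemma has_mean0 : has_mean (fun=> 0) 0.
Proof. by split; [exact: integrable0|exact: integral0]. Qed.

Lemma has_mean_sum I (r : seq I) (X : I -> T -> R) (u : I -> R) :
  (forall i, has_mean (X i) (u i)) ->
  has_mean (fun w => \sum_(i <- r) X i w) (\sum_(i <- r) u i).
Proof.
move=> h; elim: r => [|i r IH].
  by apply: eq_has_mean has_mean0 => [w|]; rewrite big_nil.
by apply: eq_has_mean (has_meanD (h i) IH) => [w|]; rewrite big_cons.
Qed.

End has_mean.

Section scalar_brownian.
Context {R : realType} {dO : measure_display} {Omega : measurableType dO}.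
Variable P : probability Omega R.
Variable Ft : R -> set (set Omega).
Hypothesis Ft_filtration : is_filtration Ft.
Variable B : R -> Omega -> R.
Hypothesis B_adapted : forall t, 0 <= t -> submeas (Ft t) (B t).
Hypothesis B_increments : forall s t, 0 <= s -> s < t ->
  forall (A : set Omega) (S : set R), Ft s A -> measurable S ->
  P (A `&` (fun w => B t w - B s w) @^-1` S) =
  (P A * normal_prob 0 (Num.sqrt (t - s)) S)%E.

Local Notation V := (@normal_second_moment R).
Local Notation has_mean := (has_mean P).

Lemma Ft_sigma t : 0 <= t -> sigma_algebra [set: Omega] (Ft t).
Proof. by move=> t0; have [/(_ t t0)[]] := Ft_filtration. Qed.

Lemma submeas_mono s t (Z : Omega -> R) : 0 <= s -> s <= t ->
  submeas (Ft s) Z -> submeas (Ft t) Z.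
Proof.
by move=> s0 st mZ S mS; have [_ h] := Ft_filtration; exact/(h s)/mZ.
Qed.

Lemma submeas_measurable t (Z : Omega -> R) : 0 <= t ->
  submeas (Ft t) Z -> measurable_fun [set: Omega] Z.
Proof.
move=> t0 mZ _ S mS; rewrite setTI.
by have [/(_ t t0)[_ h] _] := Ft_filtration; exact/h/mZ.
Qed.

Section increments.
Variables (s t : R) (Z : Omega -> R).
Hypotheses (s0 : 0 <= s) (mZ : submeas (Ft s) Z)
  (iZ : P.-integrable [set: Omega] (EFin \o Z)).

Let increments_law (h : R -> R) : s < t ->
  (normal_prob 0 (Num.sqrt (t - s))).-integrable [set: R] (EFin \o h) ->
  P.-integrable [set: Omega] (fun w => (Z w * h (B t w - B s w))%:E) /\
  (\int[P]_w (Z w * h (B t w - B s w))%:E =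
   \int[P]_w (Z w)%:E *
   \int[normal_prob 0 (Num.sqrt (t - s))]_y (h y)%:E)%E.
Proof.
move=> st ih; have t0 : 0 <= t by exact: le_trans (ltW st).
have mZ' := submeas_measurable s0 mZ.
have mD : measurable_fun [set: Omega] (fun w => B t w - B s w).
  by apply: measurable_funB;
    [apply: (@submeas_measurable t)|apply: (@submeas_measurable s)] => //;
    exact: B_adapted.
have [Z' Z'E] := mfun_of_measurable mZ'.
(* The normal law lives on [measurableTypeR R], so the increment is retyped before it is compared
   with that law. *)
have mD' : measurable_fun [set: Omega]
    ((fun w => B t w - B s w) : Omega -> measurableTypeR R) by exact: mD.
have [D DE] := mfun_of_measurable mD'.
have indep (A : set R) (A' : set (measurableTypeR R)) :
    measurable A -> measurable A' ->
    P (Z' @^-1` A `&` D @^-1` A') =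
    (P (Z' @^-1` A) * normal_prob 0 (Num.sqrt (t - s)) A')%E.
  by move=> mA mA'; rewrite Z'E DE; apply: B_increments => //; exact: mZ.
have mh : measurable_fun [set: measurableTypeR R] h.
  by move/measurable_int : ih => /measurable_EFinP.
pose N : probability (measurableTypeR R) R := normal_prob 0 (Num.sqrt (t - s)).
have iZ' : P.-integrable [set: Omega] (EFin \o Z') by rewrite Z'E.
have r1 := @integrable_indep _ _ _ _ _ P N Z' D indep h mh iZ' ih.
have r2 := @integral_indep _ _ _ _ _ P N Z' D indep h mh iZ' ih.
by rewrite Z'E DE in r1 r2.
Qed.

Let sqrt_neq0 : s < t -> Num.sqrt (t - s) != 0.
Proof. by move=> st; rewrite gt_eqF// sqrtr_gt0 subr_gt0. Qed.

Lemma increment_mean : s <= t -> has_mean (fun w => Z w * (B t w - B s w)) 0.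
Proof.
rewrite le_eqVlt => /predU1P[<-|st].
  by apply: eq_has_mean (has_mean0 P) => // w; rewrite subrr mulr0.
have [h1 h2] := @increments_law id st (normal_integrable_id (sqrt_neq0 st)).
by split => //; rewrite h2 normal_mean0 ?mule0// sqrt_neq0.
Qed.

Lemma increment_variance : s <= t ->
  has_mean (fun w => Z w * (B t w - B s w) ^+ 2)
    (V * (t - s) * fine (\int[P]_w (Z w)%:E)%E).
Proof.
rewrite le_eqVlt => /predU1P[<-|st].
  apply: eq_has_mean (has_mean0 P) => [w|]; rewrite subrr ?expr0n ?mulr0//.
  by rewrite mul0r.
have [h1 h2] := @increments_law (fun x => x ^+ 2) st
  (normal_integrable_sqr (sqrt_neq0 st)).
split => //; rewrite h2 normal_variance ?sqrtr_gt0 ?subr_gt0//.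
rewrite sqr_sqrtr ?subr_ge0 1?ltW// [in RHS]EFinM fineK; last exact: integrable_fin_num.
by rewrite muleC mulrC.
Qed.

End increments.

Definition bounded_fun (Z : Omega -> R) := exists c, forall w, `|Z w| <= c.

Lemma bounded_funM Z Z' : bounded_fun Z -> bounded_fun Z' ->
  bounded_fun (fun w => Z w * Z' w).
Proof.
move=> [c hc] [c' hc']; exists (c * c') => w; rewrite normrM.
exact: ler_pM.
Qed.

Lemma bounded_integrable t (Z : Omega -> R) : 0 <= t -> submeas (Ft t) Z ->
  bounded_fun Z -> P.-integrable [set: Omega] (EFin \o Z).
Proof.
move=> t0 mZ [c hc]; apply: (@le_integrable _ _ _ P _ measurableT _ (cst c%:E)).
- exact/measurable_EFinP/(submeas_measurable t0).
- by move=> w _; rewrite lee_fin (le_trans (hc w))// ler_norm.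
- exact: finite_measure_integrable_cst.
Qed.

(** The longer increment is the shorter one plus [B M - B m]. The first part gives the variance; the
    second is independent of the past at time [m] and contributes 0. *)
Lemma increments_cross c m M (Z : Omega -> R) : 0 <= c -> c <= m -> m <= M ->
  submeas (Ft c) Z -> bounded_fun Z ->
  has_mean (fun w => Z w * ((B m w - B c w) * (B M w - B c w)))
    (V * (m - c) * fine (\int[P]_w (Z w)%:E)%E).
Proof.
move=> c0 cm mM mZ bZ; have iZ := bounded_integrable c0 mZ bZ.
have m0 : 0 <= m by exact: le_trans cm.
have h1 := increment_variance c0 mZ iZ cm.
have [i2 _] := increment_mean c0 mZ iZ cm.
have mZm : submeas (Ft m) (fun w => Z w * (B m w - B c w)).
  apply: (submeasM (Ft_sigma m0)); first exact: submeas_mono mZ.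
  apply: (submeasB (Ft_sigma m0)); first exact: B_adapted.
  by apply: submeas_mono (B_adapted c0).
have h2 := increment_mean m0 mZm i2 mM.
apply: eq_has_mean (has_meanD h1 h2) => [w|]; last by rewrite addr0.
by rewrite expr2 -mulrA -mulrDr -mulrDr (addrC (B m w - _)) addrA subrK.
Qed.

(** The length of the intersection of [a, b] and [c, d]. *)
Definition overlap (a b c d : R) := Num.max 0 (Num.min b d - Num.max a c).

Lemma overlapC a b c d : overlap a b c d = overlap c d a b.
Proof. by rewrite /overlap (minC b) (maxC a). Qed.

(** The increment over [a, b] is cut at [c]: what happens before [c] averages to 0 against the later
    increment ([early]), and what happens after [c] produces the overlap ([late]). *)
Let pair_mean_le a b c d (xi eta : Omega -> R) : 0 <= a -> a <= b -> c <= d ->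
  a <= c -> submeas (Ft a) xi -> bounded_fun xi ->
  submeas (Ft c) eta -> bounded_fun eta ->
  has_mean (fun w => (xi w * (B b w - B a w)) * (eta w * (B d w - B c w)))
    (V * fine (\int[P]_w (xi w * eta w)%:E)%E * overlap a b c d).
Proof.
move=> a0 ab cd ac mxi bxi meta beta.
have c0 : 0 <= c by exact: le_trans ac.
have b0 : 0 <= b by exact: le_trans ab.
have mxi' : submeas (Ft c) xi by exact: submeas_mono mxi.
have mp : submeas (Ft c) (fun w => xi w * eta w) by exact: (submeasM (Ft_sigma c0)).
have bp := bounded_funM bxi beta.
have early m : a <= m -> m <= c ->
    has_mean (fun w => (xi w * eta w * (B m w - B a w)) * (B d w - B c w)) 0.
  move=> am mc; have m0 : 0 <= m by exact: le_trans am.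
  apply: increment_mean => //.
    apply: (submeasM (Ft_sigma c0)) => //; apply: (submeasB (Ft_sigma c0)).
      by apply: submeas_mono (B_adapted m0).
    by apply: submeas_mono (B_adapted a0).
  have [c' hc'] := beta.
  have ixi := bounded_integrable a0 mxi bxi.
  have [i1 _] := increment_mean a0 mxi ixi am.
  have meta' := submeas_measurable c0 meta.
  (* The increment is unbounded, so integrability comes from that of [xi] times the increment and
     from the bound [c'] on [eta]. *)
  apply: (@le_integrable _ _ _ P _ measurableT _
    (fun w => c'%:E * (xi w * (B m w - B a w))%:E)%E).
  - apply/measurable_EFinP; apply: measurable_funM.
      exact: submeas_measurable mp.
    by move/measurable_int : i1 => /measurable_EFinP mi1;
      apply: measurable_funB;
      [apply: (@submeas_measurable m)|apply: (@submeas_measurable a)] => //;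
      exact: B_adapted.
  - move=> w _; rewrite /= lee_fin !normrM mulrAC [leRHS]mulrC ler_wpM2l ?mulr_ge0//.
    by rewrite (le_trans (hc' w))// ler_norm.
  - exact: integrableZl.
have [bc|cb] := leP b c.
  apply: eq_has_mean (early b ab bc) => [w|]; first by ring.
  rewrite /overlap; have -> : Num.max 0 (Num.min b d - Num.max a c) = 0.
    by apply/max_idPl; rewrite subr_le0 (max_idPr ac) ge_min bc.
  by rewrite mulr0.
have late : has_mean (fun w => xi w * eta w * ((B b w - B c w) * (B d w - B c w)))
    (V * fine (\int[P]_w (xi w * eta w)%:E)%E * overlap a b c d).
  have ovE : overlap a b c d = Num.min b d - c.
    by rewrite /overlap (max_idPr ac); apply/max_idPr; rewrite subr_ge0 le_min ltW.
  have [bd|/ltW db] := leP b d.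
    have := increments_cross c0 (ltW cb) bd mp bp.
    by apply: eq_has_mean => //; rewrite ovE (min_idPl bd) mulrAC.
  have := increments_cross c0 cd db mp bp.
  apply: eq_has_mean => [w|]; first by rewrite (mulrC (B b w - _)).
  by rewrite ovE (min_idPr db) mulrAC.
apply: eq_has_mean (has_meanD (early c ac (lexx c)) late) => [w|]; last by rewrite add0r.
by ring.
Qed.

Lemma pair_mean a b c d (xi eta : Omega -> R) :
  0 <= a -> a <= b -> 0 <= c -> c <= d ->
  submeas (Ft a) xi -> bounded_fun xi ->
  submeas (Ft c) eta -> bounded_fun eta ->
  has_mean (fun w => (xi w * (B b w - B a w)) * (eta w * (B d w - B c w)))
    (V * fine (\int[P]_w (xi w * eta w)%:E)%E * overlap a b c d).
Proof.
move=> a0 ab c0 cd mxi bxi meta beta; have [ac|/ltW ca] := leP a c.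
  exact: pair_mean_le.
have := pair_mean_le c0 cd ab ca meta beta mxi bxi.
apply: eq_has_mean => [w|]; first by rewrite mulrC.
rewrite overlapC; congr (V * fine _ * _); apply: eq_integral => w _.
by rewrite mulrC.
Qed.

End scalar_brownian.

(** * Frobenius norm inequalities *)

Section frob_theory.
Context {R : realType}.

Lemma frob_sqrE m n (A : 'M[R]_(m, n)) :
  frob A ^+ 2 = \sum_i \sum_j A i j ^+ 2.
Proof.
by rewrite sqr_sqrtr// sumr_ge0// => i _; rewrite sumr_ge0// => j _; rewrite sqr_ge0.
Qed.

Lemma frob_ge0 m n (A : 'M[R]_(m, n)) : 0 <= frob A.
Proof. exact: sqrtr_ge0. Qed.

Lemma entry_le_frob m n (A : 'M[R]_(m, n)) i j : `|A i j| <= frob A.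
Proof.
rewrite -(ler_pXn2r (n := 2))// ?nnegrE ?frob_ge0// real_normK ?num_real//.
rewrite frob_sqrE (bigD1 i)//= (bigD1 j)//= -addrA lerDl.
rewrite addr_ge0 ?sumr_ge0// => *; rewrite ?sqr_ge0// sumr_ge0// => *.
by rewrite sqr_ge0.
Qed.

Lemma cauchy_schwarz_sum (I : finType) (a b : I -> R) :
  (\sum_i a i * b i) ^+ 2 <= (\sum_i a i ^+ 2) * (\sum_i b i ^+ 2).
Proof.
set A := \sum_i a i ^+ 2; set B := \sum_i b i ^+ 2; set S := \sum_i a i * b i.
have A0 : 0 <= A by apply: sumr_ge0 => i _; exact: sqr_ge0.
have quad (x y : R) : 0 <= x ^+ 2 * A + 2 * (x * y) * S + y ^+ 2 * B.
  have -> : x ^+ 2 * A + 2 * (x * y) * S + y ^+ 2 * B =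
      \sum_i (x * a i + y * b i) ^+ 2.
    rewrite !mulr_sumr -!big_split/=; apply: eq_bigr => i _; ring.
  by apply: sumr_ge0 => i _; exact: sqr_ge0.
have [A00|A_neq0] := eqVneq A 0; last first.
  have Agt0 : 0 < A by rewrite lt_def A_neq0.
  (* At this point the nonnegative quadratic form equals A (A B - S^2), and [A] can be divided
     out. *)
  have := quad S (- A).
  have -> : S ^+ 2 * A + 2 * (S * - A) * S + (- A) ^+ 2 * B = A * (A * B - S ^+ 2).
    by ring.
  by rewrite pmulr_rge0// subr_ge0.
have a0 i : a i = 0.
  have /psumr_eq0P : \sum_i a i ^+ 2 = 0 by [].
  move=> /(_ (fun i _ => sqr_ge0 _) i isT) /eqP.
  by rewrite sqrf_eq0 => /eqP.
rewrite A00 mul0r /S big1 ?expr0n// => i _.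
by rewrite a0 mul0r.
Qed.

Lemma sqr_sum_le n (a : 'I_n -> R) :
  (\sum_i a i) ^+ 2 <= n%:R * \sum_i a i ^+ 2.
Proof.
have := cauchy_schwarz_sum (fun=> 1) a.
under eq_bigr do rewrite mul1r.
by under [X in _ <= X * _ -> _]eq_bigr do rewrite expr1n;
  rewrite sumr_const card_ord.
Qed.

Lemma frob_mulmx_sqr m n p (A : 'M[R]_(m, n)) (B : 'M[R]_(n, p)) :
  frob (A *m B) ^+ 2 <= frob A ^+ 2 * frob B ^+ 2.
Proof.
rewrite !frob_sqrE mulr_suml; apply: ler_sum => i _.
rewrite exchange_big /= mulr_sumr; apply: ler_sum => j _.
by rewrite mxE; exact: cauchy_schwarz_sum.
Qed.

Lemma frobN m n (A : 'M[R]_(m, n)) : frob (- A) = frob A.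
Proof.
by congr Num.sqrt; apply: eq_bigr => i _; apply: eq_bigr => j _;
  rewrite mxE sqrrN.
Qed.

Lemma frob0 m n : frob (0 : 'M[R]_(m, n)) = 0.
Proof.
rewrite /frob big1 ?sqrtr0// => i _; rewrite big1// => j _.
by rewrite mxE expr0n.
Qed.

Lemma frobD_sqr m n (A B : 'M[R]_(m, n)) :
  frob (A + B) ^+ 2 <= 2 * frob A ^+ 2 + 2 * frob B ^+ 2.
Proof.
rewrite !frob_sqrE !mulr_sumr -big_split; apply: ler_sum => i _ /=.
rewrite !mulr_sumr -big_split; apply: ler_sum => j _ /=.
rewrite mxE -subr_ge0; have -> : 2 * A i j ^+ 2 + 2 * B i j ^+ 2 -
  (A i j + B i j) ^+ 2 = (A i j - B i j) ^+ 2 by ring.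
exact: sqr_ge0.
Qed.

Lemma frobD3_sqr m n (A B C : 'M[R]_(m, n)) :
  frob (A + B + C) ^+ 2 <= 3 * frob A ^+ 2 + 3 * frob B ^+ 2 + 3 * frob C ^+ 2.
Proof.
rewrite !frob_sqrE !mulr_sumr -!big_split; apply: ler_sum => i _ /=.
rewrite !mulr_sumr -!big_split; apply: ler_sum => j _ /=.
rewrite !mxE -subr_ge0.
have -> : 3 * A i j ^+ 2 + 3 * B i j ^+ 2 + 3 * C i j ^+ 2 -
    (A i j + B i j + C i j) ^+ 2 =
    (A i j - B i j) ^+ 2 + (B i j - C i j) ^+ 2 + (A i j - C i j) ^+ 2 by ring.
by rewrite !addr_ge0// sqr_ge0.
Qed.

End frob_theory.

Section joint_measurability.
Local Open Scope ereal_scope.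
Context {R : realType} {d : measure_display} {T : measurableType d}.
Variable P : probability T R.
Local Notation mu := (@lebesgue_measure R).
Variables (D : set R) (mD : measurable D).
Variable f : R -> T -> \bar R.
Hypothesis mf : measurable_fun (D `*` [set: T]) (fun p : R * T => f p.1 p.2).
Hypothesis f0 : forall s w, 0 <= f s w.

(** Joint measurability is assumed on [D] only; the extension by 0 to the whole product makes
    Tonelli's theorem applicable. *)
Let g (p : measurableTypeR R * T) := ((fun p : R * T => f p.1 p.2) \_ (D `*` [set: T])) p.

Let mg : measurable_fun [set: measurableTypeR R * T] g.
Proof.
apply: (measurable_restrictT _ _).1; last exact: mf.
by apply: measurableX; [exact: mD|exact: measurableT].
Qed.

Let g0 p : 0 <= g p.
Proof. by apply: erestrict_ge0 => *; exact: f0. Qed.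

Let gE1 w : \int[mu]_(s in D) f s w = \int[mu]_s g (s, w).
Proof.
rewrite integral_mkcond; apply: eq_integral => s _; rewrite /g !patchE.
by congr (if _ then _ else _); apply/idP/idP => [/set_mem|/set_mem[]];
  rewrite ?inE.
Qed.

Let gE2 : (fun s => \int[P]_w g (s, w)) = (fun s => \int[P]_w f s w) \_ D.
Proof.
apply/funext => s; rewrite patchE /g; case: ifPn => sD.
  apply: eq_integral => w _; rewrite patchE ifT// inE; split => //.
  exact: set_mem.
apply: integral0_eq => w _; rewrite patchE ifF//; apply/negbTE.
by apply: contra sD => /set_mem[]; rewrite inE.
Qed.

Lemma measurable_section_time : measurable_fun [set: T] (fun w => \int[mu]_(s in D) f s w).
Proof.
under eq_fun do rewrite gE1.
exact: (measurable_fun_fubini_tonelli_G (m1 := mu) g mg g0).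
Qed.

Lemma measurable_section_prob : measurable_fun D (fun s => \int[P]_w f s w).
Proof.
apply/(measurable_restrictT _ mD); rewrite -gE2.
exact: (measurable_fun_fubini_tonelli_F (m2 := P) g mg g0).
Qed.

Lemma tonelli_time : \int[P]_w \int[mu]_(s in D) f s w = \int[mu]_(s in D) \int[P]_w f s w.
Proof.
under eq_integral do rewrite gE1.
rewrite [RHS]integral_mkcond -gE2; symmetry.
exact: (@fubini_tonelli _ _ _ _ R mu P g mg g0).
Qed.

End joint_measurability.

(** * Isometry for simple integrands *)

Section simple_isometry.
Context {R : realType} {dO : measure_display} {Omega : measurableType dO}.
Variable P : probability Omega R.
Variables (d : nat) (Ft : R -> set (set Omega)).
Hypothesis Ft_filtration : is_filtration Ft.
Variable W : R -> Omega -> 'cV[R]_d.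
Hypothesis W_brownian : brownian_motion P Ft W.
Local Notation mu := (@lebesgue_measure R).
Local Notation V := (@normal_second_moment R).

Lemma coordinate_adapted j t : 0 <= t -> submeas (Ft t) (fun w => W t w j 0).
Proof. by move=> t0 S mS; exact: (bm_adapted W_brownian). Qed.

Lemma coordinate_increments j s t : 0 <= s -> s < t ->
  forall (A : set Omega) (S : set R), Ft s A -> measurable S ->
  P (A `&` (fun w => W t w j 0 - W s w j 0) @^-1` S) =
  (P A * normal_prob 0 (Num.sqrt (t - s)) S)%E.
Proof.
move=> s0 st A S FA mS.
have := bm_increments W_brownian s0 st (B := fun i => if i == j then S else setT) FA.
rewrite (bigD1 j)//= eqxx big1 ?mule1; last first.
  by move=> i /negbTE ->; exact: probability_setT.
move=> <-; last by move=> i; case: ifP.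
congr (P (A `&` _)); apply/seteqP; split => w /=.
  by move=> Sw i _; case: eqP => [->|].
by move=> /(_ j I); rewrite eqxx.
Qed.

Variables (t : R) (t0 : 0 <= t) (i j : 'I_d).
Local Notation elem := (elementary d Ft).
Implicit Types (e f : elem) (Phi Psi : seq elem).

Let B s w := W s w j 0.
Let ta e := Num.min (el_start e) t.
Let tb e := Num.min (el_end e) t.
Let x e w := el_coef e w i j.
Let ov e f := overlap (ta e) (tb e) (ta f) (tb f).
Let dB e w := B (tb e) w - B (ta e) w.
Let m e f := fine (\int[P]_w (x e w * x f w)%:E)%E.

Let start0 e : 0 <= el_start e. Proof. by have /andP[] := el_times e. Qed.
Let start_end e : el_start e <= el_end e. Proof. by have /andP[] := el_times e. Qed.

Let ta_ge0 e : 0 <= ta e. Proof. by rewrite le_min start0 t0. Qed.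
Let ta_tb e : ta e <= tb e.
Proof. by rewrite /ta /tb le_min ge_min start_end/= ge_min lexx orbT. Qed.

Let x_bounded e : bounded_fun (x e).
Proof.
have [c hc] := el_bounded e; exists c => w.
exact: le_trans (entry_le_frob _ _ _) (hc w).
Qed.

Let x_submeas e : submeas (Ft (el_start e)) (x e).
Proof. by move=> S mS; exact: el_measurable. Qed.

Let x_measurable e : measurable_fun [set: Omega] (x e).
Proof. exact: (submeas_measurable Ft_filtration (start0 e) (x_submeas e)). Qed.

Let dB0 e : t <= el_start e -> dB e = fun=> 0.
Proof.
move=> te; apply/funext => w; rewrite /dB /ta /tb (min_idPr te).
by rewrite (min_idPr (le_trans te (start_end e))) subrr.
Qed.

Let ov0 e f : t <= el_start e -> ov e f = 0.
Proof.
move=> te; apply/max_idPl; rewrite subr_le0 /ta (min_idPr te).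
apply: (@le_trans _ _ t); last by rewrite le_max lexx.
by rewrite ge_min /tb ge_min lexx orbT.
Qed.

Let pair_mean_elem e f :
  has_mean P (fun w => (x e w * dB e w) * (x f w * dB f w)) (V * m e f * ov e f).
Proof.
(* An element that starts after [t] is truncated to start at [t], where its coefficient need not be
   measurable. Its increment and its overlaps vanish, so it is treated apart, and likewise for
   [f]. *)
have [te|et] := leP t (el_start e).
  apply: eq_has_mean (has_mean0 P) => [w|].
    by rewrite dB0// mulr0 mul0r.
  by rewrite ov0// mulr0.
have [tf|ft] := leP t (el_start f).
  apply: eq_has_mean (has_mean0 P) => [w|].
    by rewrite (dB0 tf) !mulr0.
  have -> : ov e f = ov f e by exact: overlapC.
  by rewrite ov0// mulr0.
have taE : ta e = el_start e by apply/min_idPl; exact: ltW.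
have tfE : ta f = el_start f by apply/min_idPl; exact: ltW.
apply: (@pair_mean _ _ _ P Ft Ft_filtration B) => //.
- by move=> s; exact: coordinate_adapted.
- by move=> s s'; exact: coordinate_increments.
- by rewrite taE.
- by rewrite tfE.
Qed.

Let integral_scalar_sqr Phi :
  has_mean P (fun w => (\sum_(e <- Phi) x e w * dB e w) ^+ 2)
    (V * \sum_(e <- Phi) \sum_(f <- Phi) m e f * ov e f).
Proof.
apply: eq_has_mean (has_mean_sum Phi (fun e =>
  has_mean_sum Phi (fun f => pair_mean_elem e f))) => [w|].
  by rewrite expr2 big_distrlr.
rewrite mulr_sumr; apply: eq_bigr => e _; rewrite mulr_sumr.
by apply: eq_bigr => f _; rewrite mulrA.
Qed.

Let process_scalar Phi s w :=
  \sum_(e <- Phi) (if el_start e < s <= el_end e then x e w else 0).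

(** The times up to [t] at which both elements are active. Its length is the overlap of the
    truncated intervals, which links the time integral to the covariances of the increments. *)
Let meet e f := `]Num.max (el_start e) (el_start f),
                  Num.min (Num.min (el_end e) (el_end f)) t]%classic.

Let mu_meet e f : mu (meet e f) = (ov e f)%:E.
Proof.
rewrite lebesgue_measure_itv/= /ov /overlap /ta /tb lte_fin.
rewrite -minACA minxx -min_maxl.
set M := Num.max _ _; set m' := Num.min _ t.
have m't : m' <= t by rewrite ge_min lexx orbT.
case: ltP => [Mm|mM].
  rewrite (min_idPl (le_trans (ltW Mm) m't)) -EFinB; congr EFin.
  by apply/esym/max_idPr; rewrite subr_ge0 ltW.
by congr EFin; apply/esym/max_idPl; rewrite subr_le0 le_min mM.
Qed.

Let process_scalar_sqr Phi w :
  (\int[mu]_(s in `[0%R, t]) (process_scalar Phi s w ^+ 2)%:E =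
   (\sum_(e <- Phi) \sum_(f <- Phi) x e w * x f w * ov e f)%:E)%E.
Proof.
have h e f : has_mean mu (fun s => \1_(meet e f) s) (ov e f).
  split; first exact: integrable_indic_itv.
  rewrite integral_indic//; first by rewrite setIT; exact: mu_meet.
  exact: measurable_itv.
have [_ <-] := has_mean_sum Phi (fun e =>
  has_mean_sum Phi (fun f => has_meanZ (x e w * x f w) (h e f))).
rewrite [LHS]integral_mkcond; apply: eq_integral => s _; rewrite patchE.
case: ifPn => [|/negP sD].
  rewrite inE/= in_itv/= => /andP[s0 st].
  congr EFin; rewrite expr2 big_distrlr/=; apply: eq_bigr => e _.
  apply: eq_bigr => f _; rewrite indicE.
  have -> : (s \in meet e f) =
      (el_start e < s <= el_end e) && (el_start f < s <= el_end f).
    rewrite mem_setE in_itv/= gt_max !le_min st andbT.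
    by rewrite andbACA.
  by do 2 case: ifP => _; rewrite /= ?mulr1 ?mulr0 ?mul0r.
rewrite big1// => e _; rewrite big1// => f _; rewrite indicE.
rewrite [s \in _](_ : _ = false) ?mulr0//; apply/negbTE/negP => /set_mem.
rewrite /meet/= in_itv/= gt_max !le_min => /andP[/andP[es _] /andP[_ st]].
by apply: sD; rewrite inE/= in_itv/= st andbT (le_trans (start0 e))// ltW.
Qed.

Let coef_mean Phi :
  has_mean P (fun w => \sum_(e <- Phi) \sum_(f <- Phi) x e w * x f w * ov e f)
    (\sum_(e <- Phi) \sum_(f <- Phi) m e f * ov e f).
Proof.
have h e f : has_mean P (fun w => x e w * x f w) (m e f).
  have ixx : P.-integrable [set: Omega] (EFin \o (fun w => x e w * x f w)).
    have [c hc] := bounded_funM (x_bounded e) (x_bounded f).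
    apply: (@le_integrable _ _ _ P _ measurableT _ (cst c%:E)).
    - by apply/measurable_EFinP; exact: measurable_funM.
    - by move=> w _; rewrite lee_fin (le_trans (hc w))// ler_norm.
    - exact: finite_measure_integrable_cst.
  by split => //; rewrite fineK//; exact: integrable_fin_num.
apply: has_mean_sum => e; apply: has_mean_sum => f.
by apply: eq_has_mean (has_meanZ (ov e f) (h e f)) => [w|]; rewrite mulrC.
Qed.

(** Both sides expand into the same double sum of [m e f * ov e f]: on the left by the covariances
    of increments, on the right by the lengths of common intervals. One matrix entry is paired with
    one coordinate of [W]. *)
Lemma simple_isometry Phi :
  (\int[P]_w ((\sum_(e <- Phi) el_coef e w i j *
      (W (Num.min (el_end e) t) w j 0 - W (Num.min (el_start e) t) w j 0)) ^+ 2)%:E =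
   V%:E * \int[P]_w \int[mu]_(s in `[0%R, t]) (simple_process Phi s w i j ^+ 2)%:E)%E.
Proof.
have [_ ->] := integral_scalar_sqr Phi.
rewrite EFinM; congr (_ * _)%E; have [_ <-] := coef_mean Phi.
apply: eq_integral => w _; rewrite -process_scalar_sqr; apply: eq_integral => s _.
congr (_ ^+ 2)%:E; rewrite /simple_process summxE; apply: eq_bigr => e _.
by case: ifP => // _; rewrite mxE.
Qed.

End simple_isometry.

Lemma ge0_integral_le3 d (T : measurableType d) (R : realType)
    (mu : {measure set T -> \bar R}) (D : set T) (k : R) (f f1 f2 f3 : T -> \bar R) :
  measurable D -> 0 <= k ->
  measurable_fun D f -> measurable_fun D f1 -> measurable_fun D f2 ->
  measurable_fun D f3 ->
  (forall x, D x -> 0 <= f x)%E -> (forall x, 0 <= f1 x)%E ->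
  (forall x, 0 <= f2 x)%E -> (forall x, 0 <= f3 x)%E ->
  (forall x, D x -> f x <= k%:E * (f1 x + f2 x + f3 x))%E ->
  (\int[mu]_(x in D) f x <= k%:E *
    (\int[mu]_(x in D) f1 x + \int[mu]_(x in D) f2 x + \int[mu]_(x in D) f3 x))%E.
Proof.
move=> mD k0 mf mf1 mf2 mf3 f0 f10 f20 f30 fle.
rewrite -!ge0_integralD//; last 2 first.
- by move=> x _; rewrite adde_ge0.
- exact: emeasurable_funD.
have m123 : measurable_fun D (fun x => f1 x + f2 x + f3 x)%E.
  by do 2 (apply: emeasurable_funD => //).
rewrite -ge0_integralZl_EFin//; last first.
  by move=> x _; rewrite !adde_ge0.
apply: ge0_le_integral => //.
by apply: emeasurable_funM.
Qed.

(** * Comparison of two Ito integrals *)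

Section ito_comparison.
Context {R : realType} {dO : measure_display} {Omega : measurableType dO}.
Variable P : probability Omega R.
Variables (d : nat) (Ft : R -> set (set Omega)).
Hypothesis Ft_filtration : is_filtration Ft.
Variable W : R -> Omega -> 'cV[R]_d.
Hypothesis W_brownian : brownian_motion P Ft W.
Local Notation mu := (@lebesgue_measure R).
Local Notation V := (@normal_second_moment R).
Variables (t : R) (t0 : 0 <= t).
Local Notation elem := (elementary d Ft).
Implicit Types (e f : elem) (Phi Psi : seq elem).

Let elem_start0 e : 0 <= el_start e. Proof. by have /andP[] := el_times e. Qed.

Lemma measurable_el_coef e i j : measurable_fun [set: Omega] (fun w => el_coef e w i j).
Proof.
apply: (submeas_measurable Ft_filtration (elem_start0 e)).
by move=> S mS; exact: el_measurable.
Qed.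

Lemma measurable_simple_process Phi i j :
  measurable_fun [set: R * Omega] (fun p => simple_process Phi p.1 p.2 i j).
Proof.
rewrite (_ : (fun p => _) = fun p : R * Omega => \sum_(e <- Phi)
    \1_(`]el_start e, el_end e]) p.1 * el_coef e p.2 i j); last first.
  apply/funext => -[s w] /=; rewrite /simple_process summxE.
  apply: eq_bigr => e _; rewrite indicE mem_setE in_itv/=.
  by case: ifP => _; rewrite ?mul1r// mul0r mxE.
apply: measurable_sum => e; apply: measurable_funM.
  apply: (measurableT_comp _ measurable_fst).
  by apply: measurable_indic; exact: measurable_itv.
exact: (measurableT_comp (measurable_el_coef e i j) measurable_snd).
Qed.

Let summand Phi i j w := \sum_(e <- Phi) el_coef e w i j *
  (W (Num.min (el_end e) t) w j 0 - W (Num.min (el_start e) t) w j 0).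

Let simple_integralE Phi w i :
  simple_integral W Phi t w i 0 = \sum_j summand Phi i j w.
Proof.
rewrite /simple_integral summxE exchange_big/=; apply: eq_bigr => e _.
by rewrite mxE; apply: eq_bigr => j _; rewrite !mxE.
Qed.

Lemma measurable_coordinate j s : 0 <= s -> measurable_fun [set: Omega] (fun w => W s w j 0).
Proof.
move=> s0; apply: (submeas_measurable Ft_filtration s0).
exact: (coordinate_adapted W_brownian).
Qed.

Let measurable_summand Phi i j : measurable_fun [set: Omega] (summand Phi i j).
Proof.
apply: measurable_sum => e; apply: measurable_funM; first exact: measurable_el_coef.
have e0 := elem_start0 e.
have e1 : 0 <= el_end e by have /andP[_] := el_times e; exact: le_trans.
by apply: measurable_funB; apply: measurable_coordinate; rewrite le_min t0 ?e0 ?e1.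
Qed.

Lemma measurable_simple_integral Phi i :
  measurable_fun [set: Omega] (fun w => simple_integral W Phi t w i 0).
Proof.
under eq_fun do rewrite simple_integralE.
by apply: measurable_sum => j; exact: measurable_summand.
Qed.

(** Each component of the integral is a sum of [d] scalar integrals. Bounding its square by [d]
    times the sum of squares leaves only terms covered by [simple_isometry]. *)
Lemma simple_integral_bound Phi :
  (\int[P]_w (frob (simple_integral W Phi t w) ^+ 2)%:E <=
   (d%:R * V)%:E *
   \int[P]_w \int[mu]_(s in `[0%R, t]) (frob (simple_process Phi s w) ^+ 2)%:E)%E.
Proof.
have mI : measurable (`[0, t] : set R) by exact: measurable_itv.
have mphi i j : measurable_fun (`[0, t] `*` [set: Omega])
    (fun p : R * Omega => (simple_process Phi p.1 p.2 i j ^+ 2)%:E).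
  apply: measurable_funTS; apply/measurable_EFinP; apply: measurable_funX.
  exact: measurable_simple_process.
have phi0 i j s w : (0 <= (simple_process Phi s w i j ^+ 2)%:E)%E.
  by rewrite lee_fin sqr_ge0.
have -> : (\int[P]_w \int[mu]_(s in `[0%R, t]) (frob (simple_process Phi s w) ^+ 2)%:E
   = \sum_(i < d) \sum_(j < d) \int[P]_w \int[mu]_(s in `[0%R, t])
       (simple_process Phi s w i j ^+ 2)%:E)%E.
  transitivity (\int[P]_w \sum_(i < d) \sum_(j < d) \int[mu]_(s in `[0%R, t])
       (simple_process Phi s w i j ^+ 2)%:E)%E.
    apply: eq_integral => w _.
    under eq_integral do rewrite frob_sqrE -sumEFin.
    rewrite ge0_integral_sum//; last 2 first.
    - move=> i; apply/measurable_EFinP; apply: measurable_sum => j.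
      apply: measurable_funX; apply: measurable_funTS.
      have := measurable_simple_process Phi i j.
      by move=> /(measurable_fun_pair1 w).
    - by move=> i s _; rewrite lee_fin sumr_ge0// => j _; rewrite sqr_ge0.
    apply: eq_bigr => i _.
    under eq_integral do rewrite -sumEFin.
    rewrite ge0_integral_sum// => j; apply/measurable_EFinP.
    apply: measurable_funX; apply: measurable_funTS.
    by have := measurable_simple_process Phi i j; move=> /(measurable_fun_pair1 w).
  rewrite ge0_integral_sum//; last 2 first.
  - move=> i; apply: emeasurable_sum => j.
    exact: (measurable_section_time mI (mphi i j) (phi0 i j)).
  - by move=> i w _; rewrite sume_ge0// => j _; exact: integral_ge0.
  apply: eq_bigr => i _; rewrite ge0_integral_sum//.
  - move=> j; exact: (measurable_section_time mI (mphi i j) (phi0 i j)).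
  - by move=> j w _; exact: integral_ge0.
have ms i j : measurable_fun [set: Omega] (fun w => (summand Phi i j w ^+ 2)%:E).
  by apply/measurable_EFinP; apply: measurable_funX; exact: measurable_summand.
have s0 i j w : (0 <= (summand Phi i j w ^+ 2)%:E)%E by rewrite lee_fin sqr_ge0.
have II0 i j : (0 <= \int[P]_w \int[mu]_(s in `[0%R, t])
    (simple_process Phi s w i j ^+ 2)%:E)%E.
  by apply: integral_ge0 => w _; exact: integral_ge0.
rewrite EFinM -muleA.
have -> : (V%:E * (\sum_(i < d) \sum_(j < d) \int[P]_w \int[mu]_(s in `[0%R, t])
    (simple_process Phi s w i j ^+ 2)%:E) =
    \int[P]_w (\sum_(i < d) \sum_(j < d) (summand Phi i j w ^+ 2)%:E))%E.
  rewrite ge0_sume_distrr; last by move=> i _; rewrite sume_ge0.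
  rewrite ge0_integral_sum//; last 2 first.
  - by move=> i; exact: emeasurable_sum.
  - by move=> i w _; rewrite sume_ge0.
  apply: eq_bigr => i _; rewrite ge0_sume_distrr// ge0_integral_sum//.
  apply: eq_bigr => j _.
  by rewrite -(simple_isometry Ft_filtration W_brownian t0 i j Phi).
have mss : measurable_fun [set: Omega]
    (fun w => \sum_(i < d) \sum_(j < d) (summand Phi i j w ^+ 2)%:E)%E.
  by apply: emeasurable_sum => i; exact: emeasurable_sum.
have ss0 w : (0 <= \sum_(i < d) \sum_(j < d) (summand Phi i j w ^+ 2)%:E)%E.
  by rewrite sume_ge0// => i _; rewrite sume_ge0.
rewrite -ge0_integralZl_EFin//.
apply: ge0_le_integral => //.
- by move=> w _; rewrite lee_fin sqr_ge0.
- apply/measurable_EFinP; under eq_fun do rewrite frob_sqrE.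
  apply: measurable_sum => i; apply: measurable_sum => j; rewrite ord1.
  by apply: measurable_funX; exact: measurable_simple_integral.
- by apply: emeasurable_funM.
- move=> w _; under eq_bigr do rewrite sumEFin.
  rewrite sumEFin -EFinM lee_fin frob_sqrE mulr_sumr; apply: ler_sum => i _.
  by rewrite big_ord1 simple_integralE; exact: sqr_sum_le.
Qed.

Program Definition el_opp e : elem :=
  @Elementary R dO Omega d Ft (el_start e) (el_end e) (fun w => - el_coef e w)
    (el_times e) _ _.
Next Obligation.
move=> e i j S mS; under eq_fun do rewrite mxE.
apply: (submeasN (Ft_sigma Ft_filtration (elem_start0 e))) mS.
by move=> S' mS'; exact: el_measurable.
Qed.
Next Obligation.
by move=> e; have [c hc] := el_bounded e; exists c => w; rewrite frobN.
Qed.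

(** Since a sequence stands for a sum, concatenation with negated coefficients represents a
    difference; [simple_integral_bound] thus applies to the difference of two approximations. *)
Definition simple_sub Phi Psi : seq elem := Phi ++ [seq el_opp e | e <- Psi].

Lemma simple_process_sub Phi Psi s w :
  simple_process (simple_sub Phi Psi) s w =
  simple_process Phi s w - simple_process Psi s w.
Proof.
rewrite /simple_process big_cat big_map/= -sumrN; congr (_ + _).
by apply: eq_bigr => e _; case: ifP => //; rewrite oppr0.
Qed.

Lemma simple_integral_sub Phi Psi w :
  simple_integral W (simple_sub Phi Psi) t w =
  simple_integral W Phi t w - simple_integral W Psi t w.
Proof.
rewrite /simple_integral big_cat big_map/= -sumrN; congr (_ + _).
by apply: eq_bigr => e _; rewrite mulNmx.
Qed.

End ito_comparison.

(** The value 3 (k 3) D is what survives of the two nested three-term estimates once the four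
    approximation errors vanish. [D] may be infinite; the sums stay defined because the other limits
    are 0. *)
Lemma sandwich_bound_cvg (R : realType) (a a' c c' : (\bar R)^nat) (k : R) (D : \bar R) :
  a n @[n --> \oo] --> 0%E -> a' n @[n --> \oo] --> 0%E ->
  c n @[n --> \oo] --> 0%E -> c' n @[n --> \oo] --> 0%E ->
  (3%:E * (a' n + k%:E * (3%:E * (c' n + D + c n)) + a n))%E @[n --> \oo] -->
  ((3 * (k * 3))%:E * D)%E.
Proof.
move=> a0 a'0 c0 c'0.
have -> : ((3 * (k * 3))%:E * D = 3%:E * (0 + k%:E * (3%:E * (0 + D + 0)) + 0))%E.
  by rewrite !adde0 !add0e !muleA -!EFinM mulrA.
apply: cvgeZl => //; apply: cvgeD; [exact: fin_num_adde_defl| |exact: a0].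
apply: cvgeD; [exact: fin_num_adde_defr|exact: a'0|].
apply: cvgeZl => //; apply: cvgeZl => //.
apply: cvgeD; [exact: fin_num_adde_defl| |exact: c0].
by apply: cvgeD; [exact: fin_num_adde_defr|exact: c'0|exact: cvg_cst].
Qed.

Lemma measurable_frob_sqr (R : realType) d (T : measurableType d) (D : set T) m n
    (A : T -> 'M[R]_(m, n)) :
  (forall i j, measurable_fun D (fun x => A x i j)) ->
  measurable_fun D (fun x => (frob (A x) ^+ 2)%:E).
Proof.
move=> mA; apply/measurable_EFinP; under eq_fun do rewrite frob_sqrE.
by apply: measurable_sum => i; apply: measurable_sum => j; exact: measurable_funX.
Qed.

Lemma measurable_entryB (R : realType) d (T : measurableType d) (D : set T) m n
    (A B : T -> 'M[R]_(m, n)) i j :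
  measurable_fun D (fun x => A x i j) -> measurable_fun D (fun x => B x i j) ->
  measurable_fun D (fun x => (A x - B x) i j).
Proof.
by move=> mA mB; under eq_fun do rewrite !mxE; exact: measurable_funB.
Qed.

Section ito_comparison.
Context {R : realType} {dO : measure_display} {Omega : measurableType dO}.
Variable P : probability Omega R.
Variables (d : nat) (Ft : R -> set (set Omega)).
Hypothesis Ft_filtration : is_filtration Ft.
Variable W : R -> Omega -> 'cV[R]_d.
Hypothesis W_brownian : brownian_motion P Ft W.
Local Notation mu := (@lebesgue_measure R).
Local Notation V := (@normal_second_moment R).
Local Notation norm2 A t := (\int[P]_w \int[mu]_(s in `[0%R, t]) (frob (A s w) ^+ 2)%:E)%E.

Lemma measurable_timeslice (D : set R) (m n : nat) (A : R -> Omega -> 'M[R]_(m, n)) w i j :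
  measurable D -> jointly_measurable D A -> measurable_fun D (fun s => A s w i j).
Proof.
move=> mD mA; apply/(measurable_restrictT _ mD).
have mDT : measurable (D `*` [set: Omega]) by exact: measurableX.
have /(measurable_restrictT _ mDT) := mA i j.
move=> /(measurable_fun_pair1 w); congr measurable_fun.
apply/funext => s; rewrite !patchE; congr (if _ then _ else _).
by apply/idP/idP => [/set_mem[]|/set_mem]; rewrite ?inE.
Qed.

Lemma jointly_measurableB (D : set R) (m n : nat) (A B : R -> Omega -> 'M[R]_(m, n)) :
  jointly_measurable D A -> jointly_measurable D B ->
  jointly_measurable D (fun s w => A s w - B s w).
Proof. by move=> mA mB i j; exact: measurable_entryB. Qed.

Lemma norm2_le3 t (A A1 A2 A3 : R -> Omega -> 'M[R]_d) :
  jointly_measurable `[0, t] A -> jointly_measurable `[0, t] A1 ->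
  jointly_measurable `[0, t] A2 -> jointly_measurable `[0, t] A3 ->
  (forall s w, A s w = A1 s w + A2 s w + A3 s w) ->
  (norm2 A t <= 3%:E * (norm2 A1 t + norm2 A2 t + norm2 A3 t))%E.
Proof.
move=> mA mA1 mA2 mA3 AE.
have mI : measurable (`[0, t] : set R) by exact: measurable_itv.
have f0 (A' : R -> Omega -> 'M[R]_d) s w : (0 <= (frob (A' s w) ^+ 2)%:E :> \bar R)%E.
  by rewrite lee_fin sqr_ge0.
have mf (A' : R -> Omega -> 'M[R]_d) : jointly_measurable `[0, t] A' -> measurable_fun (`[0, t] `*` [set: Omega])
    (fun p : R * Omega => (frob (A' p.1 p.2) ^+ 2)%:E).
  by move=> mA'; apply: measurable_frob_sqr => i j; exact: mA'.
have mS (A' : R -> Omega -> 'M[R]_d) : jointly_measurable `[0, t] A' -> measurable_fun [set: Omega]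
    (fun w => \int[mu]_(s in `[0%R, t]) (frob (A' s w) ^+ 2)%:E)%E.
  by move=> mA'; exact: (@measurable_section_time _ _ _ _ mI (fun s w => (frob (A' s w) ^+ 2)%:E) (mf _ mA') (f0 A')).
have ms (A' : R -> Omega -> 'M[R]_d) w : jointly_measurable `[0, t] A' -> measurable_fun `[0, t]
    (fun s => (frob (A' s w) ^+ 2)%:E).
  by move=> mA'; apply: measurable_frob_sqr => i j; exact: measurable_timeslice.
apply: ge0_integral_le3 => //; do ?exact: mS; do ?by move=> *; exact: integral_ge0.
move=> w _; apply: ge0_integral_le3 => //; do ?exact: ms.
by move=> s _; rewrite -!EFinD -EFinM lee_fin AE !mulrDr; exact: frobD3_sqr.
Qed.

Lemma jointly_measurable_simple t (Phi : seq (elementary d Ft)) :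
  jointly_measurable `[0, t] (simple_process Phi).
Proof.
by move=> i j; apply: measurable_funTS; exact: measurable_simple_process.
Qed.

(* Both sides are approximated by simple processes separately, which replaces
   the constant 1 of the isometry by 9; the factor d comes from Cauchy-Schwarz
   over the coordinates of W. *)
Lemma ito_integral_comparison t (A A' : R -> Omega -> 'M[R]_d)
    (Y Y' : Omega -> 'cV[R]_d) : 0 <= t ->
  ito_integral P Ft W A t Y -> ito_integral P Ft W A' t Y' ->
  (\int[P]_w (frob (Y' w - Y w) ^+ 2)%:E <=
   (9 * (d%:R * V))%:E * norm2 (fun s w => (A' s w - A s w)%R) t)%E.
Proof.
move=> t0 [mA mY [Phi [PhiA PhiY]]] [mA' mY' [Phi' [PhiA' PhiY']]].
have mYe i j : measurable_fun [set: Omega] (fun w => Y w i j).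
  by move=> _ S mS; rewrite setTI; exact: mY.
have mY'e i j : measurable_fun [set: Omega] (fun w => Y' w i j).
  by move=> _ S mS; rewrite setTI; exact: mY'.
have V0 := @normal_second_moment_ge0 R.
have dV0 : 0 <= d%:R * V by rewrite mulr_ge0.
set D := norm2 (fun s w => (A' s w - A s w)%R) t.
pose S n w := simple_integral W (Phi n) t w.
pose S' n w := simple_integral W (Phi' n) t w.
have mS n i j : measurable_fun [set: Omega] (fun w => S n w i j).
  by rewrite ord1; exact: (measurable_simple_integral Ft_filtration W_brownian t0).
have mS' n i j : measurable_fun [set: Omega] (fun w => S' n w i j).
  by rewrite ord1; exact: (measurable_simple_integral Ft_filtration W_brownian t0).
pose a n := (\int[P]_w (frob (S n w - Y w) ^+ 2)%:E)%E.
pose a' n := (\int[P]_w (frob (S' n w - Y' w) ^+ 2)%:E)%E.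
pose c n := norm2 (fun s w => (simple_process (Phi n) s w - A s w)%R) t.
pose c' n := norm2 (fun s w => (simple_process (Phi' n) s w - A' s w)%R) t.
have acvg : a n @[n --> \oo] --> 0%E.
  by move: PhiY; under eq_fun do rewrite unlock.
have a'cvg : a' n @[n --> \oo] --> 0%E.
  by move: PhiY'; under eq_fun do rewrite unlock.
have key n : (\int[P]_w (frob (Y' w - Y w) ^+ 2)%:E <=
   3%:E * (a' n + (d%:R * V)%:E * (3%:E * (c' n + D + c n)) + a n))%E.
  apply: (@le_trans _ _ (3%:E * (a' n +
      \int[P]_w (frob (S' n w - S n w) ^+ 2)%:E + a n))%E).
    apply: ge0_integral_le3 => //;
      do ?by move=> *; rewrite lee_fin sqr_ge0.
    - by apply: measurable_frob_sqr => i j; exact: measurable_entryB.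
    - by apply: measurable_frob_sqr => i j; exact: measurable_entryB.
    - by apply: measurable_frob_sqr => i j; exact: measurable_entryB.
    - by apply: measurable_frob_sqr => i j; exact: measurable_entryB.
    - move=> w _; rewrite -!EFinD -EFinM lee_fin !mulrDr.
      have -> : Y' w - Y w = - (S' n w - Y' w) + (S' n w - S n w) + (S n w - Y w).
        by rewrite opprB !addrA !subrK.
      by rewrite -[in leRHS](frobN (S' n w - Y' w)); exact: frobD3_sqr.
  apply: lee_wpmul2l; first by rewrite lee_fin.
  apply: leeD2r; apply: leeD2l.
  have := simple_integral_bound Ft_filtration W_brownian t0 (simple_sub Ft_filtration (Phi' n) (Phi n)).
  under eq_integral do rewrite simple_integral_sub.
  move=> h; apply: le_trans h _; apply: lee_wpmul2l; first by rewrite lee_fin.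
  have -> : c n = norm2 (fun s w => (A s w - simple_process (Phi n) s w)%R) t.
    by apply: eq_integral => w _; apply: eq_integral => s _; rewrite -frobN opprB.
  have mPhi (Q : seq (elementary d Ft)) : jointly_measurable `[0, t] (simple_process Q).
    exact: jointly_measurable_simple.
  under [leLHS]eq_integral do under eq_integral do rewrite simple_process_sub.
  apply: norm2_le3; do ?exact: jointly_measurableB.
  by move=> s w; rewrite !addrA !subrK.
have -> : (9 * (d%:R * V) = 3 * ((d%:R * V) * 3))%R by ring.
have lim := @sandwich_bound_cvg _ _ _ _ _ (d%:R * V) D acvg a'cvg PhiA PhiA'.
by apply: (cvge_to_ge lim); apply: nearW => n; exact: key.
Qed.

End ito_comparison.

(** * Simpson's rule and smooth integrands *)

Section pointwise_derivatives.
Context {R : realType}.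
Implicit Types (f g : R -> R) (x a b : R).

Lemma is_derive_add f g x a b : is_derive x 1 f a -> is_derive x 1 g b ->
  is_derive x 1 (fun y => f y + g y) (a + b).
Proof. by move=> df dg; exact: is_deriveD. Qed.

Lemma is_derive_sub f g x a b : is_derive x 1 f a -> is_derive x 1 g b ->
  is_derive x 1 (fun y => f y - g y) (a - b).
Proof. by move=> df dg; exact: is_deriveB. Qed.

Lemma is_derive_mul f g x a b : is_derive x 1 f a -> is_derive x 1 g b ->
  is_derive x 1 (fun y => f y * g y) (a * g x + f x * b).
Proof.
move=> df dg; apply: (is_derive_eq (is_deriveM df dg)).
by rewrite /GRing.scale/= addrC mulrC.
Qed.

Lemma is_derive_scale f x a (c : R) : is_derive x 1 f a ->
  is_derive x 1 (fun y => c * f y) (c * a).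
Proof. by move=> df; have := is_deriveZ c df. Qed.

Lemma is_derive_exp f x a n : is_derive x 1 f a ->
  is_derive x 1 (fun y => f y ^+ n.+1) (n.+1%:R * f x ^+ n * a).
Proof.
move=> df; elim: n => [|n IH].
  by rewrite expr0 !mul1r; under eq_fun do rewrite expr1.
under eq_fun do rewrite exprS.
apply: (is_derive_eq (is_derive_mul df IH)).
by rewrite -[in RHS]natr1 exprS; ring.
Qed.

Lemma is_derive_continuous f x a : is_derive x 1 f a -> {for x, continuous f}.
Proof. by case=> df _; apply: differentiable_continuous; exact/derivable1_diffP. Qed.

Lemma is_derive_within_continuous f f' a b :
  (forall x, a <= x <= b -> is_derive x 1 f (f' x)) ->
  {within `[a, b], continuous f}.
Proof.
move=> df; apply: continuous_in_subspaceT => x; rewrite inE/= in_itv/= => xab.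
exact: is_derive_continuous (df x xab).
Qed.

(** One application of the mean value theorem gains one power of [x - a]. Repeated from the highest
    derivative downwards it replaces Taylor's formula, at the price of the factorials. *)
Lemma MVT_pow_bound f f' a b (B : R) k : a <= b ->
  (forall x, a <= x <= b -> is_derive x 1 f (f' x)) -> f a = 0 ->
  (forall x, a <= x <= b -> `|f' x| <= B * (x - a) ^+ k) ->
  forall x, a <= x <= b -> `|f x| <= B * (x - a) ^+ k.+1.
Proof.
move=> ab df fa f'B x /andP[ax xb].
have dfx y : a <= y <= x -> is_derive y 1 f (f' y).
  by move=> /andP[ay yx]; apply: df; rewrite ay (le_trans yx).
have dfx' y : y \in `]a, x[ -> is_derive y 1 f (f' y).
  by rewrite in_itv/= => /andP[ay yx]; apply: dfx; rewrite !ltW.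
have [y] := MVT_segment ax dfx' (is_derive_within_continuous dfx).
rewrite in_itv/= => /andP[ay yx]; rewrite fa subr0 => ->.
rewrite normrM (ger0_norm (_ : 0 <= x - a)) ?subr_ge0// exprSr mulrA.
rewrite ler_wpM2r ?subr_ge0//.
apply: le_trans (f'B y _) _; first by rewrite ay (le_trans yx).
have B0 : 0 <= B * (y - a) ^+ k.
  by apply: le_trans (f'B y _); rewrite // ay (le_trans yx).
(* The sign of [B] is not given. It follows from the bound on [f'] at [y] unless [y = a], where only
   [k = 0] and [k > 0] have to be distinguished. *)
have [->|ya] := eqVneq y a.
  have [k0|k0] := posnP k; first by rewrite k0 !expr0.
  have : 0 <= B * (x - a) ^+ k.
    by apply: le_trans (f'B x _); rewrite // ax.
  by rewrite subrr expr0n gtn_eqF// mulr0.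
have ya0 : 0 < y - a by rewrite subr_gt0 lt_def ya.
have {}B0 : 0 <= B by rewrite -(pmulr_lge0 _ (exprn_gt0 k ya0)).
by rewrite ler_wpM2l// lerXn2r ?nnegrE ?subr_ge0// ?lerB// ltW.
Qed.

End pointwise_derivatives.

(** The successive derivatives are explicit data, so that products are differentiated by formulas.
    The derivatives are two-sided, also at boundary points of [D]. *)
Definition is_jet (R : realType) (k : nat) (D : set R) (F : nat -> R -> R) :=
  forall j x, (j < k)%N -> D x -> is_derive x 1 (F j) (F j.+1 x).

Section simpson.
Context {R : realType}.
Local Notation mu := (@lebesgue_measure R).
Variables (a h B : R) (F : nat -> R -> R).
Hypotheses (h0 : 0 < h) (jF : is_jet 4 `[a, a + h] F).
Hypothesis F4B : forall x, a <= x <= a + h -> `|F 4%N x| <= B.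

Let q n (y : R) : R := (y - a) ^+ n / n`!%:R.

Let dq n (x : R) : is_derive x 1 (q n.+1) (q n x).
Proof.
have d1 : is_derive x 1 (fun y : R => y - a) 1.
  by apply: (is_derive_eq (is_derive_sub (is_derive_id _ _) (is_derive_cst a _ _)));
    rewrite subr0.
have := is_derive_scale (n.+1)`!%:R^-1 (is_derive_exp n d1).
rewrite (_ : (fun y => _) = q n.+1); last first.
  by apply/funext => y; rewrite /q mulrC.
move=> /is_derive_eq; apply; rewrite mulr1 /q factS natrM.
have n0 : n.+1%:R != 0 :> R by rewrite pnatr_eq0.
have f0 : n`!%:R != 0 :> R by rewrite pnatr_eq0 -lt0n fact_gt0.
by field; rewrite f0 /=; move: n0; rewrite -natr1.
Qed.

(** The cubic Taylor polynomial of [F 0] at [a]; [P1], [P2], [P3] are its derivatives and [Q] is its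
    antiderivative vanishing at [a]. *)
Let P0 y := F 0 a * q 0 y + F 1 a * q 1 y + F 2 a * q 2 y + F 3 a * q 3 y.
Let P1 y := F 1 a * q 0 y + F 2 a * q 1 y + F 3 a * q 2 y.
Let P2 y := F 2 a * q 0 y + F 3 a * q 1 y.
Let P3 y := F 3 a * q 0 y.
Let Q y := F 0 a * q 1 y + F 1 a * q 2 y + F 2 a * q 3 y + F 3 a * q 4 y.

Let dq0 (x : R) : is_derive x 1 (q 0) 0.
Proof.
have -> : q 0 = cst 1 by apply/funext => y; rewrite /q expr0 divr1.
exact: is_derive_cst.
Qed.

Let q0 y : q 0 y = 1. Proof. by rewrite /q expr0 divr1. Qed.
Let qa n : q n.+1 a = 0. Proof. by rewrite /q subrr expr0n mul0r. Qed.

Let dP3 (x : R) : is_derive x 1 P3 0.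
Proof.
by apply: (is_derive_eq (is_derive_scale _ (dq0 x))); rewrite mulr0.
Qed.

Let dP2 (x : R) : is_derive x 1 P2 (P3 x).
Proof.
apply: (is_derive_eq (is_derive_add (is_derive_scale _ (dq0 x)) (is_derive_scale _ (dq 0 x)))).
by rewrite mulr0 add0r.
Qed.

Let dP1 (x : R) : is_derive x 1 P1 (P2 x).
Proof.
apply: (is_derive_eq (is_derive_add
  (is_derive_add (is_derive_scale _ (dq0 x)) (is_derive_scale _ (dq 0 x)))
  (is_derive_scale _ (dq 1 x)))).
by rewrite mulr0 add0r.
Qed.

Let dP0 (x : R) : is_derive x 1 P0 (P1 x).
Proof.
apply: (is_derive_eq (is_derive_add (is_derive_add
  (is_derive_add (is_derive_scale _ (dq0 x)) (is_derive_scale _ (dq 0 x)))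
  (is_derive_scale _ (dq 1 x))) (is_derive_scale _ (dq 2 x)))).
by rewrite mulr0 add0r.
Qed.

Let dQ (x : R) : is_derive x 1 Q (P0 x).
Proof.
exact: is_derive_add (is_derive_add
  (is_derive_add (is_derive_scale _ (dq 0 x)) (is_derive_scale _ (dq 1 x)))
  (is_derive_scale _ (dq 2 x))) (is_derive_scale _ (dq 3 x)).
Qed.

Let ab : a <= a + h. Proof. by rewrite lerDl ltW. Qed.

Let inD x : a <= x <= a + h -> `[a, a + h]%classic x.
Proof. by rewrite /= in_itv. Qed.

(** Each difference between a derivative of [F 0] and that of [P0] vanishes at [a], so
    [MVT_pow_bound] climbs from the bound on [F 4] in four steps. *)
Let remainder x : a <= x <= a + h -> `|F 0 x - P0 x| <= B * (x - a) ^+ 4.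
Proof.
have r3 y : a <= y <= a + h -> `|F 3 y - P3 y| <= B * (y - a) ^+ 1.
  apply: (@MVT_pow_bound _ (fun y => F 3 y - P3 y) (fun y => F 4%N y - 0)) => //.
  - by move=> z zab; apply: is_derive_sub => //; apply: jF => //; exact: inD.
  - by rewrite /P3 q0 mulr1 subrr.
  - by move=> z zab; rewrite subr0 expr0 mulr1; exact: F4B.
have r2 y : a <= y <= a + h -> `|F 2 y - P2 y| <= B * (y - a) ^+ 2.
  apply: (@MVT_pow_bound _ (fun y => F 2 y - P2 y) (fun y => F 3 y - P3 y)) => //.
  - by move=> z zab; apply: is_derive_sub => //; apply: jF => //; exact: inD.
  - by rewrite /P2 q0 qa mulr1 mulr0 addr0 subrr.
have r1 y : a <= y <= a + h -> `|F 1 y - P1 y| <= B * (y - a) ^+ 3.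
  apply: (@MVT_pow_bound _ (fun y => F 1 y - P1 y) (fun y => F 2 y - P2 y)) => //.
  - by move=> z zab; apply: is_derive_sub => //; apply: jF => //; exact: inD.
  - by rewrite /P1 q0 !qa mulr1 !mulr0 !addr0 subrr.
apply: (@MVT_pow_bound _ (fun y => F 0 y - P0 y) (fun y => F 1 y - P1 y)) => //.
- by move=> z zab; apply: is_derive_sub => //; apply: jF => //; exact: inD.
- by rewrite /P0 q0 !qa mulr1 !mulr0 !addr0 subrr.
Qed.

Let B_ge0 : 0 <= B.
Proof. by apply: (le_trans (normr_ge0 (F 4%N a))); apply: F4B; rewrite lexx. Qed.

Let remainder_le x : a <= x <= a + h -> `|F 0 x - P0 x| <= B * h ^+ 4.
Proof.
move=> xab; apply: le_trans (remainder xab) _; rewrite ler_wpM2l//.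
by move/andP: xab => [ax xb]; rewrite lerXn2r ?nnegrE ?subr_ge0 ?(ltW h0)//; lra.
Qed.

Let cF : {within `[a, a + h], continuous (F 0)}.
Proof.
apply: (is_derive_within_continuous (f' := F 1)) => x xab.
by apply: jF => //; exact: inD.
Qed.

Let cP : {within `[a, a + h], continuous P0}.
Proof. by apply: (is_derive_within_continuous (f' := P1)) => x _. Qed.

Let iF : mu.-integrable `[a, a + h] (EFin \o F 0).
Proof. by apply: continuous_compact_integrable => //; exact: segment_compact. Qed.

Let iP : mu.-integrable `[a, a + h] (EFin \o P0).
Proof. by apply: continuous_compact_integrable => //; exact: segment_compact. Qed.

Let intP : \int[mu]_(x in `[a, a + h]) P0 x =
  F 0 a * h + F 1 a * h ^+ 2 / 2 + F 2 a * h ^+ 3 / 6 + F 3 a * h ^+ 4 / 24.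
Proof.
rewrite /Rintegral (@continuous_FTC2 _ P0 Q)//; first last.
- by move=> x _; rewrite derive1E; have [_ ->] := dQ x.
- split.
  + by move=> x _; have [] := dQ x.
  + by apply: cvg_at_right_filter; exact: is_derive_continuous (dQ a).
  + by apply: cvg_at_left_filter; exact: is_derive_continuous (dQ (a + h)).
- by rewrite ltrDl.
rewrite -EFinB /= /Q !qa !mulr0 !addr0 subr0 /q (addrC a h) addrK.
by rewrite expr1 !factS fact0 !muln1/=; field.
Qed.

(* Simpson's rule is exact on the cubic Taylor polynomial at a, so only the
   remainder contributes; the sharp constant 1/2880 is not needed. *)
Lemma simpson_error :
  `|\int[mu]_(x in `[a, a + h]) F 0 x -
    h / 6 * (F 0 a + 4 * F 0 (a + h / 2) + F 0 (a + h))| <= 2 * B * h ^+ 5.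
Proof.
set I := \int[mu]_(x in _) _.
pose r x := F 0 x - P0 x.
have -> : I - h / 6 * (F 0 a + 4 * F 0 (a + h / 2) + F 0 (a + h)) =
    (I - \int[mu]_(x in `[a, a + h]) P0 x) -
    h / 6 * (r a + 4 * r (a + h / 2) + r (a + h)).
  rewrite intP /r /P0 /q !subrr (addrC a h) addrK (addrC a (h / 2)) addrK.
  by rewrite !factS fact0 !muln1 !expr0 !expr1 !expr0n/=; field.
have ra : a <= a <= a + h by rewrite lexx.
have rm : a <= a + h / 2 <= a + h by move: h0; lra.
have rb : a <= a + h <= a + h by rewrite lexx ab.
have ir : mu.-integrable `[a, a + h] (EFin \o r).
  apply: continuous_compact_integrable; first exact: segment_compact.
  apply: (is_derive_within_continuous (f' := fun y => F 1 y - P1 y)) => x xab.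
  by apply: is_derive_sub => //; apply: jF => //; exact: inD.
have Ir : `|I - \int[mu]_(x in `[a, a + h]) P0 x| <= B * h ^+ 5.
  rewrite -RintegralB//; apply: (le_trans (le_normr_Rintegral _ _)) => //.
  rewrite (_ : B * h ^+ 5 = \int[mu]_(x in `[a, a + h]) (B * h ^+ 4)); last first.
    rewrite Rintegral_cst//= lebesgue_measure_itv/= lte_fin ltrDl h0/=.
    by ring.
  apply: le_Rintegral => //.
  - exact: integrable_norm ir.
  - apply: continuous_compact_integrable; first exact: segment_compact.
    exact: cst_continuous.
have Sr : `|h / 6 * (r a + 4 * r (a + h / 2) + r (a + h))| <= B * h ^+ 5.
  rewrite normrM ger0_norm ?divr_ge0 ?(ltW h0)//.
  have H4 := remainder_le.
  have : `|r a + 4 * r (a + h / 2) + r (a + h)| <= 6 * (B * h ^+ 4).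
    apply: (le_trans (ler_normD _ _)).
    have := ler_normD (r a) (4 * r (a + h / 2)); rewrite (normrM 4) ger0_norm//.
    by have := H4 _ ra; have := H4 _ rm; have := H4 _ rb; rewrite -/(r _) -/(r _) -/(r _); lra.
  move=> hle; apply: (@le_trans _ _ (h / 6 * (6 * (B * h ^+ 4)))).
    by rewrite ler_wpM2l// divr_ge0 ?(ltW h0).
  by rewrite le_eqVlt; apply/orP; left; apply/eqP; field.
apply: (le_trans (ler_normB _ _)).
have -> : 2 * B * h ^+ 5 = B * h ^+ 5 + B * h ^+ 5 by ring.
exact: lerD.
Qed.

End simpson.

(** * Derivatives up to order four *)

Section jets.
Context {R : realType}.
Implicit Types (D : set R) (U V : nat -> R -> R).

(** Leibniz's formula, written out order by order with its binomial coefficients. *)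
Definition jet_mul U V (j : nat) (x : R) : R :=
  match j with
  | 0 => U 0%N x * V 0%N x
  | 1 => U 1%N x * V 0%N x + U 0%N x * V 1%N x
  | 2 => U 2%N x * V 0%N x + 2 * (U 1%N x * V 1%N x) + U 0%N x * V 2%N x
  | 3 => U 3%N x * V 0%N x + 3 * (U 2%N x * V 1%N x) + 3 * (U 1%N x * V 2%N x) + U 0%N x * V 3%N x
  | _ => U 4%N x * V 0%N x + 4 * (U 3%N x * V 1%N x) + 6 * (U 2%N x * V 2%N x) +
         4 * (U 1%N x * V 3%N x) + U 0%N x * V 4%N x
  end.

Lemma is_jet_mul D U V : is_jet 4 D U -> is_jet 4 D V -> is_jet 4 D (jet_mul U V).
Proof.
move=> jU jV j x j4 Dx.
have dUV i k : (i < 4)%N -> (k < 4)%N ->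
    is_derive x 1 (fun y => U i y * V k y) (U i.+1 x * V k x + U i x * V k.+1 x).
  by move=> i4 k4; exact: is_derive_mul (jU i x i4 Dx) (jV k x k4 Dx).
case: j j4 => [|[|[|[|//]]]] _.
- exact: (dUV 0%N 0%N isT isT).
- apply: (is_derive_eq (is_derive_add (dUV 1%N 0%N isT isT) (dUV 0%N 1%N isT isT))).
  by rewrite /=; ring.
- apply: (is_derive_eq (is_derive_add (is_derive_add
   (dUV 2%N 0%N isT isT) (is_derive_scale 2%:R (dUV 1%N 1%N isT isT)))
   (dUV 0%N 2%N isT isT))).
  by rewrite /=; ring.
- apply: (is_derive_eq (is_derive_add (is_derive_add (is_derive_add
   (dUV 3%N 0%N isT isT) (is_derive_scale 3%:R (dUV 2%N 1%N isT isT)))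
   (is_derive_scale 3%:R (dUV 1%N 2%N isT isT))) (dUV 0%N 3%N isT isT))).
  by rewrite /=; ring.
Qed.

(** The factor 16 is the sum of the binomial coefficients of order 4, the largest such sum among the
    orders up to 4. *)
Lemma jet_mul_bound U V (a b x : R) k : (k <= 4)%N ->
  (forall j, (j <= 4)%N -> `|U j x| <= a) -> (forall j, (j <= 4)%N -> `|V j x| <= b) ->
  `|jet_mul U V k x| <= 16 * (a * b).
Proof.
move=> k4 Ua Vb.
have ab0 : 0 <= a * b.
  by apply: mulr_ge0; [apply: le_trans (Ua 0%N isT)|apply: le_trans (Vb 0%N isT)].
have UV i j : (i <= 4)%N -> (j <= 4)%N -> - (a * b) <= U i x * V j x <= a * b.
  move=> i4 j4; rewrite -ler_norml normrM.
  by apply: ler_pM => //; [exact: Ua|exact: Vb].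
rewrite ler_norml.
case: k k4 => [|[|[|[|[|//]]]]] _ /=.
- have /andP := UV 0%N 0%N isT isT; lra.
- have /andP := UV 0%N 1%N isT isT; have /andP := UV 1%N 0%N isT isT; lra.
- have /andP := UV 0%N 2%N isT isT; have /andP := UV 1%N 1%N isT isT.
  have /andP := UV 2%N 0%N isT isT; lra.
- have /andP := UV 0%N 3%N isT isT; have /andP := UV 1%N 2%N isT isT.
  have /andP := UV 2%N 1%N isT isT; have /andP := UV 3%N 0%N isT isT; lra.
- have /andP := UV 0%N 4%N isT isT; have /andP := UV 1%N 3%N isT isT.
  have /andP := UV 2%N 2%N isT isT; have /andP := UV 3%N 1%N isT isT.
  have /andP := UV 4%N 0%N isT isT; lra.
Qed.

Definition expR_jet (t : R) (j : nat) (x : R) : R := (- t) ^+ j * expR (- x * t).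

Lemma is_jet_expR t k D : is_jet k D (expR_jet t).
Proof.
move=> j x _ _.
have d1 : is_derive x 1 (fun y : R => - y * t) (- t).
  apply: (is_derive_eq (is_derive_mul (is_deriveNid _ _) (is_derive_cst t _ _))).
  by rewrite mulr0 addr0 mulN1r.
apply: (is_derive_eq (is_derive_scale _ (is_derive1_comp (is_derive_expR _) d1))).
by rewrite /expR_jet exprS; ring.
Qed.

Lemma expR_jet_bound t T j x : 0 <= t <= T -> 0 <= x -> (j <= 4)%N ->
  `|expR_jet t j x| <= (1 + T) ^+ 4.
Proof.
move=> /andP[t0 tT] x0 j4; rewrite normrM normrX normrN (ger0_norm t0).
rewrite (ger0_norm (expR_ge0 _)).
apply: (@le_trans _ _ ((1 + T) ^+ j * 1)); last first.
  by rewrite mulr1 ler_weXn2l// lerDl (le_trans t0).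
apply: ler_pM; rewrite ?exprn_ge0 ?expR_ge0//.
  by rewrite lerXn2r ?nnegrE// ?(le_trans tT) ?lerDr// addr_ge0// (le_trans t0).
by rewrite -expR0 ler_expR mulNr oppr_le0 mulr_ge0.
Qed.

Definition powR_jet (a : R) (j : nat) (x : R) : R :=
  (\prod_(i < j) (a - i%:R)) * x `^ (a - j%:R).

Lemma is_jet_powR a k D : (forall x, D x -> 0 < x) -> is_jet k D (powR_jet a).
Proof.
move=> D0 j x _ Dx; have x0 := D0 x Dx.
apply: (is_derive_eq (is_derive_scale _ (is_derive1_powR (a - j%:R) x0))).
by rewrite /powR_jet big_ord_recr/= -natr1 opprD addrA mulrA.
Qed.

(** For [a] in ]-1, 0[ the factor [a - i] is at most i + 1 in absolute value, so the product is at
    most j! and hence at most 4! = 24. For [x >= 1] a lower exponent only decreases the power. *)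
Lemma powR_jet_bound a j x : -1 < a < 0 -> 1 <= x -> (j <= 4)%N ->
  `|powR_jet a j x| <= 24 * x `^ a.
Proof.
move=> /andP[a1 a0] x1 j4; rewrite normrM (ger0_norm (powR_ge0 _ _)).
have x0 : 0 < x by exact: lt_le_trans x1.
apply: ler_pM; rewrite ?normr_ge0 ?powR_ge0//; last first.
  by apply: ler_powR => //; rewrite gerBl.
rewrite normr_prod; apply: (@le_trans _ _ (\prod_(i < j) i.+1%:R)).
  apply: ler_prod => i _; rewrite normr_ge0/= -natr1 ler_norml.
  have : 0 <= i%:R :> R by []. 
  by move: a1 a0; lra.
have -> : \prod_(i < j) i.+1%:R = j`!%:R :> R.
  by rewrite fact_prod big_add1 big_mkord natr_prod.
rewrite (ler_nat _ _ 24).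
by move: j4; case: j => [|[|[|[|[|]]]]].
Qed.

End jets.

Section Ck_functions.
Context {R : realType}.
Local Notation Rplus := [set x : R | 0 <= x].

(** Multiplying the difference quotient by [y - x] gives continuity relative to the half-line, at 0
    included. *)
Lemma one_sided_derivative_cvg (f : R -> R) (x l : R) :
  (f y - f x) / (y - x) @[y --> within Rplus x^'] --> l ->
  f y @[y --> within Rplus (nbhs x)] --> f x.
Proof.
move=> fl.
have : (f y - f x) / (y - x) * (y - x) @[y --> within Rplus x^'] --> l * 0.
  apply: cvgM fl _; have yx0 : (y - x) @[y --> x] --> (0 : R).
    by rewrite -(subrr x); apply: cvgB; [exact: cvg_id|exact: cvg_cst].
  by apply: cvg_within_filter; apply: cvg_within_filter; exact: yx0.
rewrite mulr0 => /cvgrPdist_lt h; apply/cvgrPdist_lt => e e0.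
have {}h : \forall y \near x, y != x -> 0 <= y ->
    `|0 - (f y - f x) / (y - x) * (y - x)| < e by exact: h.
rewrite near_withinE; apply: filterS h => y h y0.
have [->|yx] := eqVneq y x; first by rewrite subrr normr0.
by have := h yx y0; rewrite divfK ?subr_eq0// sub0r opprB.
Qed.

(** Near a positive point the restriction to [Rplus] is invisible; what remains is the shift between
    [y] near [x] and [h + x] with [h] near 0. *)
Lemma one_sided_derivative_is_derive (f : R -> R) (x l : R) : 0 < x ->
  (f y - f x) / (y - x) @[y --> within Rplus x^'] --> l ->
  is_derive x 1 f l.
Proof.
move=> x0 fl.
have fl' : (f y - f x) / (y - x) @[y --> x^'] --> l.
  apply: cvg_trans fl => A h; have {}h : \forall y \near x, y != x -> 0 <= y ->
      A ((f y - f x) / (y - x)) by exact: h.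
  have : \forall y \near x, y != x -> A ((f y - f x) / (y - x)); last by [].
  have y0 : \forall y \near x, 0 < y by exact: lt_nbhsr.
  by apply: filterS2 h y0 => y h /ltW y0 yx; exact: h.
have sh : h + x @[h --> (0 : R)^'] --> x^'.
  move=> A Ax; have {}Ax : \forall y \near x, y != x -> A y by exact: Ax.
  have : \forall h \near (0 : R), h != 0 -> A (h + x); last by [].
  have : h + x @[h --> (0 : R)] --> x.
    by rewrite -[X in _ --> X]add0r; apply: cvgD; [exact: cvg_id|exact: cvg_cst].
  move=> /(_ _ Ax) hA.
  have {}hA : \forall h \near (0 : R), h + x != x -> A (h + x) by exact: hA.
  by apply: filterS hA => h hA h0; apply: hA; rewrite -subr_eq0 addrK.
have cl : h^-1 *: ((f \o shift x) (h *: 1) - f x) @[h --> (0:R)^'] --> l.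
  have := cvg_comp _ _ sh fl'; apply: cvg_trans; apply: near_eq_cvg.
  by near=> h; rewrite /= /GRing.scale/= mulr1 addrK mulrC.
by apply: DeriveDef; [apply: cvgP cl|apply: cvg_lim cl].
Unshelve. all: by end_near. Qed.

End Ck_functions.

Section Ck_regularity.
Context {R : realType}.
Local Notation Rplus := [set x : R | 0 <= x].

Lemma measurable_Rplus : measurable Rplus.
Proof.
rewrite (_ : Rplus = [set` `[0, +oo[%R]); first exact: measurable_itv.
by apply/seteqP; split => x /=; rewrite in_itv/= andbT.
Qed.

(** The C^4 hypothesis in usable form: a jet on the open half-line, and one constant [b], the sum of
    all the bounds, for [f], its derivatives and its Lipschitz property. The last holds down to 0,
    because the mean value theorem asks for differentiability only in the interior. *)
Lemma Ck_regularity (f : R -> R) (c : R) :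
  Ck_bounded_derivatives 4 f -> (forall x, 0 <= x -> `|f x| <= c) ->
  exists (F : nat -> R -> R) (b : R),
  [/\ forall x, 0 <= x -> F 0%N x = f x,
      is_jet 4 [set x : R | 0 < x] F,
      forall j x, (j <= 4)%N -> 0 <= x -> `|F j x| <= b,
      forall x y, 0 <= x -> 0 <= y -> `|f x - f y| <= b * `|x - y| &
      measurable_fun Rplus f].
Proof.
move=> [F [F0 Fd _ FB]] fc.
have jF : is_jet 4 [set x : R | 0 < x] F.
  move=> j x j4 x0; apply: one_sided_derivative_is_derive => //.
  by apply: Fd => //; exact: ltW.
have [b1 hb1] := FB 1%N isT; have [b2 hb2] := FB 2%N isT.
have [b3 hb3] := FB 3%N isT; have [b4 hb4] := FB 4%N isT.
pose b := c + b1 + b2 + b3 + b4.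
have c0 : 0 <= c := le_trans (normr_ge0 _) (fc 0 (lexx _)).
have b10 : 0 <= b1 := le_trans (normr_ge0 _) (hb1 0 (lexx _)).
have b20 : 0 <= b2 := le_trans (normr_ge0 _) (hb2 0 (lexx _)).
have b30 : 0 <= b3 := le_trans (normr_ge0 _) (hb3 0 (lexx _)).
have b40 : 0 <= b4 := le_trans (normr_ge0 _) (hb4 0 (lexx _)).
have Fb j x : (j <= 4)%N -> 0 <= x -> `|F j x| <= b.
  case: j => [|[|[|[|[|//]]]]] _ x0; rewrite /b.
  - by rewrite F0//; have := fc x x0; lra.
  - by have := hb1 x x0; lra.
  - by have := hb2 x x0; lra.
  - by have := hb3 x x0; lra.
  - by have := hb4 x x0; lra.
have cF : {within Rplus, continuous (F 0%N)}.
  apply/subspace_continuousP => x x0.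
  exact: one_sided_derivative_cvg (Fd 0%N x isT x0).
have lip x y : 0 <= x -> x <= y -> `|f x - f y| <= b * `|x - y|.
  move=> x0 xy; have y0 : 0 <= y by exact: le_trans xy.
  have dF z : z \in `]x, y[ -> is_derive z 1 (F 0%N) (F 1%N z).
    by rewrite in_itv/= => /andP[xz _]; apply: jF => //=; exact: le_lt_trans xz.
  have cF' : {within `[x, y], continuous (F 0%N)}.
    apply: continuous_subspaceW cF => z; rewrite /= in_itv/= => /andP[xz _].
    exact: le_trans xz.
  have [z] := MVT_segment xy dF cF'.
  rewrite in_itv/= => /andP[xz _] e.
  rewrite distrC -!F0// e normrM (distrC x y) ler_wpM2r//.
  by apply: Fb => //; exact: le_trans xz.
exists F, b; split => //.
- move=> x y x0 y0; have [xy|/ltW yx] := leP x y; first exact: lip.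
  by rewrite distrC (distrC x y); exact: lip.
- apply: (@eq_measurable_fun _ _ _ _ _ (F 0%N)) => [x|].
    by rewrite inE => x0; rewrite F0.
  exact: subspace_continuous_measurable_fun measurable_Rplus cF.
Qed.

End Ck_regularity.

(** * Integrals against the quadrature measure *)

Section quadrature_integral.
Context {R : realType}.
Variables (H beta K : R) (n : nat) (beta01 : 0 < beta < 1) (K_gt1 : 1 < K).
Variable rho : nat -> R.
Local Notation Rplus := [set x : R | 0 <= x].
Hypothesis rho_ge0 : forall k, (k < n)%N -> 0 <= rho k.+1.

Let a : R := - H - 2^-1.

Definition quad_sum (h : R -> R) : R :=
  \sum_(k < n) fine (frac_measure H (cell beta K n k.+1)) * h (rho k.+1) +
  simpson_scale H beta K n * \sum_(k < n)
    (simpson_pt0 beta K n k.+1 `^ a * h (simpson_pt0 beta K n k.+1) +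
     4 * simpson_pt1 beta K n k.+1 `^ a * h (simpson_pt1 beta K n k.+1) +
     simpson_pt2 beta K n k.+1 `^ a * h (simpson_pt2 beta K n k.+1)).

Lemma Kbeta_ge1 : 1 <= K `^ beta.
Proof.
rewrite -(powRr0 K) ler_powR ?ltW//.
by have /andP[] := beta01.
Qed.

Lemma Kbeta_le : K `^ beta <= K.
Proof.
have /andP[_ b1] := beta01.
rewrite -[leRHS](@powRr1 _ K) ?(le_trans _ (ltW K_gt1))//.
by rewrite ler_powR ?ltW.
Qed.

Let Kbeta_ge0 : 0 <= K `^ beta. Proof. exact: powR_ge0. Qed.
Let KB : 0 <= K - K `^ beta. Proof. by rewrite subr_ge0 Kbeta_le. Qed.

Lemma simpson_pt0_ge0 k : 0 <= simpson_pt0 beta K n k.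
Proof. by rewrite addr_ge0// !mulr_ge0// invr_ge0. Qed.
Lemma simpson_pt1_ge0 k : 0 <= simpson_pt1 beta K n k.
Proof. by rewrite addr_ge0// !mulr_ge0// invr_ge0. Qed.
Lemma simpson_pt2_ge0 k : 0 <= simpson_pt2 beta K n k.
Proof. by rewrite addr_ge0// !mulr_ge0// invr_ge0. Qed.

Local Notation quad := (quad_measure H n beta01 K_gt1 rho).

(** A Dirac mass counts only if its point lies in the domain [Rplus]; this is why the signs of all
    nodes are recorded. *)
Let ge0_integral_dirac (h : R -> R) (p : R) : measurable_fun Rplus h -> 0 <= p ->
  (\int[\d_p]_(x in Rplus) (h x)%:E = (h p)%:E)%E.
Proof.
move=> mh p0; rewrite integral_dirac; first by rewrite diracE mem_set// mul1e.
- exact: measurable_Rplus.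
- exact/measurable_EFinP.
Qed.

Lemma ge0_integral_quad (h : R -> R) : measurable_fun Rplus h ->
  (forall x, 0 <= h x) -> (\int[quad]_(x in Rplus) (h x)%:E = (quad_sum h)%:E)%E.
Proof.
move=> mh h0; have mR := @measurable_Rplus R.
have mhE : measurable_fun Rplus (EFin \o h) by exact/measurable_EFinP.
have hE0 x : Rplus x -> (0 <= (h x)%:E)%E by rewrite lee_fin.
have simpson_point k :
    (\int[measure_add (measure_add
       (mscale (NngNum (simpson_density_ge0 H (simpson_pt0 beta K n k.+1)))
          \d_(simpson_pt0 beta K n k.+1))
       (mscale (NngNum (simpson_density4_ge0 H (simpson_pt1 beta K n k.+1)))
          \d_(simpson_pt1 beta K n k.+1)))
       (mscale (NngNum (simpson_density_ge0 H (simpson_pt2 beta K n k.+1)))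
          \d_(simpson_pt2 beta K n k.+1))]_(x in Rplus) (h x)%:E =
    (simpson_pt0 beta K n k.+1 `^ a * h (simpson_pt0 beta K n k.+1) +
     4 * simpson_pt1 beta K n k.+1 `^ a * h (simpson_pt1 beta K n k.+1) +
     simpson_pt2 beta K n k.+1 `^ a * h (simpson_pt2 beta K n k.+1))%:E)%E.
  rewrite !ge0_integral_measure_add// !ge0_integral_mscale//.
  rewrite !ge0_integral_dirac//.
  - exact: simpson_pt2_ge0.
  - exact: simpson_pt1_ge0.
  - exact: simpson_pt0_ge0.
rewrite /quad_measure ge0_integral_measure_add// ge0_integral_measure_sum//.
rewrite ge0_integral_mscale// ge0_integral_measure_sum//.
rewrite (eq_bigr _ (fun (k : 'I_n) _ => simpson_point k)).
rewrite /quad_sum [in RHS]EFinD [in RHS]EFinM -!sumEFin; congr (_ + _ * _)%E.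
apply: eq_bigr => k _; rewrite ge0_integral_mscale// ge0_integral_dirac//.
exact: rho_ge0.
Qed.

Lemma quad_sumB (h g : R -> R) :
  quad_sum (fun x => h x - g x) = quad_sum h - quad_sum g.
Proof.
rewrite /quad_sum opprD addrACA -mulrBr -!sumrB; congr (_ + _ * _).
  by apply: eq_bigr => k _; rewrite mulrBr.
by apply: eq_bigr => k _; ring.
Qed.

(** Additivity in the measure is available for nonnegative integrands, and [quad_sum] is linear, so
    the positive and negative parts are evaluated separately and recombined. *)
Lemma Rintegral_quad (h : R -> R) : measurable_fun Rplus h ->
  \int[quad]_(x in Rplus) h x = quad_sum h.
Proof.
move=> mh; rewrite /Rintegral integralE.
pose hp x := Num.max (h x) 0; pose hn x := Num.max (- h x) 0.
rewrite (_ : (fun x => (h x)%:E)^\+%E = EFin \o hp); last first.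
  by apply/funext => x; rewrite funeposE /= -EFin_max.
rewrite (_ : (fun x => (h x)%:E)^\-%E = EFin \o hn); last first.
  by apply/funext => x; rewrite funenegE /= -EFin_max.
rewrite !ge0_integral_quad; first last.
- by move=> x; rewrite le_max lexx orbT.
- by apply: measurable_maxr => //.
- by move=> x; rewrite le_max lexx orbT.
- by apply: measurable_maxr => //; exact: measurableT_comp.
rewrite -EFinB/= -quad_sumB; congr quad_sum; apply/funext => x.
rewrite /hp /hn; case: (leP (h x) 0) => hx.
  by rewrite max_l ?oppr_ge0// sub0r opprK.
by rewrite max_r ?subr0// oppr_le0 ltW.
Qed.

End quadrature_integral.

(** * Approximation of the kernels *)

Lemma Rintegral_itv_sum (R : realType) (f : R -> R) (u : nat -> R) n :
  (forall k, u k <= u k.+1) ->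
  (@lebesgue_measure R).-integrable `[u 0%N, u n[ (EFin \o f) ->
  \int[lebesgue_measure]_(x in `[u 0%N, u n[) f x =
  \sum_(k < n) \int[lebesgue_measure]_(x in `[u k, u k.+1[) f x.
Proof.
move=> uS; have u0 n' : u 0%N <= u n'.
  by elim: n' => // n' IH; exact: le_trans IH (uS n').
have U n' : `[u 0%N, u n'.+1[%classic = `[u 0%N, u n'[ `|` `[u n', u n'.+1[.
  apply/seteqP; split => x /=; rewrite !in_itv/=.
    move=> /andP[ux xu]; have [xn|nx] := ltP x (u n'); first by left; rewrite ux.
    by right; rewrite xu.
  move=> [/andP[-> xu]|/andP[ux ->]]; first exact: lt_le_trans (uS n').
  by rewrite andbT (le_trans (u0 n')).
elim: n => [|n IH] iu; first by rewrite big_ord0 set_itvco0 Rintegral_set0.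
rewrite big_ord_recr/= U Rintegral_setU; last 4 first.
- exact: measurable_itv.
- exact: measurable_itv.
- by rewrite -U.
- apply/disj_setPS => x /=; rewrite !in_itv/= => -[/andP[_ xu] /andP[ux _]].
  by move: (lt_le_trans xu ux); rewrite ltxx.
rewrite IH//; apply: integrableS iu; [exact: measurable_itv|exact: measurable_itv|].
by rewrite U; exact: subsetUl.
Qed.

Section fractional_kernel.
Context {R : realType}.
Local Notation mu := (@lebesgue_measure R).
Local Notation Rplus := [set x : R | 0 <= x].
Variables (H : R) (H_range : 0 < H < 2^-1).
Let a : R := - H - 2^-1.
Let w (x : R) : R := c_ H * x `^ a.

Let w_ge0 x : 0 <= w x. Proof. by rewrite mulr_ge0 ?c_ge0 ?powR_ge0. Qed.

Let mw (D : set R) : measurable_fun D w.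
Proof.
by apply: measurable_funTS; apply: measurable_funM => //; exact: measurable_powR.
Qed.

Let mid : measurable_fun [set: measurableTypeR R] (idfun : measurableTypeR R -> R).
Proof. by move=> _ A mA; rewrite setTI; exact: mA. Qed.

(* frac_measure lives on the measurable structure of R, Lebesgue measure on that of
   measurableTypeR R; pushing forward along the identity makes them comparable. *)
Definition lebesgue_id (x : measurableTypeR R) : R := x.
HB.instance Definition _ := isMeasurableFun.Build _ _ _ _ lebesgue_id mid.

Let integral_lebesgue_id (f : R -> \bar R) : measurable_fun [set: R] f ->
  (\int[pushforward mu lebesgue_id]_x f x = \int[mu]_x f x)%E.
Proof.
move=> mf; rewrite integralE [RHS]integralE.
rewrite !ge0_integral_pushforward//; first exact: measurable_funeneg.
exact: measurable_funepos.
Qed.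

Lemma Rintegral_frac (f : R -> R) : measurable_fun Rplus f ->
  \int[frac_measure H]_(x in Rplus) f x = \int[mu]_(x in Rplus) (f x * w x).
Proof.
move=> mf; have mR := @measurable_Rplus R.
rewrite /Rintegral; congr fine; rewrite integral_mkcond [RHS]integral_mkcond.
(* [frac_measure] charges only [Rplus], so its density on the whole line is [w] extended by 0. *)
pose g := w \_ Rplus.
have g0 x : 0 <= g x by rewrite /g patchE; case: ifP.
have mg : measurable_fun [set: R] g by apply/(measurable_restrictT _ mR); exact: mw.
have mfE : measurable_fun [set: R] ((fun x => (f x)%:E) \_ Rplus).
  by apply/(measurable_restrictT _ mR); exact/measurable_EFinP.
rewrite (@integral_density _ _ _ (pushforward mu lebesgue_id) _ g)//.
  rewrite integral_lebesgue_id; last first.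
    by apply: emeasurable_funM => //; exact/measurable_EFinP.
  apply: eq_integral => x _; rewrite /g !patchE.
  by case: ifP => _; rewrite ?EFinM ?mule0.
move=> A mA; rewrite integral_mkcond integral_lebesgue_id; last first.
  by apply/(measurable_restrictT _ mA); apply/measurable_EFinP; exact: measurable_funTS.
transitivity (\int[mu]_(x in A `&` Rplus) (w x)%:E)%E; first by [].
rewrite integral_mkcond; apply: eq_integral => x _.
rewrite /g !patchE in_setI; case: (x \in A) => //=.
by case: ifP.
Qed.

Lemma weight_near0 x : 0 < x ->
  (\int[mu]_(y in `[0%R, x[) (w y)%:E <= (c_ H * (x `^ (a + 1) / (a + 1)))%:E)%E.
Proof.
move=> x0; have mwE D : measurable_fun D (EFin \o w) by apply/measurable_EFinP.
have wE0 y : (0 <= (w y)%:E)%E by rewrite lee_fin.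
apply: (@le_trans _ _ (\int[mu]_(y in `[0%R, x]) (w y)%:E)%E).
  apply: ge0_subset_integral => //; first exact: mwE.
  by move=> y; rewrite /= !in_itv/= => /andP[-> /ltW].
rewrite -integral_itv_obnd_cbnd//.
under eq_integral do rewrite EFinM.
rewrite ge0_integralZl//; last 3 first.
- exact: ge0_measurable_powRE.
- by move=> y _; rewrite lee_fin powR_ge0.
- by rewrite lee_fin c_ge0.
rewrite EFinM; apply: lee_wpmul2l; first by rewrite lee_fin c_ge0.
by apply: integral_powR_near0 => //; rewrite /a; move: H_range => /andP[]; lra.
Qed.

Lemma weight_tail x t p : 0 < x -> 0 < t -> 0 <= p <= 1 -> a - p + 1 < 0 ->
  (\int[mu]_(y in `[x, +oo[) (expR (- y * t) * w y)%:E <=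
   (c_ H * (t `^ (- p) * (x `^ (a - p + 1) / - (a - p + 1))))%:E)%E.
Proof.
move=> x0 t0 p01 ap.
apply: (@le_trans _ _ (\int[mu]_(y in `[x, +oo[)
    ((c_ H * t `^ (- p))%:E * (y `^ (a - p))%:E))%E).
  apply: ge0_le_integral => //.
  - by move=> y _; rewrite lee_fin mulr_ge0 ?expR_ge0.
  - apply/measurable_EFinP; apply: measurable_funM; last exact: mw.
    apply: measurableT_comp => //; apply: measurable_funTS.
    by apply: measurable_funM => //; exact: measurableT_comp.
  - by apply: emeasurable_funM => //; exact: ge0_measurable_powRE.
  - move=> y; rewrite /= in_itv/= andbT => xy.
    have y0 : 0 < y by exact: lt_le_trans xy.
    rewrite -EFinM lee_fin /w.
    have := @expRN_le_powR _ (y * t) p (mulr_gt0 y0 t0) p01.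
    rewrite (powRM _ (ltW y0) (ltW t0)) => h.
    have -> : c_ H * t `^ (- p) * y `^ (a - p) =
        y `^ (- p) * t `^ (- p) * (c_ H * y `^ a).
      rewrite powRD; first by ring.
      by rewrite (negbT (gt_eqF y0)) implybT.
    by rewrite mulNr ler_wpM2r// mulr_ge0 ?c_ge0 ?powR_ge0.
rewrite ge0_integralZl//; last 3 first.
- exact: ge0_measurable_powRE.
- by move=> y _; rewrite lee_fin powR_ge0.
- by rewrite lee_fin mulr_ge0 ?c_ge0 ?powR_ge0.
rewrite [in leRHS]mulrA [leRHS]EFinM.
apply: lee_wpmul2l; first by rewrite lee_fin mulr_ge0 ?c_ge0 ?powR_ge0.
by apply: integral_powR_nearoo => //; move: ap; lra.
Qed.

Variables (m : R -> R) (b : R).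
Hypotheses (mm : measurable_fun Rplus m) (mb : forall x, 0 <= x -> `|m x| <= b).

Let b_ge0 : 0 <= b. Proof. exact: le_trans (mb (lexx 0)). Qed.

Definition laplace_integrand (t x : R) : R := expR (- x * t) * m x.
Local Notation phi := laplace_integrand.

Lemma measurable_laplace_integrand t : measurable_fun Rplus (phi t).
Proof.
apply: measurable_funM => //; apply: measurableT_comp => //.
by apply: measurable_funTS; apply: measurable_funM => //; exact: measurableT_comp.
Qed.

Let q t x : R := phi t x * w x.

Let mq t D : measurable D -> D `<=` Rplus -> measurable_fun D (q t).
Proof.
move=> mD DR; apply: (measurable_funS measurable_Rplus DR).
by apply: measurable_funM; [exact: measurable_laplace_integrand|exact: mw].
Qed.

Let q_le t x : 0 <= x -> `|q t x| <= b * (expR (- x * t) * w x).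
Proof.
move=> x0; have -> : `|q t x| = `|m x| * (expR (- x * t) * w x).
  rewrite /q normrM (ger0_norm (w_ge0 x)) /phi normrM (ger0_norm (expR_ge0 _)).
  by rewrite mulrAC mulrC.
by rewrite ler_wpM2r ?mb// mulr_ge0 ?expR_ge0.
Qed.

Let abs_tail t x p : 0 < x -> 0 < t -> 0 <= p <= 1 -> a - p + 1 < 0 ->
  (\int[mu]_(y in `[x, +oo[) `|(q t y)%:E| <=
   (b * (c_ H * (t `^ (- p) * (x `^ (a - p + 1) / - (a - p + 1)))))%:E)%E.
Proof.
move=> x0 t0 p01 ap.
have sub : `[x, +oo[%classic `<=` Rplus.
  by move=> y; rewrite /= in_itv/= andbT => xy; rewrite (le_trans (ltW x0)).
have mew : measurable_fun `[x, +oo[ (fun y => (expR (- y * t) * w y)%:E).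
  apply/measurable_EFinP; apply: measurable_funM; last exact: mw.
  apply: measurableT_comp => //; apply: measurable_funTS.
  by apply: measurable_funM => //; exact: measurableT_comp.
apply: (@le_trans _ _ (\int[mu]_(y in `[x, +oo[)
    (b%:E * (expR (- y * t) * w y)%:E))%E).
  apply: ge0_le_integral => //.
  - apply: measurableT_comp => //; apply/measurable_EFinP.
    by apply: mq; [exact: measurable_itv|].
  - by apply: emeasurable_funM.
  - by move=> y /sub y0; rewrite -EFinM lee_fin; exact: q_le.
rewrite ge0_integralZl//; last first.
- by move=> y _; rewrite lee_fin mulr_ge0 ?expR_ge0.
rewrite [leRHS]EFinM; apply: lee_wpmul2l; first by rewrite lee_fin.
exact: weight_tail.
Qed.

Let abs_near0 t x : 0 < x -> 0 <= t ->
  (\int[mu]_(y in `[0%R, x[) `|(q t y)%:E| <=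
   (b * (c_ H * (x `^ (a + 1) / (a + 1))))%:E)%E.
Proof.
move=> x0 t0.
have sub : `[0, x[%classic `<=` Rplus.
  by move=> y; rewrite /= in_itv/= => /andP[].
apply: (@le_trans _ _ (\int[mu]_(y in `[0%R, x[) (b%:E * (w y)%:E))%E).
  apply: ge0_le_integral => //.
  - apply: measurableT_comp => //; apply/measurable_EFinP.
    by apply: mq; [exact: measurable_itv|].
  - by apply: emeasurable_funM => //; apply/measurable_EFinP; exact: mw.
  - move=> y /sub y0; rewrite -EFinM lee_fin; apply: le_trans (q_le t y0) _.
    rewrite ler_wpM2l// ler_piMl//.
    by rewrite -expR0 ler_expR mulNr oppr_le0 mulr_ge0.
rewrite ge0_integralZl//; last first.
- by move=> y _; rewrite lee_fin.
- by apply/measurable_EFinP; exact: mw.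
rewrite [leRHS]EFinM; apply: lee_wpmul2l; first by rewrite lee_fin.
exact: weight_near0.
Qed.

Let Rplus_split (x : R) : 0 <= x -> Rplus = `[0, x[ `|` `[x, +oo[.
Proof.
move=> x0; apply/seteqP; split => y /=; rewrite !in_itv/= andbT.
  by move=> y0; have [yx|xy] := ltP y x; [left|right]; rewrite ?y0.
by move=> [/andP[]//|xy]; exact: le_trans xy.
Qed.

Let disj (x : R) : [disjoint `[0, x[%classic & `[x, +oo[%classic].
Proof.
apply/disj_setPS => y /=; rewrite !in_itv/= andbT => -[/andP[_ yx] xy].
by move: (lt_le_trans yx xy); rewrite ltxx.
Qed.

(** Below 1 the weight is integrable because [a + 1 = 1/2 - H] is positive; beyond 1 the exponent p
    = 1 suffices for the tail. *)
Lemma kernel_integrable t : 0 < t -> mu.-integrable Rplus (EFin \o q t).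
Proof.
move=> t0; apply/integrableP; split.
  by apply/measurable_EFinP; apply: mq => //; exact: measurable_Rplus.
rewrite (Rplus_split ler01) ge0_integral_setU//=; last first.
  apply/measurable_EFinP; apply: measurableT_comp => //.
  rewrite -(Rplus_split ler01); apply: mq => //; exact: measurable_Rplus.
apply: lte_add_pinfty.
  exact: le_lt_trans (abs_near0 ltr01 (ltW t0)) (ltry _).
apply: le_lt_trans (@abs_tail t 1 1 ltr01 t0 _ _) (ltry _).
  by rewrite ler01 lexx.
by rewrite /a; move: H_range => /andP[]; lra.
Qed.

Let norm_Rintegral_le D t (B : R) : measurable D -> D `<=` Rplus -> 0 < t ->
  (\int[mu]_(y in D) `|(q t y)%:E| <= B%:E)%E -> `|\int[mu]_(y in D) q t y| <= B.
Proof.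
move=> mD0 DR t0 hB; have mD : @measurable _ (measurableTypeR R) D by exact: mD0.
have i : mu.-integrable D (EFin \o q t).
  apply: (@integrableS _ (measurableTypeR R) R mu Rplus D) => //.
    exact: measurable_Rplus.
  exact: kernel_integrable.
apply: (le_trans (le_normr_Rintegral mD i)); rewrite /Rintegral.
have -> : B = fine B%:E by [].
apply: fine_le => //.
have := integrable_fin_num mD (integrable_norm i).
by apply.
Qed.

(** The cut at 1 separates the singularity of the weight from its tail; [p] governs the blow-up
    allowed as [t] tends to 0. *)
Lemma kernel_bound t p : 0 < t -> 0 <= p <= 1 -> a - p + 1 < 0 ->
  `|\int[frac_measure H]_(x in Rplus) phi t x| <=
  b * c_ H * ((a + 1)^-1 + t `^ (- p) / - (a - p + 1)).
Proof.
move=> t0 p01 ap; rewrite Rintegral_frac; last exact: measurable_laplace_integrand.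
rewrite (Rplus_split ler01) Rintegral_setU; last 4 first.
- exact: measurable_itv.
- exact: measurable_itv.
- by rewrite -(Rplus_split ler01); exact: kernel_integrable.
- exact: disj.
apply: (le_trans (ler_normD _ _)).
have sub1 : `[0, 1[%classic `<=` Rplus by move=> y; rewrite /= in_itv/= => /andP[].
have sub2 : `[1, +oo[%classic `<=` Rplus.
  by move=> y; rewrite /= in_itv/= andbT => xy; rewrite (le_trans ler01).
have h1 := norm_Rintegral_le (measurable_itv _) sub1 t0 (abs_near0 ltr01 (ltW t0)).
have h2 := norm_Rintegral_le (measurable_itv _) sub2 t0 (abs_tail ltr01 t0 p01 ap).
apply: le_trans (lerD h1 h2) _; rewrite !powR1 le_eqVlt; apply/orP; left; apply/eqP.
by ring.
Qed.

Variables (F : nat -> R -> R) (T : R).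
Hypotheses (F0 : forall x, 0 <= x -> F 0%N x = m x)
  (jF : is_jet 4 [set x : R | 0 < x] F)
  (Fb : forall j x, (j <= 4)%N -> 0 <= x -> `|F j x| <= b)
  (m_lip : forall x y, 0 <= x -> 0 <= y -> `|m x - m y| <= b * `|x - y|).
Variables (beta K : R) (n : nat) (beta01 : 0 < beta < 1) (K_gt1 : 1 < K).
Hypothesis n_gt0 : (0 < n)%N.
Variable rho : nat -> R.
Hypothesis rho_in_cell : forall i, (1 <= i <= n)%N -> cell beta K n i (rho i).
Variable t : R.
Hypotheses (t0 : 0 < t) (tT : t <= T).

Let T0 : 0 <= T. Proof. exact: le_trans (ltW t0) tT. Qed.
Let Kb := K `^ beta.
Let Kb_ge1 : 1 <= Kb. Proof. exact: Kbeta_ge1. Qed.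
Let Kb_gt0 : 0 < Kb. Proof. exact: lt_le_trans Kb_ge1. Qed.
Let nR_gt0 : 0 < n%:R :> R. Proof. by rewrite ltr0n. Qed.
Let h := (K - Kb) / n%:R.

(** The exponential is bounded by 1 and T-Lipschitz, [m] is bounded and Lipschitz with the same [b].
    The constant is uniform in [t <= T]. *)
Lemma laplace_integrand_lipschitz x y : 0 <= x -> 0 <= y ->
  `|phi t x - phi t y| <= (1 + T) * b * `|x - y|.
Proof.
have expR_le1 z : 0 <= z -> expR (- z * t) <= 1.
  by move=> z0; rewrite -expR0 ler_expR mulNr oppr_le0 mulr_ge0// ltW.
have expR_lip : forall z z', 0 <= z -> z <= z' ->
    `|expR (- z * t) - expR (- z' * t)| <= T * `|z - z'|.
  move=> z z' z0 zz'; rewrite ger0_norm; last first.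
    by rewrite subr_ge0 ler_expR ler_wpM2r ?(ltW t0)// lerN2.
  have -> : expR (- z' * t) = expR (- z * t) * expR (- ((z' - z) * t)).
    by rewrite -expRD; congr expR; ring.
  rewrite -[X in X - _]mulr1 -mulrBr distrC ger0_norm ?subr_ge0//.
  have h1 : 0 <= 1 - expR (- ((z' - z) * t)).
    by rewrite subr_ge0 -expR0 ler_expR oppr_le0 mulr_ge0 ?subr_ge0// ltW.
  apply: (@le_trans _ _ (1 * (1 - expR (- ((z' - z) * t))))).
    by apply: ler_wpM2r => //; exact: expR_le1.
  rewrite mul1r; apply: (@le_trans _ _ ((z' - z) * t)).
    by have := expR_ge1Dx (- ((z' - z) * t)); lra.
  by rewrite mulrC ler_wpM2r// subr_ge0.
move=> x0 y0.
have {}expR_lip : `|expR (- x * t) - expR (- y * t)| <= T * `|x - y|.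
  have [xy|/ltW yx] := leP x y; first exact: expR_lip.
  by rewrite distrC (distrC x); exact: expR_lip.
have -> : phi t x - phi t y = (expR (- x * t) - expR (- y * t)) * m x +
    expR (- y * t) * (m x - m y) by rewrite /phi; ring.
apply: (le_trans (ler_normD _ _)); rewrite !normrM (ger0_norm (expR_ge0 _)).
have h1 : `|expR (- x * t) - expR (- y * t)| * `|m x| <= T * `|x - y| * b.
  by apply: ler_pM => //; exact: mb.
have h2 : expR (- y * t) * `|m x - m y| <= 1 * (b * `|x - y|).
  by apply: ler_pM => //; [exact: expR_le1|exact: m_lip].
by apply: le_trans (lerD h1 h2) _; rewrite le_eqVlt; apply/orP; left; apply/eqP; ring.
Qed.

Let u k : R := k%:R / n%:R * Kb.

Let uS k : u k <= u k.+1.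
Proof. by rewrite ler_wpM2r ?(ltW Kb_gt0)// ler_wpM2r ?invr_ge0// ler_nat. Qed.

Let u_ge0 k : 0 <= u k. Proof. by rewrite !mulr_ge0// ?invr_ge0// ltW. Qed.

Let u0 : u 0%N = 0. Proof. by rewrite /u !mul0r. Qed.
Let un : u n = Kb. Proof. by rewrite /u divff ?mul1r// gt_eqF. Qed.

Let cellE k : cell beta K n k.+1 = `[u k, u k.+1[%classic. Proof. by []. Qed.

Let cell_sub k : `[u k, u k.+1[%classic `<=` Rplus.
Proof. by move=> x; rewrite /= in_itv/= => /andP[ux _]; exact: le_trans ux. Qed.

Let integrable_q D : measurable D -> D `<=` Rplus -> mu.-integrable D (EFin \o q t).
Proof.
move=> mD DR; apply: (@integrableS _ (measurableTypeR R) R mu Rplus D) => //.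
  exact: measurable_Rplus.
exact: kernel_integrable.
Qed.

Let integrable_w x : 0 < x -> mu.-integrable `[0, x[ (EFin \o w).
Proof.
move=> x0; apply/integrableP; split; first by apply/measurable_EFinP; exact: mw.
under eq_integral do rewrite gee0_abs ?lee_fin//.
exact: le_lt_trans (weight_near0 x0) (ltry _).
Qed.

Let integrable_w_cell k : (k < n)%N -> mu.-integrable `[u k, u k.+1[ (EFin \o w).
Proof.
move=> kn; have x0 : 0 < u k.+1.
  by rewrite /u mulr_gt0// divr_gt0// ltr0n.
apply: integrableS (integrable_w x0); [exact: measurable_itv|exact: measurable_itv|].
by move=> x; rewrite /= !in_itv/= => /andP[ux ->]; rewrite (le_trans (u_ge0 k)).
Qed.

Let frac_cell k : fine (frac_measure H (cell beta K n k.+1)) =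
  \int[mu]_(x in `[u k, u k.+1[) w x.
Proof.
rewrite /frac_measure/= cellE (_ : _ `&` _ = `[u k, u k.+1[%classic)//.
by apply/setIidl/cell_sub.
Qed.

(** Two points of a cell differ by at most its width [Kb / n]. The Lipschitz bound therefore serves
    an arbitrary node, and the weight is integrated exactly. *)
Let cell_error k : (k < n)%N ->
  `|\int[mu]_(x in `[u k, u k.+1[) q t x -
    fine (frac_measure H (cell beta K n k.+1)) * phi t (rho k.+1)| <=
  (1 + T) * b * (Kb / n%:R) * \int[mu]_(x in `[u k, u k.+1[) w x.
Proof.
move=> kn; have mI : measurable (`[u k, u k.+1[ : set (measurableTypeR R)).
  exact: measurable_itv.
have iw := integrable_w_cell kn.
have iq : mu.-integrable `[u k, u k.+1[ (EFin \o q t).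
  by apply: integrable_q; [exact: measurable_itv|exact: cell_sub].
have rk := @rho_in_cell k.+1 kn; rewrite cellE /= in_itv/= in rk.
move/andP: rk => [rk1 rk2].
rewrite frac_cell (mulrC _ (phi _ _)) -[X in _ - X]RintegralZl//.
have iwp : mu.-integrable `[u k, u k.+1[ (EFin \o (fun x => phi t (rho k.+1) * w x)).
  by have := integrableZl mI (phi t (rho k.+1)) iw.
rewrite -RintegralB//.
have id : mu.-integrable `[u k, u k.+1[
    (EFin \o (fun x => q t x - phi t (rho k.+1) * w x)).
  by have := integrableB mI iq iwp.
apply: (le_trans (le_normr_Rintegral mI id)).
rewrite -RintegralZl//; apply: le_Rintegral => //.
- exact: integrable_norm id.
- by have := integrableZl mI ((1 + T) * b * (Kb / n%:R)) iw.
- move=> x; rewrite /= in_itv/= => /andP[x1 x2].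
  rewrite /q -mulrBl normrM (ger0_norm (w_ge0 x)); apply: ler_wpM2r => //.
  apply: le_trans (laplace_integrand_lipschitz _ _) _.
  + exact: le_trans x1.
  + exact: le_trans rk1.
  + apply: ler_wpM2l; first by rewrite mulr_ge0// addr_ge0.
    have : u k.+1 - u k = Kb / n%:R by rewrite /u -natr1; ring.
    by rewrite ler_norml; lra.
Qed.

Let cells_error :
  `|\int[mu]_(x in `[0, Kb[) q t x -
    \sum_(k < n) fine (frac_measure H (cell beta K n k.+1)) * phi t (rho k.+1)| <=
  (1 + T) * b * (Kb / n%:R) * (c_ H * (Kb `^ (a + 1) / (a + 1))).
Proof.
have iq : mu.-integrable `[u 0%N, u n[ (EFin \o q t).
  apply: integrable_q; first exact: measurable_itv.
  by move=> x; rewrite /= in_itv/= u0 => /andP[].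
have iw : mu.-integrable `[u 0%N, u n[ (EFin \o w).
  by rewrite u0 un; exact: integrable_w.
have := Rintegral_itv_sum uS iq; rewrite u0 un => ->.
rewrite -sumrB; apply: (le_trans (ler_norm_sum _ _ _)).
apply: (@le_trans _ _ (\sum_(k < n) ((1 + T) * b * (Kb / n%:R) *
    \int[mu]_(x in `[u k, u k.+1[) w x))).
  by apply: ler_sum => k _; exact: cell_error.
rewrite -mulr_sumr -(Rintegral_itv_sum uS iw) u0 un; apply: ler_wpM2l.
  by rewrite !mulr_ge0 ?addr_ge0 ?invr_ge0// ltW.
have := weight_near0 Kb_gt0; rewrite u0 un in iw.
by rewrite -[leLHS]fineK ?lee_fin//; apply: integrable_fin_num iw; exact: measurable_itv.
Qed.

Let Kb_lt : Kb < K.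
Proof.
have /andP[b0 b1] := beta01; have K0 : 0 < K := lt_trans ltr01 K_gt1.
rewrite -[ltRHS]powRr1 ?(ltW K0)// /Kb /powR !gt_eqF//.
by rewrite ltr_expR ltr_pM2r ?ln_gt0.
Qed.

Let h_gt0 : 0 < h. Proof. by rewrite divr_gt0// subr_gt0. Qed.

Let v k : R := Kb + k%:R * (K - Kb) / n%:R.
Let vS k : v k.+1 = v k + h.
Proof. by rewrite /v /h -natr1; ring. Qed.
Let v0 : v 0%N = Kb. Proof. by rewrite /v !mul0r addr0. Qed.
Let vn : v n = K.
Proof. by rewrite /v mulrC mulKf ?gt_eqF// addrC subrK. Qed.
Let v_ge k : Kb <= v k.
Proof. by rewrite lerDl !mulr_ge0 ?invr_ge0// subr_ge0 ltW. Qed.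

Let pt0E k : simpson_pt0 beta K n k.+1 = v k. Proof. by []. Qed.
Let pt2E k : simpson_pt2 beta K n k.+1 = v k.+1. Proof. by []. Qed.
Let pt1E k : simpson_pt1 beta K n k.+1 = v k + h / 2.
Proof.
(* With i = k + 1, the odd number 2 i - 1 is 2 k + 1 half steps, the midpoint of the subinterval. *)
have e : (2 * k.+1).-1 = (2 * k).+1 by rewrite mulnS.
rewrite /simpson_pt1 e -natr1 natrM /v /h -/Kb; field.
by rewrite gt_eqF.
Qed.

Let G := jet_mul (jet_mul (expR_jet t) F) (powR_jet a).

Let G0 x : 0 <= x -> q t x = c_ H * G 0%N x.
Proof.
move=> x0; rewrite /q /phi /w /G/= /expR_jet/powR_jet expr0 big_ord0 subr0 F0//.
by ring.
Qed.

Let jG : is_jet 4 [set x : R | 0 < x] G.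
Proof.
apply: is_jet_mul; last by apply: is_jet_powR => x.
by apply: is_jet_mul => //; exact: is_jet_expR.
Qed.

(** Each of the two products in [G] costs a factor 16. Since a < 0, x^a is largest at the left end
    [Kb], which gives the factor needed in [simpson_rate]. *)
Let B4 := 16 * (16 * ((1 + T) ^+ 4 * b) * (24 * Kb `^ a)).

Let G4_bound x : Kb <= x -> `|G 4%N x| <= B4.
Proof.
move=> Kbx; have x0 : 0 <= x by rewrite (le_trans (ltW Kb_gt0)).
have x1 : 1 <= x := le_trans Kb_ge1 Kbx.
have a1 : -1 < a < 0 by rewrite /a; move: H_range => /andP[]; lra.
apply: jet_mul_bound => // j j4.
  apply: jet_mul_bound => // i i4; last exact: Fb.
  by apply: expR_jet_bound => //; rewrite ltW.
apply: le_trans (powR_jet_bound a1 x1 j4) _; rewrite ler_wpM2l//.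
have an : 0 <= - a by move: a1 => /andP[]; lra.
have K0 : 0 < K := lt_trans ltr01 K_gt1.
have xa : 0 < x `^ (- a) by rewrite powR_gt0// (lt_le_trans ltr01 x1).
have Kba : 0 < Kb `^ (- a) by rewrite powR_gt0.
rewrite -[a]opprK !(powRN _ (- a)) lef_pV2 ?posrE//.
by apply: ge0_ler_powR; rewrite ?nnegrE ?(ltW Kb_gt0).
Qed.

Let simpson_cell k :
  `|\int[mu]_(x in `[v k, v k.+1[) q t x - c_ H * (h / 6) *
     (G 0%N (v k) + 4 * G 0%N (v k + h / 2) + G 0%N (v k.+1))| <=
  c_ H * (2 * B4 * h ^+ 5).
Proof.
have v_gt0 : 0 < v k by exact: lt_le_trans (v_ge k).
have sub : `[v k, v k + h]%classic `<=` [set x : R | 0 < x].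
  by move=> x; rewrite /= in_itv/= => /andP[vx _]; exact: lt_le_trans vx.
have jG' : is_jet 4 `[v k, v k + h] G by move=> j x j4 /sub; exact: jG.
have G4 x : v k <= x <= v k + h -> `|G 4%N x| <= B4.
  by move=> /andP[vx _]; apply: G4_bound; exact: le_trans vx.
have := simpson_error h_gt0 jG' G4; rewrite vS.
have subR : `[v k, v k + h[%classic `<=` Rplus.
  by move=> x; rewrite /= in_itv/= => /andP[vx _]; rewrite (le_trans (ltW v_gt0)).
rewrite Rintegral_itv_bndo_bndc; last first.
  by apply: integrable_q; [exact: measurable_itv|].
have -> : \int[mu]_(x in `[v k, v k + h]) q t x =
    c_ H * \int[mu]_(x in `[v k, v k + h]) G 0%N x.
  rewrite -RintegralZl//; last first.
    apply: continuous_compact_integrable; first exact: segment_compact.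
    apply: (is_derive_within_continuous (f' := G 1%N)) => x vx.
    by apply: jG' => //=; rewrite in_itv.
  apply: eq_Rintegral => x; rewrite inE => /sub /= x0.
  by rewrite G0// ltW.
move=> hS; rewrite -mulrA -mulrBr normrM ger0_norm ?c_ge0//.
by apply: ler_wpM2l; rewrite ?c_ge0.
Qed.

Let simpson_total :
  `|\int[mu]_(x in `[Kb, K[) q t x - simpson_scale H beta K n * \sum_(k < n)
    (simpson_pt0 beta K n k.+1 `^ a * phi t (simpson_pt0 beta K n k.+1) +
     4 * simpson_pt1 beta K n k.+1 `^ a * phi t (simpson_pt1 beta K n k.+1) +
     simpson_pt2 beta K n k.+1 `^ a * phi t (simpson_pt2 beta K n k.+1))| <=
  n%:R * (c_ H * (2 * B4 * h ^+ 5)).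
Proof.
have iq : mu.-integrable `[v 0%N, v n[ (EFin \o q t).
  apply: integrable_q; first exact: measurable_itv.
  by move=> x; rewrite /= in_itv/= v0 => /andP[/(le_trans (ltW Kb_gt0))].
have vle k : v k <= v k.+1 by rewrite vS lerDl ltW.
have := Rintegral_itv_sum vle iq; rewrite v0 vn => ->.
rewrite mulr_sumr -sumrB; apply: (le_trans (ler_norm_sum _ _ _)).
rewrite -[X in X%:R * _]card_ord mulr_natl -sumr_const; apply: ler_sum => k _.
rewrite (le_trans _ (simpson_cell k))// le_eqVlt; apply/orP; left; apply/eqP.
congr `|_ - _|; rewrite pt0E pt1E pt2E.
have GE x : Kb <= x -> x `^ a * phi t x = G 0%N x.
  move=> Kbx; rewrite /phi /G/= /expR_jet/powR_jet expr0 big_ord0 subr0 F0.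
    by ring.
  by rewrite (le_trans (ltW Kb_gt0)).
have vm : Kb <= v k + h / 2.
  by apply: (le_trans (v_ge k)); rewrite lerDl divr_ge0// ltW.
rewrite -[4 * _ * _]mulrA !GE// /simpson_scale -/Kb /h; field.
by rewrite gt_eqF.
Qed.

(** The three terms come from the cells of [0, K^beta[, Simpson's rule on [K^beta, K] and the
    truncation at [K]. Only the last depends on [p] and is singular in [t]. *)
Lemma quadrature_error p : 0 <= p <= 1 -> a - p + 1 < 0 ->
  `|\int[quad_measure H n beta01 K_gt1 rho]_(x in Rplus) phi t x -
    \int[frac_measure H]_(x in Rplus) phi t x| <=
  (1 + T) * b * (Kb / n%:R) * (c_ H * (Kb `^ (a + 1) / (a + 1))) +
  n%:R * (c_ H * (2 * B4 * h ^+ 5)) +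
  b * (c_ H * (t `^ (- p) * (K `^ (a - p + 1) / - (a - p + 1)))).
Proof.
move=> p01 ap; rewrite Rintegral_frac; last exact: measurable_laplace_integrand.
have K0 : 0 < K := lt_trans ltr01 K_gt1.
have rho0 k : (k < n)%N -> 0 <= rho k.+1.
  by move=> kn; have := @rho_in_cell k.+1 kn; rewrite cellE => /cell_sub.
rewrite Rintegral_quad//; last exact: measurable_laplace_integrand.
have sub1 : `[0, K[%classic `<=` Rplus by move=> y; rewrite /= in_itv/= => /andP[].
have sub2 : `[K, +oo[%classic `<=` Rplus.
  by move=> y; rewrite /= in_itv/= andbT => Ky; rewrite (le_trans (ltW K0)).
have tail := norm_Rintegral_le (measurable_itv _) sub2 t0 (abs_tail K0 t0 p01 ap).
rewrite (Rplus_split (ltW K0)) Rintegral_setU; last 4 first.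
- exact: measurable_itv.
- exact: measurable_itv.
- by rewrite -(Rplus_split (ltW K0)); exact: kernel_integrable.
- exact: disj.
(* The points 0, Kb, K as a monotone sequence, so that [Rintegral_itv_sum] also provides the cut at
   [Kb]. *)
pose z k : R := if k is k'.+1 then (if k' is _.+1 then K else Kb) else 0.
have zS k : z k <= z k.+1.
  by case: k => [|[|k]] /=; rewrite ?lexx// ltW.
have iz : mu.-integrable `[z 0%N, z 2%N[ (EFin \o q t).
  by apply: integrable_q; [exact: measurable_itv|exact: sub1].
have := Rintegral_itv_sum zS iz; rewrite big_ord_recl big_ord1 /= => ->.
have := cells_error; have := simpson_total; rewrite /quad_sum -/a.
set I1 := \int[mu]_(x in `[0, Kb[) _; set I2 := \int[mu]_(x in `[Kb, K[) _.
set I3 := \int[mu]_(x in `[K, +oo[) _ in tail *.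
set S1 := \sum_(k < n) (fine _ * _).
set S2 := simpson_scale _ _ _ _ * _ => e2 e1.
have -> : S1 + S2 - (I1 + I2 + I3) = - (I1 - S1) - (I2 - S2) - I3 by ring.
apply: (le_trans (ler_normB _ _)); apply: lerD => //.
by apply: (le_trans (ler_normB _ _)); rewrite normrN; apply: lerD.
Qed.

End fractional_kernel.

(** * Rates in n *)

Section asymptotics.
Context {R : realType}.

(** The big-O bound holds eventually. Because [v >= 1], the finitely many earlier terms are absorbed
    by adding their absolute values to the constant. *)
Lemma bigO_seq_bound (u v : R^nat) : u =O_\oo v ->
  (forall n, (0 < n)%N -> 1 <= v n) ->
  exists2 C, 0 < C & forall n, (0 < n)%N -> `|u n| <= C * v n.
Proof.
move=> /eqO_exP[k k0 [n0 _ hn0]] v1.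
exists (k + \sum_(i < n0) `|u i|).
  by apply: ltr_wpDr => //; apply: sumr_ge0.
move=> n n0'; have v0 : 0 <= v n by exact: le_trans (v1 n n0').
have S0 : 0 <= \sum_(i < n0) `|u i| by apply: sumr_ge0.
have [nn|nn] := leqP n0 n.
  apply: le_trans (hn0 n nn) _; rewrite ger0_norm// ler_wpM2r//.
  by rewrite lerDl.
apply: (@le_trans _ _ ((k + \sum_(i < n0) `|u i|) * 1)); last first.
  by rewrite ler_wpM2l ?v1// addr_ge0// ltW.
rewrite mulr1 (bigD1 (Ordinal nn))//= addrCA lerDl addr_ge0 ?(ltW k0)//.
exact: sumr_ge0.
Qed.

(** Equivalence yields a big-O relation in each direction, and [bigO_seq_bound] makes both valid for
    every positive [n]. *)
Lemma equiv_seq_bounds (K f : R^nat) : K ~_\oo f ->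
  (forall n, (0 < n)%N -> 1 < K n) -> (forall n, (0 < n)%N -> 1 <= f n) ->
  exists c1 c2, [/\ 0 < c1, 0 < c2 &
    forall n, (0 < n)%N -> c1 * f n <= K n <= c2 * f n].
Proof.
move=> Kf K1 f1.
have [c2 c20 h2] := bigO_seq_bound (equivOLR Kf) f1.
have [c1 c10 h1] := bigO_seq_bound (equivORL Kf) (fun n n0 => ltW (K1 n n0)).
exists c1^-1, c2; split; rewrite ?invr_gt0// => n n0.
have := h1 n n0; have := h2 n n0.
have K0 : 0 <= K n by rewrite ltW// (lt_trans ltr01) ?K1.
have f0 : 0 <= f n by rewrite (le_trans ler01) ?f1.
by rewrite !ger0_norm// => -> ?; rewrite andbT ler_pdivrMl.
Qed.

Lemma powR_scale (kappa N g r : R) : 0 <= kappa -> 0 <= N ->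
  (kappa * N `^ g) `^ r = kappa `^ r * N `^ (g * r).
Proof. by move=> k0 N0; rewrite powRM ?powR_ge0// powRrM. Qed.

Section rates.
Variables (H beta g : R) (n : nat) (K c1 c2 : R).
Hypotheses (H_range : 0 < H < 2^-1)
  (beta_def : beta = (10 - 6 * H) / (13 - 6 * H))
  (g_def : g = (13 - 6 * H) / (15 - 6 * H))
  (beta01 : 0 < beta < 1) (K_gt1 : 1 < K) (n_gt0 : (0 < n)%N) (c10 : 0 < c1)
  (K_bounds : c1 * n%:R `^ g <= K <= c2 * n%:R `^ g).
Let a : R := - H - 2^-1.
Let N : R := n%:R.
Let N1 : 1 <= N. Proof. by rewrite ler1n. Qed.
Let N0 : 0 < N. Proof. exact: lt_le_trans N1. Qed.
Let Ng0 : 0 < N `^ g. Proof. exact: powR_gt0. Qed.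
(** [K] is exactly [kappa] times n^g with [kappa] between [c1] and [c2]: powers of [K] split into an
    exact power of n and a bounded factor. *)
Let kappa := K / N `^ g.
Let KE : K = kappa * N `^ g. Proof. by rewrite divfK// gt_eqF. Qed.
Let kappa1 : c1 <= kappa.
Proof. by rewrite ler_pdivlMr//; have /andP[] := K_bounds. Qed.
Let kappa2 : kappa <= c2.
Proof. by rewrite ler_pdivrMr//; have /andP[] := K_bounds. Qed.
Let kappa0 : 0 < kappa. Proof. exact: lt_le_trans kappa1. Qed.
Let dens : 13 - 6 * H != 0 /\ 15 - 6 * H != 0.
Proof. by move: H_range => /andP[h1 h2]; split; rewrite gt_eqF//; lra. Qed.

Let NE r s : N `^ r * N `^ s = N `^ (r + s).
Proof. by rewrite powRD// (gt_eqF N0) implybT. Qed.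

(** First balance of exponents: g beta (a + 2) - 1 = - H g, where a + 2 = 3/2 - H is positive, so
    that the upper bound [c2] on [kappa] enters. *)
Lemma cell_rate :
  K `^ beta / N * (K `^ beta) `^ (a + 1) <= c2 `^ (beta * (a + 2)) * N `^ (- (H * g)).
Proof.
have b0 : 0 <= beta by have /andP[/ltW] := beta01.
have a2 : 0 <= a + 2 by rewrite /a; move: H_range => /andP[]; lra.
have -> : K `^ beta / N * (K `^ beta) `^ (a + 1) = K `^ (beta * (a + 2)) / N.
  rewrite mulrAC; congr (_ / _).
  have K0 : 0 < K := lt_trans ltr01 K_gt1.
  rewrite -[X in X * _](@powRr1 _ (K `^ beta)) ?powR_ge0// -!powRrM -powRD.
    by congr (_ `^ _); ring.
  by rewrite (gt_eqF K0) implybT.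
rewrite {1}KE powR_scale ?(ltW kappa0) ?(ltW N0)// -mulrA.
have -> : N^-1 = N `^ (-1) by rewrite powR_inv1// ltW.
rewrite NE; apply: ler_pM; rewrite ?powR_ge0//.
  apply: ge0_ler_powR; rewrite ?nnegrE ?(ltW kappa0)//; first exact: mulr_ge0.
  exact: le_trans (ltW kappa0) kappa2.
rewrite le_eqVlt; apply/orP; left; apply/eqP; congr (_ `^ _).
have [d1 d2] := dens; rewrite g_def beta_def /a; field.
by rewrite d1 d2.
Qed.

(** Second balance of exponents: 5 g - 4 + g beta a = - H g. The power of [kappa] with negative
    exponent [beta * a] is controlled by the lower bound [c1]. *)
Lemma simpson_rate :
  N * ((K - K `^ beta) / N) ^+ 5 * (K `^ beta) `^ a <=
  c2 ^+ 5 * c1 `^ (beta * a) * N `^ (- (H * g)).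
Proof.
have b0 : 0 <= beta by have /andP[/ltW] := beta01.
have K0 : 0 < K := lt_trans ltr01 K_gt1.
have KbK : 0 <= K - K `^ beta by rewrite subr_ge0 Kbeta_le.
apply: (@le_trans _ _ (N * (K / N) ^+ 5 * (K `^ beta) `^ a)).
  rewrite ler_wpM2r ?powR_ge0// ler_wpM2l ?(ltW N0)// lerXn2r//.
  - by rewrite nnegrE divr_ge0 ?(ltW N0).
  - by rewrite nnegrE divr_ge0 ?(ltW N0) ?(ltW K0).
  - by rewrite ler_wpM2r ?invr_ge0 ?(ltW N0)// lerBlDr lerDl powR_ge0.
have -> : N * (K / N) ^+ 5 * (K `^ beta) `^ a =
    (kappa ^+ 5 * kappa `^ (beta * a)) * N `^ (- (H * g)).
  rewrite -powRrM [in K `^ _]KE powR_scale ?(ltW kappa0) ?(ltW N0)//.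
  rewrite [in K / N]KE.
  have -> : N * (kappa * N `^ g / N) ^+ 5 = kappa ^+ 5 * ((N `^ g) ^+ 5 * N ^- 4).
    by field; rewrite gt_eqF.
  have -> : (N `^ g) ^+ 5 = N `^ (g * 5) by rewrite -powR_mulrn ?powR_ge0// powRrM.
  have -> : N ^- 4 = N `^ (-4) by rewrite powRN powR_mulrn// ltW.
  rewrite NE mulrACA NE; congr (_ * _ `^ _).
  have [d1 d2] := dens; rewrite g_def beta_def /a; field.
  by rewrite d1 d2.
rewrite ler_wpM2r ?powR_ge0//; apply: ler_pM; rewrite ?powR_ge0 ?exprn_ge0 ?(ltW kappa0)//.
  by rewrite lerXn2r ?nnegrE ?(ltW kappa0)// (le_trans (ltW kappa0)).
have ba : 0 <= beta * - a by rewrite mulr_ge0// /a; move: H_range => /andP[]; lra.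
have -> : beta * a = - (beta * - a) by ring.
rewrite !powRN lef_pV2 ?posrE ?powR_gt0//.
by apply: ge0_ler_powR; rewrite ?nnegrE ?(ltW kappa0) ?(ltW c10).
Qed.

End rates.
End asymptotics.

Section kernel_rates.
Context {R : realType}.
Local Notation mu := (@lebesgue_measure R).
Local Notation Rplus := [set x : R | 0 <= x].
Variables (H T beta g : R) (K : nat -> R) (rho : nat -> nat -> R) (c1 c2 : R).
Hypotheses (H_range : 0 < H < 2^-1) (T_gt0 : 0 < T)
  (beta_def : beta = (10 - 6 * H) / (13 - 6 * H))
  (g_def : g = (13 - 6 * H) / (15 - 6 * H))
  (beta01 : 0 < beta < 1) (K_gt1 : forall n, (0 < n)%N -> 1 < K n)
  (c1_gt0 : 0 < c1)
  (K_bounds : forall n, (0 < n)%N -> c1 * n%:R `^ g <= K n <= c2 * n%:R `^ g)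
  (rho_in_cell : forall n i, (1 <= i <= n)%N -> cell beta (K n) n i (rho n i)).
Local Notation quad n n_gt0 := (quad_measure H n beta01 (K_gt1 n_gt0) (rho n)).
Let a : R := - H - 2^-1.
Let rate n : R := n%:R `^ (- (H * g)).

(* The exponents for which exp (- x * t) <= (x * t) `^ (- p) makes the tail of the
   density integrable at infinity. *)
Definition admissible p := 0 <= p <= 1 /\ a - p + 1 < 0.

(** [C] is chosen before [t], [p] and [n], so that [p] can later depend on the position of [t]
    relative to 1 / K. *)
Lemma scalar_kernel_rate (f : R -> R) (c : R) : Ck_bounded_derivatives 4 f ->
  (forall x, 0 <= x -> `|f x| <= c) ->
  exists2 C, 0 <= C & forall t p, 0 < t <= T -> admissible p ->
    `|\int[frac_measure H]_(x in Rplus) laplace_integrand f t x| <=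
      C * (1 + t `^ (- p) / - (a - p + 1)) /\
    forall n (n_gt0 : (0 < n)%N),
    `|\int[quad n n_gt0]_(x in Rplus) laplace_integrand f t x -
      \int[frac_measure H]_(x in Rplus) laplace_integrand f t x| <=
      C * (rate n + t `^ (- p) * (K n `^ (a - p + 1) / - (a - p + 1))).
Proof.
move=> fC4 fc; have [F [b [F0 jF Fb lip mf]]] := Ck_regularity fC4 fc.
have fb x : 0 <= x -> `|f x| <= b by move=> x0; rewrite -F0//; exact: Fb.
have b0 : 0 <= b := le_trans (normr_ge0 _) (fb 0 (lexx _)).
have a1 : 0 < a + 1 by rewrite /a; move: H_range => /andP[]; lra.
have cH0 := @c_ge0 R H.
have T0 := ltW T_gt0.
have T1 : 0 <= 1 + T by rewrite addr_ge0.
have ai : 0 <= (a + 1)^-1 by rewrite invr_ge0 ltW.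
have c20 : 0 <= c2.
  have /andP[h1 h2] := @K_bounds 1%N isT.
  have := lt_trans ltr01 (@K_gt1 1%N isT).
  by move: h2; rewrite powR1 mulr1; lra.
(* [C1] serves the kernel bound and the tail, [C2] the cells and [C3] Simpson's rule; the latter two
   combine [quadrature_error] with [cell_rate] and [simpson_rate]. *)
pose C1 := b * c_ H * ((a + 1)^-1 + 1).
pose C2 := (1 + T) * b * (c_ H / (a + 1)) * c2 `^ (beta * (a + 2)).
pose C3 := c_ H * (2 * (16 * (16 * ((1 + T) ^+ 4 * b) * 24))) *
  (c2 ^+ 5 * c1 `^ (beta * a)).
have C10 : 0 <= C1.
  by apply: mulr_ge0; [exact: mulr_ge0|rewrite addr_ge0// invr_ge0 ltW].
have C20 : 0 <= C2.
  by rewrite /C2 !mulr_ge0 ?powR_ge0.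
have C30 : 0 <= C3.
  have T4 : 0 <= (1 + T) ^+ 4 by rewrite exprn_ge0// addr_ge0.
  have c5 : 0 <= c2 ^+ 5 by rewrite exprn_ge0.
  by rewrite /C3 !mulr_ge0 ?powR_ge0.
exists (C1 + C2 + C3); first by rewrite !addr_ge0.
move=> t p /andP[t0 tT] [p01 ap]; split.
  apply: le_trans (kernel_bound H_range mf fb t0 p01 ap) _; rewrite -/a.
  have X0 : 0 <= t `^ (- p) / - (a - p + 1).
    by rewrite divr_ge0 ?powR_ge0// oppr_ge0 ltW.
  apply: (@le_trans _ _ (C1 * (1 + t `^ (- p) / - (a - p + 1)))).
    rewrite /C1 -[leRHS]mulrA; apply: ler_wpM2l; first exact: mulr_ge0.
    have : 0 <= (a + 1)^-1 by rewrite invr_ge0 ltW.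
    by move: X0; set X := _ / _; set Y := _^-1 => X0 Y0; nra.
  by apply: ler_wpM2r; [rewrite addr_ge0|lra].
move=> n n_gt0.
have cell_n i : (1 <= i <= n)%N -> cell beta (K n) n i (rho n i).
  exact: rho_in_cell.
have := quadrature_error H_range mf fb F0 jF Fb lip beta01 (K_gt1 n_gt0)
  n_gt0 cell_n t0 tT p01 ap; rewrite -/a => h; apply: le_trans h _.
have r1 := cell_rate H_range beta_def g_def beta01 (K_gt1 n_gt0) n_gt0 c1_gt0 (K_bounds n_gt0).
have r2 := simpson_rate H_range beta_def g_def beta01 (K_gt1 n_gt0) n_gt0 c1_gt0 (K_bounds n_gt0).
rewrite -/a -/(rate n) in r1 r2.
set X := t `^ (- p) * _.
have X0 : 0 <= X.
  by rewrite mulr_ge0 ?powR_ge0// divr_ge0 ?powR_ge0// oppr_ge0 ltW.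
have rate0 : 0 <= rate n by exact: powR_ge0.
have e1 : (1 + T) * b * (K n `^ beta / n%:R) *
    (c_ H * ((K n `^ beta) `^ (a + 1) / (a + 1))) <= C2 * rate n.
  apply: (@le_trans _ _ ((1 + T) * b * (c_ H / (a + 1)) *
      (K n `^ beta / n%:R * (K n `^ beta) `^ (a + 1)))).
    by rewrite le_eqVlt; apply/orP; left; apply/eqP; ring.
  rewrite /C2 -[leRHS]mulrA; apply: ler_wpM2l r1.
  by rewrite !mulr_ge0.
have e2 : n%:R * (c_ H * (2 * (16 * (16 * ((1 + T) ^+ 4 * b) *
    (24 * (K n `^ beta) `^ a))) * ((K n - K n `^ beta) / n%:R) ^+ 5)) <=
    C3 * rate n.
  apply: (@le_trans _ _ (c_ H * (2 * (16 * (16 * ((1 + T) ^+ 4 * b) * 24))) *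
      (n%:R * ((K n - K n `^ beta) / n%:R) ^+ 5 * (K n `^ beta) `^ a))).
    by rewrite le_eqVlt; apply/orP; left; apply/eqP; ring.
  rewrite /C3 -[leRHS]mulrA; apply: ler_wpM2l r2.
  have T4 : 0 <= (1 + T) ^+ 4 by rewrite exprn_ge0// addr_ge0.
  by rewrite !mulr_ge0.
have e3 : b * (c_ H * X) <= C1 * X.
  rewrite mulrA ler_wpM2r// /C1 ler_peMr ?mulr_ge0//.
  by rewrite lerDr invr_ge0 ltW.
apply: le_trans (lerD (lerD e1 e2) e3) _.
have := mulr_ge0 C10 rate0; have := mulr_ge0 C20 X0; have := mulr_ge0 C30 X0.
by rewrite !mulrDr !mulrDl; lra.
Qed.

Variables (d : nat) (M : R -> 'M[R]_d).
Hypotheses (M_bounded : bounded_on_Rplus M) (M_C4 : Ck_bounded_derivatives_mx 4 M).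
Local Notation G := (laplace_kernel (frac_measure H) M).
Local Notation Ghat n n_gt0 := (laplace_kernel (quad n n_gt0) M).

(** The constants of the entries are fixed by [choice] before [t], [p] and [n] appear, then their
    squares are summed. *)
Lemma matrix_kernel_rate :
  exists2 C, 0 <= C & forall t p, 0 < t <= T -> admissible p ->
    frob (G t) ^+ 2 <= C * (1 + (t `^ (- p) / - (a - p + 1)) ^+ 2) /\
    forall n (n_gt0 : (0 < n)%N),
    frob (Ghat n n_gt0 t - G t) ^+ 2 <=
      C * (rate n ^+ 2 + (t `^ (- p) * (K n `^ (a - p + 1) / - (a - p + 1))) ^+ 2).
Proof.
have [c Mc] := M_bounded.
have entry (ij : 'I_d * 'I_d) : exists C, 0 <= C /\ forall t p, 0 < t <= T -> admissible p ->
    `|G t ij.1 ij.2| <= C * (1 + t `^ (- p) / - (a - p + 1)) /\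
    forall n (n_gt0 : (0 < n)%N),
    `|Ghat n n_gt0 t ij.1 ij.2 - G t ij.1 ij.2| <=
      C * (rate n + t `^ (- p) * (K n `^ (a - p + 1) / - (a - p + 1))).
  have Mb x : 0 <= x -> `|M x ij.1 ij.2| <= c.
    by move=> x0; exact: le_trans (entry_le_frob _ _ _) (Mc x x0).
  have [C C0 h] := scalar_kernel_rate (M_C4 ij.1 ij.2) Mb.
  exists C; split => // t p tT pa; have [h1 h2] := h t p tT pa; split.
    by rewrite mxE; exact: h1.
  by move=> n n_gt0; rewrite !mxE; exact: h2.
have [C hC] := choice entry.
have sq (x y z C' : R) : `|z| <= C' * (x + y) -> z ^+ 2 <= 2 * C' ^+ 2 * (x ^+ 2 + y ^+ 2).
  move=> zle; apply: (@le_trans _ _ ((C' * (x + y)) ^+ 2)).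
    rewrite -[z ^+ 2]real_normK ?num_real// lerXn2r ?nnegrE//.
    exact: le_trans zle.
  rewrite -subr_ge0.
  have -> : 2 * C' ^+ 2 * (x ^+ 2 + y ^+ 2) - (C' * (x + y)) ^+ 2 =
    (C' * (x - y)) ^+ 2 by ring.
  exact: sqr_ge0.
exists (\sum_i \sum_j 2 * C (i, j) ^+ 2).
  by apply: sumr_ge0 => i _; apply: sumr_ge0 => j _; rewrite mulr_ge0// sqr_ge0.
move=> t p tT pa; split.
  rewrite frob_sqrE mulr_suml; apply: ler_sum => i _; rewrite mulr_suml.
  apply: ler_sum => j _; have [_ /(_ t p tT pa)[h _]] := hC (i, j).
  by have := sq _ _ _ _ h; rewrite expr1n.
move=> n n_gt0; rewrite frob_sqrE mulr_suml; apply: ler_sum => i _; rewrite mulr_suml.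
apply: ler_sum => j _; have [_ /(_ t p tT pa)[_ h]] := hC (i, j).
by have := sq _ _ _ _ (h n n_gt0); rewrite !mxE.
Qed.

End kernel_rates.

(** * Integrable majorants of the squared kernels *)

Section dominating_kernels.
Context {R : realType}.
Local Notation mu := (@lebesgue_measure R).
Variables (H T beta g : R) (K : nat -> R) (rho : nat -> nat -> R) (c1 c2 : R).
Hypotheses (H_range : 0 < H < 2^-1) (T_gt0 : 0 < T)
  (beta_def : beta = (10 - 6 * H) / (13 - 6 * H))
  (g_def : g = (13 - 6 * H) / (15 - 6 * H))
  (beta01 : 0 < beta < 1) (K_gt1 : forall n, (0 < n)%N -> 1 < K n)
  (c1_gt0 : 0 < c1)
  (K_bounds : forall n, (0 < n)%N -> c1 * n%:R `^ g <= K n <= c2 * n%:R `^ g)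
  (rho_in_cell : forall n i, (1 <= i <= n)%N -> cell beta (K n) n i (rho n i)).
Local Notation quad n n_gt0 := (quad_measure H n beta01 (K_gt1 n_gt0) (rho n)).

Let H0 : 0 < H. Proof. by have /andP[] := H_range. Qed.

Lemma ge0_integral_powR_indic (A D : set R) (e k : R) : measurable A -> measurable D ->
  0 <= k -> (\int[mu]_(t in D) (k * (t `^ e * \1_A t))%:E <=
  k%:E * \int[mu]_(t in A) (t `^ e)%:E)%E.
Proof.
move=> mA mD k0.
have mf : measurable_fun [set: R] (fun t => (t `^ e * \1_A t)%:E).
  apply/measurable_EFinP; apply: measurable_funM; first exact: measurable_powR.
  exact: measurable_indic.
have f0 t : (0 <= (t `^ e * \1_A t)%:E)%E by rewrite lee_fin mulr_ge0 ?powR_ge0.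
under eq_integral do rewrite EFinM.
rewrite ge0_integralZl//; last first.
- by apply: measurable_funTS; exact: mf.
apply: lee_wpmul2l; first by rewrite lee_fin.
apply: (@le_trans _ _ (\int[mu]_t (t `^ e * \1_A t)%:E)%E).
  apply: ge0_subset_integral => //; exact: mf.
rewrite [leRHS]integral_mkcond le_eqVlt; apply/orP; left; apply/eqP.
apply: eq_integral => t _; rewrite patchE indicE.
by case: (t \in A); rewrite ?mulr1 ?mulr0.
Qed.

(** The squared inverse of H / 2, which is the denominator - (a - p + 1) for p = 1/2 - H/2. *)
Let D := 4 / H ^+ 2.
Let D0 : 0 <= D. Proof. by rewrite divr_ge0// sqr_ge0. Qed.
Let rate n : R := n%:R `^ (- (2 * H * g)).

(* The squared tail error with p = 1/2 - H/2 for t <= 1/K and with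
   p = 1/2 + H/2 for t >= 1/K: each piece integrates to order K^(- 2 H). *)
Let sing_bound n (t : R) : R :=
  rate n + D * K n `^ (- H) * (t `^ (H - 1) * \1_(`]0, (K n)^-1]) t) +
  D * K n `^ (- (3 * H)) * (t `^ (- H - 1) * \1_(`[(K n)^-1, +oo[) t).

Let msing n : measurable_fun [set: R] (sing_bound n).
Proof.
have mterm (k e : R) (A : set R) : measurable A ->
    measurable_fun [set: R] (fun t => k * (t `^ e * \1_A t)).
  move=> mA; apply: measurable_funM => //.
  by apply: measurable_funM; [exact: measurable_powR|exact: measurable_indic].
apply: measurable_funD; last by apply: mterm; exact: measurable_itv.
by apply: measurable_funD => //; apply: mterm; exact: measurable_itv.
Qed.

Let term_ge0 n t (k e : R) (A : set R) : 0 <= D * K n `^ k * (t `^ e * \1_A t).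
Proof.
by apply: mulr_ge0; [exact: mulr_ge0 D0 (powR_ge0 _ _)|rewrite mulr_ge0 ?powR_ge0].
Qed.

Let sing0 n t : 0 <= sing_bound n t.
Proof. by rewrite !addr_ge0 ?term_ge0// powR_ge0. Qed.

Let sing_integral n : (0 < n)%N ->
  (\int[mu]_(t in `[0%R, T]) (sing_bound n t)%:E <=
   ((T + D * 2 / H * c1 `^ (- (2 * H))) * rate n)%:E)%E.
Proof.
move=> n0; have K0 : 0 < K n := lt_trans ltr01 (K_gt1 n0).
have mI : measurable (`[0, T] : set (measurableTypeR R)) by exact: measurable_itv.
have mA1 : measurable (`]0, (K n)^-1] : set R) by exact: measurable_itv.
have mA2 : measurable (`[(K n)^-1, +oo[ : set R) by exact: measurable_itv.
have mterm (k e : R) (A : set R) : measurable A ->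
    measurable_fun [set: R] (fun t => (k * (t `^ e * \1_A t))%:E).
  move=> mA; apply/measurable_EFinP; apply: measurable_funM => //.
  by apply: measurable_funM; [exact: measurable_powR|exact: measurable_indic].
have k1 : 0 <= D * K n `^ (- H) by rewrite mulr_ge0 ?powR_ge0.
have k2 : 0 <= D * K n `^ (- (3 * H)) by rewrite mulr_ge0 ?powR_ge0.
have term0 (k e t : R) (A : set R) : 0 <= k -> (0 <= (k * (t `^ e * \1_A t))%:E :> \bar R)%E.
  by move=> k0; rewrite lee_fin !mulr_ge0 ?powR_ge0.
apply: (@le_trans _ _ (1%:E * (\int[mu]_(t in `[0%R, T]) (rate n)%:E +
  \int[mu]_(t in `[0%R, T]) (D * K n `^ (- H) * (t `^ (H - 1) * \1_(`]0%R, (K n)^-1]) t))%:E +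
  \int[mu]_(t in `[0%R, T]) (D * K n `^ (- (3 * H)) *
     (t `^ (- H - 1) * \1_(`[(K n)^-1, +oo[) t))%:E))%E).
  apply: ge0_integral_le3 => //.
  - by apply/measurable_EFinP; apply: measurable_funTS; exact: msing.
  - by apply: measurable_funTS; exact: mterm.
  - by apply: measurable_funTS; exact: mterm.
  - by move=> t _; rewrite lee_fin; exact: sing0.
  - by move=> t; rewrite lee_fin powR_ge0.
  - by move=> t; exact: term0.
  - by move=> t; exact: term0.
  - by move=> t _; rewrite mul1e -!EFinD.
rewrite mul1e [in leRHS]mulrDl [leRHS]EFinD -[leLHS]addeA; apply: leeD.
  rewrite integral_cst//= lebesgue_measure_itv/= lte_fin T_gt0 -EFinB subr0 -EFinM.
  by rewrite mulrC.
have i1 := integral_powR_near0 (_ : -1 < H - 1) (_ : 0 < (K n)^-1).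
have i2 := integral_powR_nearoo (_ : - H - 1 < -1) (_ : 0 < (K n)^-1).
have Kinv0 : 0 < (K n)^-1 by rewrite invr_gt0.
apply: (@le_trans _ _ ((D * K n `^ (- H))%:E * ((K n)^-1 `^ (H - 1 + 1) / (H - 1 + 1))%:E +
  (D * K n `^ (- (3 * H)))%:E * ((K n)^-1 `^ (- H - 1 + 1) / - (- H - 1 + 1))%:E)%E).
  apply: leeD.
    apply: le_trans (ge0_integral_powR_indic _ mA1 _ k1) _; first exact: mI.
    apply: lee_wpmul2l; first by rewrite lee_fin.
    by apply: i1 => //; move: H0; lra.
  apply: le_trans (ge0_integral_powR_indic _ mA2 _ k2) _; first exact: mI.
  apply: lee_wpmul2l; first by rewrite lee_fin.
  by apply: i2 => //; move: H0; lra.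
rewrite -!EFinM -EFinD lee_fin.
have KV (r : R) : (K n)^-1 `^ r = K n `^ (- r).
  by rewrite -powR_inv1 ?(ltW K0)// -powRrM mulN1r.
have KE r s : K n `^ r * K n `^ s = K n `^ (r + s).
  by rewrite powRD// (gt_eqF K0) implybT.
rewrite !KV.
have -> : D * K n `^ (- H) * (K n `^ (- (H - 1 + 1)) / (H - 1 + 1)) +
  D * K n `^ (- (3 * H)) * (K n `^ (- (- H - 1 + 1)) / - (- H - 1 + 1)) =
  D * 2 / H * K n `^ (- (2 * H)).
  have -> : D * K n `^ (- H) * (K n `^ (- (H - 1 + 1)) / (H - 1 + 1)) =
    D / H * K n `^ (- (2 * H)).
    transitivity (D / (H - 1 + 1) * (K n `^ (- H) * K n `^ (- (H - 1 + 1)))); first by ring.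
    by rewrite KE; congr (_ / _ * _ `^ _); ring.
  have -> : D * K n `^ (- (3 * H)) * (K n `^ (- (- H - 1 + 1)) / - (- H - 1 + 1)) =
    D / H * K n `^ (- (2 * H)).
    transitivity (D / - (- H - 1 + 1) * (K n `^ (- (3 * H)) * K n `^ (- (- H - 1 + 1)))).
      by ring.
    by rewrite KE; congr (_ / _ * _ `^ _); ring.
  by ring.
rewrite -[leRHS]mulrA; apply: ler_wpM2l.
  by apply: divr_ge0 (ltW H0); exact: mulr_ge0 D0 _.
(* The exponent -2H is negative, so the lower bound on [K n] converts K^(-2H) into the rate in n. *)
have /andP[Kc _] := K_bounds n0.
have N0 : 0 < n%:R :> R by rewrite ltr0n.
have -> : c1 `^ (- (2 * H)) * rate n = (c1 * n%:R `^ g) `^ (- (2 * H)).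
  by rewrite powR_scale ?(ltW c1_gt0) ?(ltW N0)//; congr (_ * _ `^ _); ring.
have cg0 : 0 < c1 * n%:R `^ g by rewrite mulr_gt0// powR_gt0.
rewrite !powRN lef_pV2 ?posrE ?powR_gt0//.
have H20 : 0 <= 2 * H by rewrite mulr_ge0 ?(ltW H0).
by apply: ge0_ler_powR; rewrite ?nnegrE ?(ltW cg0) ?(ltW K0).
Qed.

Variables (d : nat) (M : R -> 'M[R]_d).
Hypotheses (M_bounded : bounded_on_Rplus M) (M_C4 : Ck_bounded_derivatives_mx 4 M).
Local Notation G := (laplace_kernel (frac_measure H) M).
Local Notation Ghat n n_gt0 := (laplace_kernel (quad n n_gt0) M).

(** The majorants are explicit powers of [t], so that their measurability and all integrals, the
    damped one included, can be computed directly. *)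
Lemma dominating_kernels : exists (h : R -> R) (hn : nat -> R -> R) (C : R),
  [/\ measurable_fun [set: R] h, forall t, 0 <= h t,
      forall n, measurable_fun [set: R] (hn n), forall n t, 0 <= hn n t & 0 <= C] /\
  [/\ forall t, 0 < t <= T -> frob (G t) ^+ 2 <= h t,
      forall n (n_gt0 : (0 < n)%N) t, 0 < t <= T ->
        frob (Ghat n n_gt0 t - G t) ^+ 2 <= hn n t,
      forall n, (0 < n)%N ->
        (\int[mu]_(t in `[0%R, T]) (hn n t)%:E <= (C * rate n)%:E)%E &
      forall e, 0 < e -> exists2 theta, 0 < theta &
        (\int[mu]_(t in `[0%R, T]) (h t * expR (- (theta * t)))%:E <= e%:E)%E].
Proof.
have [C C0 hC] := matrix_kernel_rate H_range T_gt0 beta_def g_def beta01 K_gt1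
  c1_gt0 K_bounds rho_in_cell M_bounded M_C4.
(* Admissibility asks for p > 1/2 - H. Here 2 p1 = 1 - H keeps t^(-2p) integrable at 0, and 2 p2 = 1
   + H makes it integrable at infinity. *)
pose p1 := 2^-1 - H / 2; pose p2 := 2^-1 + H / 2.
have Hlt : H < 2^-1 by have /andP[] := H_range.
have ad1 : admissible H p1 by split; [apply/andP; split|]; rewrite /p1; move: H0; lra.
have ad2 : admissible H p2 by split; [apply/andP; split|]; rewrite /p2; move: H0; lra.
have e1 : - H - 2^-1 - p1 + 1 = - (H / 2) by rewrite /p1; field.
have e2 : - H - 2^-1 - p2 + 1 = - (3 * H / 2) by rewrite /p2; field.
have sqr_powR (x r : R) : (x `^ r) ^+ 2 = x `^ (2 * r).
  by rewrite -powR_mulrn ?powR_ge0// -powRrM mulrC.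
have HH : H != 0 by rewrite gt_eqF.
pose h t := C * (1 + D * t `^ (H - 1)).
pose hn n t := C * sing_bound n t.
exists h, hn, (C * (T + D * 2 / H * c1 `^ (- (2 * H)))); split; split.
- apply: measurable_funM => //; apply: measurable_funD => //.
  by apply: measurable_funM => //; exact: measurable_powR.
- by move=> t; rewrite mulr_ge0// addr_ge0//; exact: mulr_ge0 D0 (powR_ge0 _ _).
- by move=> n; exact: measurable_funM.
- by move=> n t; exact: mulr_ge0.
- apply: mulr_ge0 => //; apply: addr_ge0; first exact: ltW.
  apply: mulr_ge0; last exact: powR_ge0.
  by apply: divr_ge0 (ltW H0); exact: mulr_ge0 D0 _.
- move=> t tT; have [hG _] := hC t p1 tT ad1.
  apply: le_trans hG _; rewrite ler_wpM2l// lerD2l e1 opprK expr_div_n sqr_powR.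
  rewrite le_eqVlt; apply/orP; left; apply/eqP.
  have -> : 2 * - p1 = H - 1 by rewrite /p1; field.
  by rewrite /D; field.
- move=> n n_gt0 t tT; have K0 : 0 < K n := lt_trans ltr01 (K_gt1 n_gt0).
  have [_ /(_ n n_gt0) hG1] := hC t p1 tT ad1.
  have [_ /(_ n n_gt0) hG2] := hC t p2 tT ad2.
  have /andP[t0 _] := tT.
  have rE : (n%:R `^ (- (H * g))) ^+ 2 = rate n.
    by rewrite sqr_powR; congr (_ `^ _); ring.
  have [tK|Kt] := leP t (K n)^-1.
    apply: le_trans hG1 _; rewrite ler_wpM2l// rE /sing_bound.
    rewrite -[leLHS]addr0; apply: lerD; last first.
      exact: term_ge0.
    rewrite lerD2l e1 opprK indicE mem_set/= ?in_itv/= ?t0 ?tK// mulr1.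
    rewrite exprMn expr_div_n !sqr_powR.
    rewrite le_eqVlt; apply/orP; left; apply/eqP.
    have -> : 2 * - p1 = H - 1 by rewrite /p1; field.
    have -> : 2 * - (H / 2) = - H by field.
    by rewrite /D; field.
  apply: le_trans hG2 _; rewrite ler_wpM2l// rE /sing_bound -[leRHS]addrA lerD2l.
  rewrite -[leLHS]add0r; apply: lerD; first exact: term_ge0.
  rewrite e2 opprK indicE mem_set/= ?in_itv/= ?(ltW Kt)// mulr1.
  rewrite exprMn expr_div_n !sqr_powR.
  have -> : 2 * - p2 = - H - 1 by rewrite /p2; field.
  have -> : 2 * - (3 * H / 2) = - (3 * H) by field.
  (* For [p2] the denominator is 3H/2 instead of H/2, whence a factor 1/9 relative to [D], bounded
     by 1 afterwards. *)
  have -> : t `^ (- H - 1) * (K n `^ (- (3 * H)) / (3 * H / 2) ^+ 2) =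
      9^-1 * (D * K n `^ (- (3 * H)) * t `^ (- H - 1)).
    by rewrite /D; field.
  rewrite ler_piMl// ?invf_le1 ?ler1n//.
  by apply: mulr_ge0 (powR_ge0 _ _); exact: mulr_ge0 D0 (powR_ge0 _ _).
- move=> n n0; rewrite /hn; under eq_integral do rewrite EFinM.
  rewrite ge0_integralZl_EFin//; last 2 first.
  + by move=> t _; rewrite lee_fin.
  + by apply/measurable_EFinP; apply: measurable_funTS; exact: msing.
  have -> x y z : ((x * y) * z)%:E = (x%:E * (y * z)%:E)%E :> \bar R.
    by rewrite -mulrA EFinM.
  apply: lee_wpmul2l; first by rewrite lee_fin.
  exact: sing_integral.
- move=> e e0.
  (* Bounding exp(- theta t) by (theta t)^(-q) gains theta^(-q), while H - 1 - q > -1 keeps the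
     singularity of [h] integrable. *)
  pose q := H / 2.
  pose S := C * (T `^ (- q + 1) / (- q + 1) + D * (T `^ (H - 1 - q + 1) / (H - 1 - q + 1))).
  have q1 : 0 < - q + 1 by rewrite /q; move: H0; lra.
  have q2 : 0 < H - 1 - q + 1 by rewrite /q; move: H0; lra.
  have S0 : 0 <= S.
    apply: mulr_ge0 => //; apply: addr_ge0.
      by apply: divr_ge0 (ltW q1); exact: powR_ge0.
    by apply: mulr_ge0 => //; apply: divr_ge0 (ltW q2); exact: powR_ge0.
  (* Chosen so that theta^(-q) S = S / (S / e + 1) <= e; the summand 1 keeps the base positive when
     [S] vanishes. *)
  pose theta := (S / e + 1) `^ q^-1.
  have Se : 0 < S / e + 1 by rewrite ltr_wpDl// divr_ge0// ltW.
  have th0 : 0 < theta by exact: powR_gt0.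
  have q0 : 0 < q by rewrite divr_gt0.
  have thq : theta `^ (- q) = (S / e + 1)^-1.
    rewrite -powRrM mulrN mulVf ?gt_eqF// powR_inv1//; exact: ltW.
  exists theta => //.
  have mh : measurable_fun [set: R] (fun t => (h t * expR (- (theta * t)))%:E).
    apply/measurable_EFinP; apply: measurable_funM.
      apply: measurable_funM => //; apply: measurable_funD => //.
      by apply: measurable_funM => //; exact: measurable_powR.
    apply: measurableT_comp => //; under eq_fun do rewrite -mulNr.
    exact: measurable_funM.
  have mI : measurable (`]0, T] : set (measurableTypeR R)) by exact: measurable_itv.
  have mp (r : R) : measurable_fun [set: R] (fun t => (t `^ r)%:E).
    by apply/measurable_EFinP; exact: measurable_powR.
  have mDp (r : R) : measurable_fun [set: R] (fun t => (D * t `^ r)%:E).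
    by apply/measurable_EFinP; apply: measurable_funM => //; exact: measurable_powR.
  pose k := C * theta `^ (- q).
  have k0 : 0 <= k by rewrite mulr_ge0 ?powR_ge0.
  rewrite -integral_itv_obnd_cbnd; last by apply: measurable_funTS; exact: mh.
  apply: (@le_trans _ _ (k%:E * (\int[mu]_(t in `]0%R, T]) (t `^ (- q))%:E +
      \int[mu]_(t in `]0%R, T]) (D * t `^ (H - 1 - q))%:E +
      \int[mu]_(t in `]0%R, T]) (0 : R)%:E))%E).
    apply: ge0_integral_le3 => //.
    + by apply: measurable_funTS; exact: mh.
    + by apply: measurable_funTS; exact: mp.
    + by apply: measurable_funTS; exact: mDp.
    + move=> t _; rewrite lee_fin mulr_ge0 ?expR_ge0// /h mulr_ge0// addr_ge0//.
      exact: mulr_ge0 D0 (powR_ge0 _ _).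
    + by move=> t; rewrite lee_fin powR_ge0.
    + by move=> t; rewrite lee_fin; exact: mulr_ge0 D0 (powR_ge0 _ _).
    + move=> t; rewrite /= in_itv/= => /andP[t0 _]; rewrite -!EFinD -EFinM lee_fin.
      have q01 : 0 <= q <= 1 by apply/andP; split; rewrite /q; move: H0; lra.
      have := @expRN_le_powR _ (theta * t) q (mulr_gt0 th0 t0) q01.
      rewrite (powRM _ (ltW th0) (ltW t0)) => hexp.
      have tE : t `^ (H - 1 - q) = t `^ (H - 1) * t `^ (- q).
        by rewrite powRD// (gt_eqF t0) implybT.
      rewrite tE /k /h addr0.
      have -> : C * theta `^ (- q) * (t `^ (- q) + D * (t `^ (H - 1) * t `^ (- q))) =
        C * (1 + D * t `^ (H - 1)) * (theta `^ (- q) * t `^ (- q)) by ring.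
      apply: ler_wpM2l hexp; rewrite mulr_ge0// addr_ge0//.
      exact: mulr_ge0 D0 (powR_ge0 _ _).
  rewrite integral0 adde0.
  apply: (@le_trans _ _ (k%:E * ((T `^ (- q + 1) / (- q + 1))%:E +
      D%:E * (T `^ (H - 1 - q + 1) / (H - 1 - q + 1))%:E))%E).
    apply: lee_wpmul2l; first by rewrite lee_fin.
    apply: leeD.
      by apply: integral_powR_near0 => //; move: q1; lra.
    under eq_integral do rewrite EFinM.
    rewrite ge0_integralZl_EFin//; last 2 first.
    + by move=> t _; rewrite lee_fin powR_ge0.
    + by apply: measurable_funTS; exact: mp.
    apply: lee_wpmul2l; first by rewrite lee_fin.
    by apply: integral_powR_near0 => //; move: q2; lra.
  rewrite -[(D%:E * _)%E]EFinM -[(_ + _)%E]EFinD -[(k%:E * _)%E]EFinM lee_fin.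
  have -> : k * (T `^ (- q + 1) / (- q + 1) +
      D * (T `^ (H - 1 - q + 1) / (H - 1 - q + 1))) = theta `^ (- q) * S.
    by rewrite /k /S; ring.
  rewrite thq mulrC ler_pdivrMr// mulrDr mulr1 mulrCA divff ?gt_eqF// mulr1.
  by rewrite lerDl ltW.
Qed.

End dominating_kernels.

(** * Volterra equations *)

Section lipschitz_composition.
Context {R : realType} {d : measure_display} {T : measurableType d}.
Variables (D : set T) (mD : measurable D).

Lemma frob_le_entries m n (A : 'M[R]_(m, n)) c : 0 <= c ->
  (forall i j, `|A i j| <= c) -> frob A <= (m * n).+1%:R * c.
Proof.
move=> c0 Ac; rewrite -(ler_pXn2r (n := 2))// ?nnegrE ?frob_ge0 ?mulr_ge0//.
rewrite frob_sqrE; apply: (@le_trans _ _ (\sum_(i < m) \sum_(j < n) c ^+ 2)).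
  apply: ler_sum => i _; apply: ler_sum => j _.
  by rewrite -[A i j ^+ 2]real_normK ?num_real// lerXn2r ?nnegrE.
rewrite !sumr_const !card_ord -mulrnA -[leLHS]mulr_natl exprMn ler_wpM2r ?sqr_ge0//.
rewrite -natrX ler_nat (mulnC n m); set x := (m * n)%N.
by rewrite (leq_trans (leqnSn x))// -mulnn leq_pmulr.
Qed.

Definition grid_round m n (k : nat) (A : 'M[R]_(m, n)) : 'M[int]_(m, n) :=
  \matrix_(i, j) Num.floor (k.+1%:R * A i j).

Definition grid_point m n (k : nat) (z : 'M[int]_(m, n)) : 'M[R]_(m, n) :=
  \matrix_(i, j) ((z i j)%:~R / k.+1%:R).

Lemma grid_round_error m n k (A : 'M[R]_(m, n)) :
  frob (A - grid_point k (grid_round k A)) <= (m * n).+1%:R * k.+1%:R^-1.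
Proof.
apply: frob_le_entries => [|i j]; first by rewrite invr_ge0.
rewrite !mxE; set y := A i j; have k0 : 0 < k.+1%:R :> R by [].
have /andP[y1 y2] := floor_itv (k.+1%:R * y).
have -> : y - (Num.floor (k.+1%:R * y))%:~R / k.+1%:R =
    (k.+1%:R * y - (Num.floor (k.+1%:R * y))%:~R) / k.+1%:R.
  by field; rewrite gt_eqF.
rewrite normrM (ger0_norm (_ : 0 <= k.+1%:R^-1)) ?invr_ge0// ger0_norm ?subr_ge0//.
rewrite ler_piMl ?invr_ge0//; move: y2; rewrite intrD; lra.
Qed.

(* The argument is rounded to a countable grid of mesh 1/k.+1. *)
Lemma lipschitz_measurable m n p q (f : 'M[R]_(m, n) -> 'M[R]_(p, q))
    (X : T -> 'M[R]_(m, n)) : globally_lipschitz f ->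
  (forall i j, measurable_fun D (fun x => X x i j)) ->
  forall i j, measurable_fun D (fun x => f (X x) i j).
Proof.
move=> [L fL] mX i j.
apply: (@measurable_fun_cvg _ _ _ _
  (fun k x => f (grid_point k (grid_round k (X x))) i j)).
  move=> k _ B mB.
  have -> : D `&` (fun x => f (grid_point k (grid_round k (X x))) i j) @^-1` B =
      \bigcup_(z : 'M[int]_(m, n)) (if `[< B (f (grid_point k z) i j) >] then
        D `&` [set x | grid_round k (X x) = z] else set0).
    apply/seteqP; split => x.
      move=> [Dx Bx]; exists (grid_round k (X x)) => //.
      by rewrite ifT//; exact/asboolP.
    by move=> [z _]; case: asboolP => // Bz [Dx /= Xz]; split => //=; rewrite Xz.
  apply: countable_bigcupT_measurable; first exact: countableP.
  move=> z; case: asboolP => // _.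
  have -> : D `&` [set x | grid_round k (X x) = z] =
      D `&` \bigcap_(ij in [set: 'I_m * 'I_n])
        (D `&` (fun x => k.+1%:R * X x ij.1 ij.2) @^-1`
          `[(z ij.1 ij.2)%:~R, (z ij.1 ij.2 + 1)%:~R[).
    apply/seteqP; split => x [Dx].
      move=> /= Xz; split => // -[i' j'] _; split => //=; rewrite -Xz.
      by rewrite in_itv/= mxE; exact: floor_itv.
    move=> h; split => //=; apply/matrixP => i' j'; rewrite mxE.
    have [_] := h (i', j') I; rewrite /= in_itv/= => h'.
    by apply/eqP; rewrite floor_eq.
  apply: measurableI => //; apply: fin_bigcap_measurable => // ij _.
  apply: measurable_funM => //; exact: measurable_itv.
move=> x Dx; apply/cvgrPdist_le => e e0.
pose C := `|L| * (m * n).+1%:R.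
have C0 : 0 <= C by rewrite mulr_ge0.
have C1 : 0 < C + 1 by rewrite ltr_wpDl.
have e1 : 0 < (C + 1)^-1 * e by apply: mulr_gt0 => //; rewrite invr_gt0.
near=> k.
apply: (@le_trans _ _ (C * k.+1%:R^-1)).
  apply: (@le_trans _ _ (frob (f (X x) - f (grid_point k (grid_round k (X x)))))).
    by apply: le_trans (entry_le_frob _ i j); rewrite !mxE.
  apply: le_trans (fL _ _) _.
  apply: (@le_trans _ _ (`|L| * frob (X x - grid_point k (grid_round k (X x))))).
    by rewrite ler_wpM2r ?frob_ge0// ler_norm.
  by rewrite -mulrA ler_wpM2l// grid_round_error.
apply: (@le_trans _ _ ((C + 1) * k.+1%:R^-1)).
  by rewrite ler_wpM2r ?invr_ge0// lerDl.
rewrite -ler_pdivlMl//; apply: ltW; near: k.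
exact: (near_infty_natSinv_lt (PosNum e1)).
Unshelve. all: by end_near. Qed.

End lipschitz_composition.

Section kernel_measurability.
Context {R : realType}.
Local Notation mu := (@lebesgue_measure R).
Local Notation Rplus := [set x : R | 0 <= x].

(** The positive and negative parts are measurable in [t] by Tonelli, and so is the real part of
    their difference. *)
Lemma measurable_parametric_Rintegral (q : R -> R -> R) :
  measurable_fun [set: R * measurableTypeR R]
    (fun p : R * measurableTypeR R => (q p.1 p.2)%:E) ->
  measurable_fun [set: R] (fun t => \int[mu]_x q t x).
Proof.
move=> mq; rewrite /Rintegral; apply: measurableT_comp => //.
under eq_fun do rewrite integralE.
pose F (p : R * measurableTypeR R) : \bar R := (q p.1 p.2)%:E.
have -> : (fun t => \int[mu]_x (fun x0 => (q t x0)%:E)^\+ x -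
    \int[mu]_x (fun x0 => (q t x0)%:E)^\- x)%E =
    (fun t => \int[mu]_x (F^\+ (t, x)) - \int[mu]_x (F^\- (t, x)))%E.
  apply/funext => t; congr (_ - _)%E; apply: eq_integral => x _.
    by rewrite !funeposE.
  by rewrite !funenegE.
apply: emeasurable_funB.
  apply: (measurable_fun_fubini_tonelli_F (m2 := mu) F^\+%E) => //.
  exact: measurable_funepos.
apply: (measurable_fun_fubini_tonelli_F (m2 := mu) F^\-%E) => //.
exact: measurable_funeneg.
Qed.

Variables (m : R -> R).
Hypothesis mm : measurable_fun Rplus m.

Lemma measurable_frac_transform (H : R) : measurable_fun [set: R]
  (fun t => \int[frac_measure H]_(x in Rplus) laplace_integrand m t x).
Proof.
have mR := @measurable_Rplus R.
pose w (x : R) : R := c_ H * x `^ (- H - 2^-1).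
(* [m] is measurable on [Rplus] only; extended by 0 it makes the integrand measurable in both
   variables on the whole plane. *)
pose q t x : R := expR (- x * t) * ((m \_ Rplus) x * w x).
have -> : (fun t => \int[frac_measure H]_(x in Rplus) laplace_integrand m t x) =
    (fun t => \int[mu]_x q t x).
  apply/funext => t; rewrite Rintegral_frac; last exact: measurable_laplace_integrand.
  rewrite Rintegral_mkcond; apply: eq_Rintegral => x _.
  rewrite /q !patchE /laplace_integrand /w; case: ifP => _; first by rewrite -mulrA.
  by rewrite mul0r mulr0.
apply: measurable_parametric_Rintegral; apply/measurable_EFinP.
have m1 : measurable_fun [set: R * measurableTypeR R]
    (fun p : R * measurableTypeR R => (p.2 : R)).
  exact: measurable_snd.
apply: measurable_funM.
  apply: measurableT_comp => //; apply: measurable_funM; last exact: measurable_fst.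
  exact: measurableT_comp.
apply: measurable_funM.
  have mr : measurable_fun [set: R] (m \_ Rplus) by apply/(measurable_restrictT _ mR).
  exact: (measurableT_comp mr m1).
apply: measurable_funM => //.
exact: (measurableT_comp (measurable_powR _) m1).
Qed.

Lemma measurable_quad_transform (H beta K : R) n (beta01 : 0 < beta < 1)
    (K_gt1 : 1 < K) rho : (forall k, (k < n)%N -> 0 <= rho k.+1) ->
  measurable_fun [set: R] (fun t =>
    \int[quad_measure H n beta01 K_gt1 rho]_(x in Rplus) laplace_integrand m t x).
Proof.
move=> rho0.
have -> : (fun t => \int[quad_measure H n beta01 K_gt1 rho]_(x in Rplus)
      laplace_integrand m t x) =
    (fun t => quad_sum H beta K n rho (laplace_integrand m t)).
  apply/funext => t; apply: Rintegral_quad => //.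
  exact: measurable_laplace_integrand.
rewrite /quad_sum.
have ml x : measurable_fun [set: R] (fun t => laplace_integrand m t x).
  apply: measurable_funM => //; apply: measurableT_comp => //.

apply: measurable_funD.
  by apply: measurable_sum => k; apply: measurable_funM.
apply: measurable_funM => //; apply: measurable_sum => k.
by apply: measurable_funD; [apply: measurable_funD|]; apply: measurable_funM.
Qed.

End kernel_measurability.

(** * Estimates for the terms of the Volterra equation *)

Section cauchy_schwarz.
Context {R : realType}.
Local Notation mu := (@lebesgue_measure R).

(** On a bounded interval the function 1 + f^2 is integrable and dominates |f|. *)
Lemma integrable_of_sqr (f : R -> R) (t : R) : measurable_fun `[0, t] f ->
  (\int[mu]_(s in `[0%R, t]) (f s ^+ 2)%:E < +oo)%E ->
  mu.-integrable `[0, t] (EFin \o (fun s => f s ^+ 2)) /\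
  mu.-integrable `[0, t] (EFin \o f).
Proof.
move=> mf f2; have mI : measurable (`[0, t] : set (measurableTypeR R)).
  exact: measurable_itv.
have i2 : mu.-integrable `[0, t] (EFin \o (fun s => f s ^+ 2)).
  apply/integrableP; split; first by apply/measurable_EFinP; exact: measurable_funX.
  by under eq_integral do rewrite gee0_abs ?lee_fin ?sqr_ge0//.
split => //; have i1 : mu.-integrable `[0, t] (EFin \o (fun s => 1 + f s ^+ 2)).
  have ic : mu.-integrable `[0, t] (EFin \o cst (1 : R)).
    apply: continuous_compact_integrable; first exact: segment_compact.
    exact: cst_continuous.
  by have := integrableD mI ic i2.
apply: le_integrable i1 => //; first exact/measurable_EFinP.
move=> s _; rewrite lee_fin [leRHS]ger0_norm; last by rewrite addr_ge0 ?sqr_ge0.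
by rewrite ler_norml; nra.
Qed.

(** The integral of (f - c)^2 is nonnegative; with [c] the mean of [f] over [0, t] this is the
    claim. *)
Lemma sqr_Rintegral_le (f : R -> R) (t : R) : 0 <= t ->
  mu.-integrable `[0, t] (EFin \o (fun s => f s ^+ 2)) ->
  mu.-integrable `[0, t] (EFin \o f) ->
  (\int[mu]_(s in `[0, t]) f s) ^+ 2 <= t * \int[mu]_(s in `[0, t]) f s ^+ 2.
Proof.
rewrite le_eqVlt => /predU1P[<-|t0] i2 i1.
  by rewrite set_itv1 !Rintegral_set1 expr0n mul0r.
have mI : measurable (`[0, t] : set (measurableTypeR R)) by exact: measurable_itv.
set I := \int[mu]_(s in `[0, t]) f s; pose c := I / t.
have ic (k : R) : mu.-integrable `[0, t] (EFin \o cst k).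
  apply: continuous_compact_integrable; first exact: segment_compact.
  exact: cst_continuous.
have i3 : mu.-integrable `[0, t] (EFin \o (fun s => f s ^+ 2 - 2 * c * f s)).
  by have := integrableB mI i2 (integrableZl mI (2 * c) i1).
have : 0 <= \int[mu]_(s in `[0, t]) (f s ^+ 2 - 2 * c * f s + c ^+ 2).
  apply: Rintegral_ge0 => s _.
  have -> : f s ^+ 2 - 2 * c * f s + c ^+ 2 = (f s - c) ^+ 2 by ring.
  exact: sqr_ge0.
rewrite RintegralD//; last exact: ic.
rewrite RintegralB//; last by have := integrableZl mI (2 * c) i1.
rewrite RintegralZl// Rintegral_cst//= lebesgue_measure_itv/= lte_fin t0/=.
rewrite subr0 -/I => h; rewrite -ler_pdivrMl//.
have : 0 = 2 * c * I - c ^+ 2 * t - t^-1 * I ^+ 2.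
  by rewrite /c; field; rewrite gt_eqF.
by move: h; lra.
Qed.

End cauchy_schwarz.

(** One constant for increments and for growth, by f x = (f x - f 0) + f 0. Squares also remove the
    undetermined sign of the Lipschitz constant. *)
Lemma lipschitz_growth (R : realType) m n p q (f : 'M[R]_(m, n) -> 'M[R]_(p, q)) :
  globally_lipschitz f -> exists a, [/\ 0 <= a,
    forall x y, frob (f x - f y) ^+ 2 <= a * frob (x - y) ^+ 2 &
    forall x, frob (f x) ^+ 2 <= a * (1 + frob x ^+ 2)].
Proof.
move=> [L fL].
have L2 x y : frob (f x - f y) ^+ 2 <= L ^+ 2 * frob (x - y) ^+ 2.
  rewrite -exprMn lerXn2r ?nnegrE ?frob_ge0//.
  exact: le_trans (frob_ge0 _) (fL _ _).
exists (2 * L ^+ 2 + 2 * frob (f 0) ^+ 2); split.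
- by rewrite addr_ge0// mulr_ge0// sqr_ge0.
- move=> x y; apply: le_trans (L2 x y) _; rewrite ler_wpM2r ?sqr_ge0//.
  by have := sqr_ge0 L; have := sqr_ge0 (frob (f 0)); lra.
- move=> x; have := frobD_sqr (f x - f 0) (f 0); have := L2 x 0.
  rewrite subrK subr0; have := sqr_ge0 L; have := sqr_ge0 (frob (f 0)).
  have := sqr_ge0 (frob x); nra.
Qed.

(** The difference is (Gh - G) f(y) + G (f(y) - f(x)), and f(y) is split again around f(x). Only the
    size of [x] and the distance [y - x] appear: in the application [x] is X, whose moments do not
    depend on n. *)
Lemma kernel_difference_le (R : realType) d q (f : 'cV[R]_d -> 'M[R]_(d, q)) a
    (G Gh : 'M[R]_d) (x y : 'cV[R]_d) (h hn : R) :
  0 <= a ->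
  (forall x y, frob (f x - f y) ^+ 2 <= a * frob (x - y) ^+ 2) ->
  (forall x, frob (f x) ^+ 2 <= a * (1 + frob x ^+ 2)) ->
  frob G ^+ 2 <= h -> frob (Gh - G) ^+ 2 <= hn ->
  frob (Gh *m f y - G *m f x) ^+ 2 <=
  4 * a * (hn + hn * frob x ^+ 2 + (hn + h) * frob (y - x) ^+ 2).
Proof.
move=> a0 fL fG Gle Ghle.
have -> : Gh *m f y - G *m f x = (Gh - G) *m f y + G *m (f y - f x).
  by rewrite mulmxBl mulmxBr addrA subrK.
apply: le_trans (frobD_sqr _ _) _.
have := frobD_sqr (f y - f x) (f x); rewrite subrK => h1.
have h2 : frob ((Gh - G) *m f y) ^+ 2 <=
    hn * (2 * (a * frob (y - x) ^+ 2) + 2 * (a * (1 + frob x ^+ 2))).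
  apply: le_trans (frob_mulmx_sqr _ _) _.
  apply: ler_pM; rewrite ?sqr_ge0//; apply: le_trans h1 _.
  by apply: lerD; rewrite ler_wpM2l.
have h3 : frob (G *m (f y - f x)) ^+ 2 <= h * (a * frob (y - x) ^+ 2).
  by apply: le_trans (frob_mulmx_sqr _ _) _; apply: ler_pM; rewrite ?sqr_ge0.
have h0 : 0 <= h by apply: le_trans Gle; exact: sqr_ge0.
have : 0 <= h * (a * frob (y - x) ^+ 2) by apply: mulr_ge0 h0 (mulr_ge0 a0 (sqr_ge0 _)).
lra.
Qed.

Section kernel_term.
Context {R : realType} {dO : measure_display} {Omega : measurableType dO}.
Variable P : probability Omega R.
Local Notation mu := (@lebesgue_measure R).
Local Notation Rplus := [set x : R | 0 <= x].
Variables (d q : nat) (f : 'cV[R]_d -> 'M[R]_(d, q)).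
Hypothesis f_lip : globally_lipschitz f.

Lemma jointly_measurable_kernel (G : R -> 'M[R]_d) (X : R -> Omega -> 'cV[R]_d) t :
  (forall i j, measurable_fun [set: R] (fun s => G s i j)) ->
  jointly_measurable Rplus X ->
  jointly_measurable `[0, t] (fun s w => G (t - s) *m f (X s w)).
Proof.
move=> mG mX i j.
rewrite (_ : (fun p : R * Omega => _) =
  (fun p => \sum_k G (t - p.1) i k * f (X p.1 p.2) k j)); last first.
  by apply/funext => p; rewrite mxE.
have mD : measurable (`[0, t] `*` [set: Omega] : set (measurableTypeR R * Omega)).
  by apply: measurableX => //; exact: measurable_itv.
apply: measurable_sum => k; apply: measurable_funM.
  apply: measurable_funTS.
  have m1 : measurable_fun [set: R * Omega] (fun p : R * Omega => t - p.1).
    by apply: measurable_funB => //; exact: measurable_fst.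
  exact: (measurableT_comp (mG i k) m1).
apply: (lipschitz_measurable mD (X := fun p : R * Omega => X p.1 p.2) f_lip).
move=> i' j'; apply: measurable_funS (mX i' j').
  by apply: measurableX => //; exact: measurable_Rplus.
by move=> [s w] [/=]; rewrite in_itv/= => /andP[].
Qed.

Lemma measurable_lipschitz_kernel (G : 'M[R]_d) (x : Omega -> 'cV[R]_d) :
  (forall i j, measurable_fun [set: Omega] (fun w => x w i j)) ->
  forall i j, measurable_fun [set: Omega] (fun w => (G *m f (x w)) i j).
Proof.
move=> mx i j; rewrite (_ : (fun w => _) = (fun w => \sum_k G i k * f (x w) k j)).
  apply: measurable_sum => k; apply: measurable_funM => //.
  exact: lipschitz_measurable.
by apply/funext => w; rewrite mxE.
Qed.

Lemma expectation_kernel_difference_le a (G Gh : 'M[R]_d)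
    (x y : Omega -> 'cV[R]_d) (h hn : R) :
  0 <= a ->
  (forall x y, frob (f x - f y) ^+ 2 <= a * frob (x - y) ^+ 2) ->
  (forall x, frob (f x) ^+ 2 <= a * (1 + frob x ^+ 2)) ->
  (forall i j, measurable_fun [set: Omega] (fun w => x w i j)) ->
  (forall i j, measurable_fun [set: Omega] (fun w => y w i j)) ->
  frob G ^+ 2 <= h -> frob (Gh - G) ^+ 2 <= hn ->
  (\int[P]_w (frob (Gh *m f (y w) - G *m f (x w)) ^+ 2)%:E <=
   (4 * a)%:E * (hn%:E + hn%:E * \int[P]_w (frob (x w) ^+ 2)%:E +
     (hn + h)%:E * \int[P]_w (frob (y w - x w) ^+ 2)%:E))%E.
Proof.
move=> a0 fL fG mx my Gle Ghle.
have h0 : 0 <= h by apply: le_trans Gle; exact: sqr_ge0.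
have hn0 : 0 <= hn by apply: le_trans Ghle; exact: sqr_ge0.
have mX : measurable_fun [set: Omega] (fun w => (frob (x w) ^+ 2)%:E).
  exact: measurable_frob_sqr.
have mD : measurable_fun [set: Omega] (fun w => (frob (y w - x w) ^+ 2)%:E).
  by apply: measurable_frob_sqr => i j; exact: measurable_entryB.
have sq0 m n (A : Omega -> 'M[R]_(m, n)) w : (0 <= (frob (A w) ^+ 2)%:E :> \bar R)%E.
  by rewrite lee_fin sqr_ge0.
have hh0 : 0 <= hn + h by exact: addr_ge0.
rewrite -ge0_integralZl// -[X in (_ + X)%E]ge0_integralZl//;
  do ?by [move=> w _; rewrite lee_fin sqr_ge0|rewrite lee_fin].
rewrite -[X in (X + _ + _)%E](_ : \int[P]_w hn%:E = hn%:E)%E; last first.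
  rewrite integral_cst//.
  by transitivity (hn%:E * 1)%E; [congr (_ * _)%E; exact: probability_setT|rewrite mule1].
apply: ge0_integral_le3 => //; first by rewrite mulr_ge0.
- apply: measurable_frob_sqr => i j; apply: measurable_entryB;
    exact: measurable_lipschitz_kernel.
- exact: measurable_funeM.
- exact: measurable_funeM.
- by move=> w _; rewrite lee_fin sqr_ge0.
- by move=> w; rewrite -EFinM lee_fin mulr_ge0 ?sqr_ge0.
- by move=> w; rewrite -EFinM lee_fin mulr_ge0 ?sqr_ge0.
- by move=> w _; rewrite -!EFinM lee_fin; exact: kernel_difference_le.
Qed.

Variables (T a m : R) (h hn : R -> R) (G Gh : R -> 'M[R]_d)
  (X Xh : R -> Omega -> 'cV[R]_d).
Hypotheses (a0 : 0 <= a)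
  (fL : forall x y, frob (f x - f y) ^+ 2 <= a * frob (x - y) ^+ 2)
  (fG : forall x, frob (f x) ^+ 2 <= a * (1 + frob x ^+ 2)).
Hypotheses (mh : measurable_fun [set: R] h) (mhn : measurable_fun [set: R] hn).
Hypotheses (Gle : forall t, 0 < t <= T -> frob (G t) ^+ 2 <= h t)
  (Ghle : forall t, 0 < t <= T -> frob (Gh t - G t) ^+ 2 <= hn t).
Hypotheses (h0 : forall t, 0 <= h t) (hn0 : forall t, 0 <= hn t).
Hypotheses (mG : forall i j, measurable_fun [set: R] (fun s => G s i j))
  (mGh : forall i j, measurable_fun [set: R] (fun s => Gh s i j)).
Hypotheses (mX : jointly_measurable Rplus X) (mXh : jointly_measurable Rplus Xh).
Hypothesis (m0 : 0 <= m)
  (Xm : forall t, 0 <= t <= T -> (\int[P]_w (frob (X t w) ^+ 2)%:E <= m%:E)%E).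
Local Notation D t := (\int[P]_w (frob (Xh t w - X t w) ^+ 2)%:E)%E.

Lemma measurable_state (Y : R -> Omega -> 'cV[R]_d) s : jointly_measurable Rplus Y ->
  0 <= s -> forall i j, measurable_fun [set: Omega] (fun w => Y s w i j).
Proof.
move=> mY s0 i j.
have mDT : measurable (Rplus `*` [set: Omega] : set (measurableTypeR R * Omega)).
  by apply: measurableX => //; exact: measurable_Rplus.
have /(measurable_restrictT _ mDT) := mY i j.
move=> /(measurable_fun_pair2 s); congr measurable_fun.
by apply/funext => w; rewrite !patchE ifT// inE.
Qed.

(** The growth exp(theta s) of the assumed bound equals exp(theta t) exp(- theta (t - s)): the
    second factor damps [h] in the convolution and brings in [kappa], while the small kernel [hn] is
    left undamped and brings in [eta]. *)
Lemma kernel_term_le theta B eta kappa : 0 <= theta -> 0 <= B ->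
  (forall s, 0 <= s <= T -> (D s <= (B * expR (theta * s))%:E)%E) ->
  (\int[mu]_(s in `[0%R, T]) (hn s)%:E <= eta%:E)%E ->
  (\int[mu]_(s in `[0%R, T]) (h s * expR (- (theta * s)))%:E <= kappa%:E)%E ->
  forall t, 0 <= t <= T ->
  (\int[P]_w \int[mu]_(s in `[0%R, t])
     (frob (Gh (t - s) *m f (Xh s w) - G (t - s) *m f (X s w)) ^+ 2)%:E <=
   (4 * a * expR (theta * t) * ((1 + m + B) * eta + B * kappa))%:E)%E.
Proof.
move=> theta0 B0 DB hneta hkappa t /andP[t0 tT].
pose A s w := Gh (t - s) *m f (Xh s w) - G (t - s) *m f (X s w).
have mI : measurable (`[0, t] : set (measurableTypeR R)) by exact: measurable_itv.
have mA : jointly_measurable `[0, t] A.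
  by apply: jointly_measurableB; exact: jointly_measurable_kernel.
have mA2 : measurable_fun (`[0, t] `*` [set: Omega])
    (fun p : R * Omega => (frob (A p.1 p.2) ^+ 2)%:E).
  by apply: measurable_frob_sqr => i j; exact: mA.
have A0 s w : (0 <= (frob (A s w) ^+ 2)%:E :> \bar R)%E by rewrite lee_fin sqr_ge0.
have mE := @measurable_section_prob _ _ _ P _ mI (fun s w => (frob (A s w) ^+ 2)%:E) mA2 A0.
rewrite (@tonelli_time _ _ _ P _ mI (fun s w => (frob (A s w) ^+ 2)%:E) mA2 A0).
(* The convolution kernel after exp(theta t) has been factored out. The part 1 + m comes from the
   linear growth of [f] along X. *)
pose k u := (1 + m + B) * hn u + B * (h u * expR (- (theta * u))).
have k0 u : 0 <= k u.
  apply: addr_ge0; first by apply: mulr_ge0; rewrite ?addr_ge0.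
  by apply: mulr_ge0 B0 _; rewrite mulr_ge0 ?expR_ge0.
have mw : measurable_fun [set: R] (fun u => h u * expR (- (theta * u))).
  apply: measurable_funM => //; apply: measurableT_comp => //.
  by apply: measurable_funN; exact: mulrl_measurable.
have mk : measurable_fun [set: R] (fun u => (k u)%:E).
  by apply/measurable_EFinP; apply: measurable_funD; apply: measurable_funM.
have mIT : measurable (`[0, T] : set (measurableTypeR R)) by exact: measurable_itv.
have kint : (\int[mu]_(s in `[0%R, T]) (k s)%:E <= ((1 + m + B) * eta + B * kappa)%:E)%E.
  under eq_integral do rewrite EFinD !EFinM.
  have mI1 : measurable_fun `[0, T] (fun s => (hn s)%:E).
    by apply: measurable_funTS; apply/measurable_EFinP.
  have mI2 : measurable_fun `[0, T] (fun s => (h s * expR (- (theta * s)))%:E).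
    by apply: measurable_funTS; apply/measurable_EFinP.
  have pos1 s : (0 <= (hn s)%:E :> \bar R)%E by rewrite lee_fin.
  have pos2 s : (0 <= (h s * expR (- (theta * s)))%:E :> \bar R)%E.
    by rewrite lee_fin mulr_ge0 ?expR_ge0.
  have mB0 : 0 <= 1 + m + B by rewrite !addr_ge0.
  under eq_integral do rewrite EFinD [X in (X + _)%E]EFinM [X in (_ + X)%E]EFinM.
  rewrite ge0_integralD//=.
  - rewrite ge0_integralZl// ge0_integralZl//.
    rewrite [leRHS]EFinD [X in (_ <= X + _)%E]EFinM [X in (_ <= _ + X)%E]EFinM.
    by apply: leeD; apply: lee_wpmul2l; rewrite ?lee_fin.
  - by move=> s _; rewrite mule_ge0.
  - exact: measurable_funeM.
  - by move=> s _; rewrite mule_ge0.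
  - exact: measurable_funeM.
pose c := 4 * a * expR (theta * t).
have mr : measurable_fun [set: R] (fun s : R => t - s) by exact: measurable_funB.
have mkr : measurable_fun [set: R] (fun s => (k (t - s))%:E).
  exact: (measurableT_comp mk mr).
have mkt : measurable_fun `[0, t] (fun s => (k (t - s))%:E) by exact: measurable_funTS.
have c0 : 0 <= c by rewrite mulr_ge0 ?expR_ge0// mulr_ge0.
apply: (@le_trans _ _ (\int[mu]_(s in `[0%R, t]) (c%:E * (k (t - s))%:E))%E); last first.
  rewrite ge0_integralZl//; do ?by move=> s _; rewrite lee_fin.
  rewrite -/c [leRHS]EFinM; apply: lee_wpmul2l; first by rewrite lee_fin.
  apply: le_trans kint; apply: (@le_trans _ _ (\int[mu]_(s in `[0%R, t]) (k s)%:E)%E).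
    by rewrite le_eqVlt; apply/orP; left; apply/eqP; exact: ge0_integral_reflect.
  apply: ge0_subset_integral => //.
  - exact: measurable_funTS.
  - by move=> s _; rewrite lee_fin.
  by move=> s /=; rewrite !in_itv/= => /andP[-> /le_trans->].
have mIo : measurable (`[0, t[ : set (measurableTypeR R)) by exact: measurable_itv.
have sub : (`[0, t[ : set R) `<=` `[0, t].
  by move=> s /=; rewrite !in_itv/= => /andP[-> /ltW->].
have mck : measurable_fun [set: R] (fun s => (c%:E * (k (t - s))%:E)%E).
  exact: measurable_funeM.
(* The endpoint s = t is removed, since the kernel bounds hold only at positive times t - s. *)
rewrite -integral_itv_bndo_bndc; last exact: measurable_funS mI sub mE.
rewrite -[leRHS]integral_itv_bndo_bndc; last exact: measurable_funTS.
apply: ge0_le_integral => //.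
- by move=> s _; exact: integral_ge0.
- exact: measurable_funS mI sub mE.
- exact: measurable_funTS.
move=> s; rewrite /= in_itv/= => /andP[s0 st].
have sT : 0 <= s <= T by rewrite s0 (le_trans (ltW st)).
have tsT : 0 < t - s <= T by rewrite subr_gt0 st/=; move: s0 tT; lra.
apply: le_trans (expectation_kernel_difference_le a0 fL fG
  (measurable_state mX s0) (measurable_state mXh s0) (Gle tsT) (Ghle tsT)) _.
apply: (@le_trans _ _ ((4 * a)%:E * ((hn (t - s))%:E + (hn (t - s))%:E * m%:E +
     (hn (t - s) + h (t - s))%:E * (B * expR (theta * s))%:E))%E).
  apply: lee_wpmul2l; first by rewrite lee_fin mulr_ge0.
  apply: leeD; first apply: leeD2l.
    by apply: lee_wpmul2l; rewrite ?lee_fin//; exact: Xm.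
  by apply: lee_wpmul2l; rewrite ?lee_fin ?addr_ge0//; exact: DB.
rewrite -!EFinM lee_fin /c -!mulrA; apply: ler_wpM2l => //; apply: ler_wpM2l => //.
have E1 : 1 <= expR (theta * t) by rewrite -expR0 ler_expR mulr_ge0.
have E2 : expR (theta * s) <= expR (theta * t).
  by rewrite ler_expR ler_wpM2l// ltW.
have E3 : expR (theta * t) * expR (- (theta * (t - s))) = expR (theta * s).
  by rewrite -expRD; congr expR; ring.
rewrite /k; have := hn0 (t - s); have := h0 (t - s).
set H := h _; set N := hn _ => H0 N0.
have e1 : N * (1 + m) <= expR (theta * t) * (N * (1 + m)).
  by rewrite ler_peMl// mulr_ge0 ?addr_ge0.
have e2 : N * B * expR (theta * s) <= expR (theta * t) * (N * B).
  by rewrite [leRHS]mulrC ler_wpM2l// mulr_ge0.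
have e3 : expR (theta * t) * (B * (H * expR (- (theta * (t - s))))) =
    B * H * expR (theta * s).
  by rewrite -E3; ring.
move: e1 e2 e3; lra.
Qed.

End kernel_term.

Section drift.
Context {R : realType}.
Local Notation mu := (@lebesgue_measure R).

Lemma frob_cV_sqrE n (A : 'cV[R]_n) : frob A ^+ 2 = \sum_i A i 0 ^+ 2.
Proof. by rewrite frob_sqrE; apply: eq_bigr => i _; rewrite big_ord1. Qed.

Lemma integrable_entry n (g : R -> 'cV[R]_n) (t : R) :
  (forall i, measurable_fun `[0, t] (fun s => g s i 0)) ->
  (\int[mu]_(s in `[0%R, t]) (frob (g s) ^+ 2)%:E < +oo)%E ->
  forall i, mu.-integrable `[0, t] (EFin \o (fun s => g s i 0 ^+ 2)) /\
    mu.-integrable `[0, t] (EFin \o (fun s => g s i 0)).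
Proof.
move=> mg gfin i; apply: integrable_of_sqr => //.
apply: le_lt_trans gfin; apply: ge0_le_integral.
- exact: measurable_itv.
- by move=> s _; rewrite lee_fin sqr_ge0.
- by apply/measurable_EFinP; exact: (measurable_funX 2 (mg i)).
- by apply: measurable_frob_sqr => j k; rewrite ord1; exact: mg.
move=> s _; rewrite lee_fin -[g s i 0 ^+ 2]real_normK ?num_real//.
by rewrite lerXn2r ?nnegrE ?frob_ge0//; exact: entry_le_frob.
Qed.

(** Cauchy-Schwarz in time, entry by entry, gives the factor [t]. Finiteness is asked of [g] and of
    the difference, because these are what the moment estimates control. *)
Lemma frob_integral_difference_le n (g gh : R -> 'cV[R]_n) (t : R) : 0 <= t ->
  (forall i, measurable_fun `[0, t] (fun s => g s i 0)) ->
  (forall i, measurable_fun `[0, t] (fun s => (gh s - g s) i 0)) ->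
  (\int[mu]_(s in `[0%R, t]) (frob (g s) ^+ 2)%:E < +oo)%E ->
  (\int[mu]_(s in `[0%R, t]) (frob (gh s - g s) ^+ 2)%:E < +oo)%E ->
  ((frob (\col_i (\int[mu]_(s in `[0%R, t]) (gh s) i 0) -
          \col_i (\int[mu]_(s in `[0%R, t]) (g s) i 0)) ^+ 2)%:E <=
   t%:E * \int[mu]_(s in `[0%R, t]) (frob (gh s - g s) ^+ 2)%:E)%E.
Proof.
move=> t0 mg mdg gfin ufin.
have mI : measurable (`[0, t] : set (measurableTypeR R)) by exact: measurable_itv.
have ig := integrable_entry mg gfin; have iu := integrable_entry mdg ufin.
have -> : (\int[mu]_(s in `[0%R, t]) (frob (gh s - g s) ^+ 2)%:E)%E =
    (\sum_i \int[mu]_(s in `[0%R, t]) (gh s - g s) i 0 ^+ 2)%:E.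
  rewrite -sumEFin.
  under [RHS]eq_bigr => i _ do rewrite fineK ?(integrable_fin_num mI (iu i).1)//.
  rewrite -ge0_integral_sum//.
  - by apply: eq_integral => s _; rewrite frob_cV_sqrE -sumEFin.
  - by move=> i; apply/measurable_EFinP; exact: (measurable_funX 2 (mdg i)).
  - by move=> i s _; rewrite lee_fin sqr_ge0.
rewrite -EFinM lee_fin frob_cV_sqrE mulr_sumr; apply: ler_sum => i _.
have -> : (\col_i (\int[mu]_(s in `[0%R, t]) (gh s) i 0) -
          \col_i (\int[mu]_(s in `[0%R, t]) (g s) i 0)) i 0 =
    \int[mu]_(s in `[0%R, t]) (gh s - g s) i 0.
  rewrite [LHS]mxE [X in X + _]mxE [X in _ + X]mxE [X in _ - X]mxE.
  (* The integral of [gh] is recovered from the integrable functions [gh - g] and [g]. *)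
  have <- : \int[mu]_(s in `[0%R, t]) (gh s - g s) i 0 +
      \int[mu]_(s in `[0%R, t]) g s i 0 = \int[mu]_(s in `[0%R, t]) gh s i 0.
    rewrite -RintegralD//; [|exact: (iu i).2|exact: (ig i).2].
    by apply: eq_Rintegral => s _; rewrite !mxE subrK.
  by rewrite addrK.
by apply: sqr_Rintegral_le => //; [exact: (iu i).1|exact: (iu i).2].
Qed.

End drift.

Section comparison.
Context {R : realType} {dO : measure_display} {Omega : measurableType dO}.
Variable P : probability Omega R.
Local Notation mu := (@lebesgue_measure R).
Local Notation Rplus := [set x : R | 0 <= x].
Variables (d : nat) (Ft : R -> set (set Omega)).
Hypothesis Ft_filtration : is_filtration Ft.
Variable W : R -> Omega -> 'cV[R]_d.
Hypothesis W_brownian : brownian_motion P Ft W.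
Variables (b : 'cV[R]_d -> 'cV[R]_d) (sigma : 'cV[R]_d -> 'M[R]_d).
Hypotheses (b_lip : globally_lipschitz b) (sigma_lip : globally_lipschitz sigma).
Variables (a m T : R) (h hn : R -> R) (x0 : 'cV[R]_d) (G1 G2 Gh1 Gh2 : R -> 'M[R]_d)
  (X Xh : R -> Omega -> 'cV[R]_d).
Hypotheses (a0 : 0 <= a)
  (bL : forall x y, frob (b x - b y) ^+ 2 <= a * frob (x - y) ^+ 2)
  (bG : forall x, frob (b x) ^+ 2 <= a * (1 + frob x ^+ 2))
  (sigmaL : forall x y, frob (sigma x - sigma y) ^+ 2 <= a * frob (x - y) ^+ 2)
  (sigmaG : forall x, frob (sigma x) ^+ 2 <= a * (1 + frob x ^+ 2)).
Hypotheses (mh : measurable_fun [set: R] h) (mhn : measurable_fun [set: R] hn).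
Hypotheses (h0 : forall t, 0 <= h t) (hn0 : forall t, 0 <= hn t).
Hypotheses (G1le : forall t, 0 < t <= T -> frob (G1 t) ^+ 2 <= h t)
  (G2le : forall t, 0 < t <= T -> frob (G2 t) ^+ 2 <= h t)
  (Gh1le : forall t, 0 < t <= T -> frob (Gh1 t - G1 t) ^+ 2 <= hn t)
  (Gh2le : forall t, 0 < t <= T -> frob (Gh2 t - G2 t) ^+ 2 <= hn t).
Hypotheses (mG1 : forall i j, measurable_fun [set: R] (fun s => G1 s i j))
  (mG2 : forall i j, measurable_fun [set: R] (fun s => G2 s i j))
  (mGh1 : forall i j, measurable_fun [set: R] (fun s => Gh1 s i j))
  (mGh2 : forall i j, measurable_fun [set: R] (fun s => Gh2 s i j)).
Hypotheses (X_solution : volterra_solution P Ft W x0 b sigma G1 G2 X)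
  (Xh_solution : volterra_solution P Ft W x0 b sigma Gh1 Gh2 Xh).
Hypothesis (m0 : 0 <= m)
  (Xm : forall t, 0 <= t <= T -> (\int[P]_w (frob (X t w) ^+ 2)%:E <= m%:E)%E).
Variable eta0 : R.
Hypothesis h_int : (\int[mu]_(s in `[0%R, T]) (h s)%:E <= eta0%:E)%E.
Local Notation D t := (\int[P]_w (frob (Xh t w - X t w) ^+ 2)%:E)%E.
Local Notation V := (@normal_second_moment R).

(** [kernel_term_le] with second kernel 0, both processes equal to X, and B = theta = 0: the kernel
    error is then [G1] itself, and [h] plays the role of [hn]. *)
Lemma drift_finite t : 0 <= t <= T ->
  (\int[P]_w \int[mu]_(s in `[0%R, t]) (frob (G1 (t - s) *m b (X s w)) ^+ 2)%:E < +oo)%E.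
Proof.
move=> t0T; have mX := vs_measurable X_solution.
pose Z : R -> 'M[R]_d := fun _ => 0.
have Zle u : 0 < u <= T -> frob (Z u - G1 u) ^+ 2 <= h u.
  by rewrite sub0r frobN; exact: G1le.
have mZ i j : measurable_fun [set: R] (fun s => Z s i j).
  by under eq_fun do rewrite mxE; exact: measurable_cst.
have D0 s : 0 <= s <= T ->
    (\int[P]_w (frob (X s w - X s w) ^+ 2)%:E <= (0 * expR (0 * s))%:E)%E.
  move=> _; rewrite mul0r integral0_eq// => w _.
  by rewrite subrr frob0 expr0n.
have h_int0 : (\int[mu]_(s in `[0%R, T]) (h s * expR (- (0 * s)))%:E <= eta0%:E)%E.
  by under eq_integral do rewrite mul0r oppr0 expR0 mulr1.
have := kernel_term_le b_lip a0 bL bG mh mh G1le Zle h0 h0 mG1 mZ mX mX m0 Xm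
  (lexx 0) (lexx 0) D0 h_int h_int0 t0T.
under eq_integral do under eq_integral do rewrite mul0mx sub0r frobN.
by move=> /le_lt_trans; apply; rewrite ltry.
Qed.

(** One Picard step for the weighted bound on D. In 8 a (T + 9 d V), the 8 is 2 from separating
    drift and noise times 4 from [kernel_term_le]; T is Cauchy-Schwarz in time and 9 d V is the cost
    of the Ito comparison. *)
Lemma one_step theta B eta kappa : 0 <= theta -> 0 <= B ->
  (forall s, 0 <= s <= T -> (D s <= (B * expR (theta * s))%:E)%E) ->
  (\int[mu]_(s in `[0%R, T]) (hn s)%:E <= eta%:E)%E ->
  (\int[mu]_(s in `[0%R, T]) (h s * expR (- (theta * s)))%:E <= kappa%:E)%E ->
  forall t, 0 <= t <= T ->
  (D t <= (8 * a * (T + 9 * (d%:R * V)) * expR (theta * t) *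
           ((1 + m + B) * eta + B * kappa))%:E)%E.
Proof.
move=> theta0 B0 DB hneta hkappa t t0T; have /andP[t0 tT] := t0T.
have mX := vs_measurable X_solution; have mXh := vs_measurable Xh_solution.
have V0 := @normal_second_moment_ge0 R.
have [Y [itoY XE]] := vs_equation X_solution t0.
have [Yh [itoYh XhE]] := vs_equation Xh_solution t0.
have hb := kernel_term_le b_lip a0 bL bG mh mhn G1le Gh1le h0 hn0 mG1 mGh1 mX mXh
  m0 Xm theta0 B0 DB hneta hkappa t0T.
have hs := kernel_term_le sigma_lip a0 sigmaL sigmaG mh mhn G2le Gh2le h0 hn0 mG2
  mGh2 mX mXh m0 Xm theta0 B0 DB hneta hkappa t0T.
have hY := ito_integral_comparison Ft_filtration W_brownian t0 itoY itoYh.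
pose g s w := G1 (t - s) *m b (X s w); pose gh s w := Gh1 (t - s) *m b (Xh s w).
have mI : measurable (`[0, t] : set (measurableTypeR R)) by exact: measurable_itv.
have mg : jointly_measurable `[0, t] g by exact: jointly_measurable_kernel.
have mgh : jointly_measurable `[0, t] gh by exact: jointly_measurable_kernel.
have md := jointly_measurableB mgh mg.
pose N (u : R -> Omega -> 'cV[R]_d) w := (\int[mu]_(s in `[0%R, t]) (frob (u s w) ^+ 2)%:E)%E.
have N0 u w : (0 <= N u w)%E by apply: integral_ge0 => s _; rewrite lee_fin sqr_ge0.
have mN u : jointly_measurable `[0, t] u -> measurable_fun [set: Omega] (N u).
  move=> mu'; apply: (@measurable_section_time _ _ _ _ mI (fun s w => (frob (u s w) ^+ 2)%:E)).
    by apply: measurable_frob_sqr => i j; exact: mu'.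
  by move=> s w; rewrite lee_fin sqr_ge0.
have finite u : jointly_measurable `[0, t] u -> (\int[P]_w N u w < +oo)%E ->
    {ae P, forall w, (N u w < +oo)%E}.
  move=> mu' ufin.
  have iN : P.-integrable [set: Omega] (N u).
    apply/integrableP; split; first exact: mN.
    by under eq_integral do rewrite gee0_abs//.
  have := integrable_ae measurableT iN; apply: filterS => w /(_ I).
  by rewrite ge0_fin_numE.
have fin_g := finite _ mg (drift_finite t0T).
have fin_d := finite _ md (le_lt_trans hb (ltry _)).
pose err w := (frob (Yh w - Y w) ^+ 2)%:E : \bar R.
(* Almost surely both equations hold and both time integrals are finite. Without integrability
   [Rintegral] may take a default value, and the drifts could not be subtracted. *)
have pathwise : {ae P, forall w, [set: Omega] w ->
    ((frob (Xh t w - X t w) ^+ 2)%:E <=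
     (2 * t)%:E * N (fun s w => (gh s w - g s w)%R) w + 2%:E * err w)%E}.
  near=> w => _.
  have Xw : X t w = x0 + \col_i (\int[mu]_(s in `[0%R, t]) (g s w) i 0) + Y w.
    by near: w; exact: XE.
  have Xhw : Xh t w = x0 + \col_i (\int[mu]_(s in `[0%R, t]) (gh s w) i 0) + Yh w.
    by near: w; exact: XhE.
  have gw : (N g w < +oo)%E by near: w; exact: fin_g.
  have dw : (N (fun s w => (gh s w - g s w)%R) w < +oo)%E by near: w; exact: fin_d.
  have sl (u : R -> Omega -> 'cV[R]_d) i : jointly_measurable `[0, t] u ->
    measurable_fun `[0, t] (fun s => u s w i 0) by exact: measurable_timeslice.
  have := frob_integral_difference_le t0 (fun i => sl _ i mg) (fun i => sl _ i md) gw dw.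
  set Ig := \col_i _; set Igh := (X in frob (Ig - X)); move=> hI.
  apply: (@le_trans _ _ (2 * frob (Ig - Igh) ^+ 2 + 2 * frob (Yh w - Y w) ^+ 2)%:E).
    rewrite lee_fin; have -> : Xh t w - X t w = (Ig - Igh) + (Yh w - Y w).
      rewrite Xw Xhw -/Ig -/Igh; set u := Ig; set v := Igh.
      by apply/matrixP => i j; rewrite !mxE; ring.
    exact: frobD_sqr.
  rewrite EFinD [X in (X + _)%E]EFinM [X in (_ + X)%E]EFinM; apply: leeD => //.
  by rewrite (EFinM 2 t) -muleA; apply: lee_wpmul2l.
have mY i j : measurable_fun [set: Omega] (fun w => Y w i j).
  by case: itoY => _ mY _ _ S mS; rewrite setTI; exact: mY.
have mYh i j : measurable_fun [set: Omega] (fun w => Yh w i j).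
  by case: itoYh => _ mY' _ _ S mS; rewrite setTI; exact: mY'.
have merr : measurable_fun [set: Omega] err.
  by apply: measurable_frob_sqr => i j; exact: measurable_entryB.
have mDt : measurable_fun [set: Omega] (fun w => (frob (Xh t w - X t w) ^+ 2)%:E).
  by apply: measurable_frob_sqr => i j; apply: measurable_entryB; exact: measurable_state.
have err0 w : (0 <= err w)%E by rewrite lee_fin sqr_ge0.
have t20 : (0 <= (2 * t)%:E :> \bar R)%E by rewrite lee_fin mulr_ge0.
apply: (@le_trans _ _ ((2 * t)%:E * \int[P]_w N (fun s w => (gh s w - g s w)%R) w +
    2%:E * \int[P]_w err w)%E).
  rewrite -ge0_integralZl//; last exact: mN.
  rewrite -ge0_integralZl// -ge0_integralD//.
  - apply: ae_ge0_le_integral => //.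
    + by move=> w _; rewrite lee_fin sqr_ge0.
    + by move=> w _; rewrite adde_ge0// mule_ge0.
    + apply: emeasurable_funD; apply: measurable_funeM => //; exact: mN.
  - by move=> w _; rewrite mule_ge0.
  - by apply: measurable_funeM; exact: mN.
  - by move=> w _; rewrite mule_ge0.
  - exact: measurable_funeM.
apply: (@le_trans _ _ ((2 * t)%:E * (4 * a * expR (theta * t) * ((1 + m + B) * eta + B * kappa))%:E +
  2%:E * ((9 * (d%:R * V))%:E * (4 * a * expR (theta * t) * ((1 + m + B) * eta + B * kappa))%:E))%E).
  apply: leeD; first by apply: lee_wpmul2l.
  apply: lee_wpmul2l => //; apply: le_trans hY _; apply: lee_wpmul2l => //.
  by rewrite lee_fin mulr_ge0// mulr_ge0.
set Q := (1 + m + B) * eta + B * kappa; set r := 4 * a * expR (theta * t) * Q.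
have r0 : 0 <= r.
  rewrite -lee_fin; apply: le_trans hb; apply: integral_ge0 => w _.
  by apply: integral_ge0 => s _; rewrite lee_fin sqr_ge0.
rewrite -!EFinM -EFinD lee_fin.
have -> : 8 * a * (T + 9 * (d%:R * V)) * expR (theta * t) * Q =
  2 * T * r + 2 * (9 * (d%:R * V) * r) by rewrite /r; ring.
by rewrite lerD2r ler_wpM2r// ler_wpM2l.
Unshelve. all: end_near. Qed.

End comparison.

Section laplace_kernel_measurability.
Context {R : realType}.
Variables (d : nat) (M : R -> 'M[R]_d).
Hypotheses (M_bounded : bounded_on_Rplus M) (M_C4 : Ck_bounded_derivatives_mx 4 M).

Let mM i j : measurable_fun [set x : R | 0 <= x] (fun r => M r i j).
Proof.
have [c Mc] := M_bounded.
have bnd x : 0 <= x -> `|M x i j| <= c.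
  by move=> x0; apply: le_trans (Mc x x0); exact: entry_le_frob.
by have [F [b [_ _ _ _]]] := Ck_regularity (M_C4 i j) bnd.
Qed.

Lemma measurable_laplace_kernel_frac (H : R) i j :
  measurable_fun [set: R] (fun s => laplace_kernel (frac_measure H) M s i j).
Proof.
rewrite (_ : (fun s => _) = (fun t => \int[frac_measure H]_(x in [set x | 0 <= x])
    laplace_integrand (fun r => M r i j) t x)); last by apply/funext => s; rewrite mxE.
exact: measurable_frac_transform.
Qed.

Lemma measurable_laplace_kernel_quad (H beta K : R) n (beta01 : 0 < beta < 1)
    (K_gt1 : 1 < K) rho i j : (forall k, (0 < k <= n)%N -> cell beta K n k (rho k)) ->
  measurable_fun [set: R] (fun s =>
    laplace_kernel (quad_measure H n beta01 K_gt1 rho) M s i j).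
Proof.
move=> rho_in_cell.
rewrite (_ : (fun s => _) = (fun t =>
    \int[quad_measure H n beta01 K_gt1 rho]_(x in [set x | 0 <= x])
    laplace_integrand (fun r => M r i j) t x)); last by apply/funext => s; rewrite mxE.
apply: measurable_quad_transform => // k kn.
have := rho_in_cell k.+1 kn; rewrite /cell /= in_itv/= => /andP[+ _].
by apply: le_trans; rewrite mulr_ge0 ?divr_ge0 ?powR_ge0.
Qed.

End laplace_kernel_measurability.

(** * Iteration of the estimate and conclusion *)

Section asymptotics.
Context {R : realType}.

Lemma powRN_small (r e : R) : 0 < r -> 0 < e ->
  exists n0, forall n, (n0 <= n)%N -> (0 < n)%N -> n%:R `^ (- r) <= e.
Proof.
move=> r0 e0; pose x := e `^ (- r^-1).
exists (Num.trunc x).+1 => n xn n0.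
have x0 : 0 < x by rewrite powR_gt0.
have xn' : x <= n%:R.
  by apply: le_trans (ltW (truncnS_gt x)) _; rewrite ler_nat.
have -> : e = x `^ (- r).
  by rewrite /x -powRrM mulrNN mulVf ?gt_eqF// powRr1// ltW.
rewrite !powRN lef_pV2 ?posrE ?powR_gt0 ?ltr0n//.
by apply: ge0_ler_powR; rewrite ?nnegrE ?(ltW r0) ?(ltW x0).
Qed.

(** After k steps the bound is 2 c (1 - 2^(-k)) + M 2^(-k). No closure of [Q] under limits is
    assumed, so the iteration stops once M 2^(-k) <= c, whence 3 c instead of the fixed point 2 c;
    the start [M] no longer appears. *)
Lemma contraction_iterate (Q : R -> Prop) (c M : R) : 0 < c -> 0 <= M -> Q M ->
  (forall B, 0 <= B -> Q B -> Q (c + B / 2)) ->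
  exists2 B, Q B & 0 <= B <= 3 * c.
Proof.
move=> c0 M0 QM step.
have c00 := ltW c0.
have iter k : Q (2 * c * (1 - 2^-1 ^+ k) + M / 2 ^+ k).
  elim: k => [|k IH]; first by rewrite !expr0 subrr mulr0 add0r divr1.
  have := step _ _ IH; rewrite !exprS !exprVn.
  have -> : c + (2 * c * (1 - (2 ^+ k)^-1) + M / 2 ^+ k) / 2 =
      2 * c * (1 - 2^-1 * (2 ^+ k)^-1) + M / (2 * 2 ^+ k).
    by field; rewrite expf_neq0.
  apply; apply: addr_ge0; last by rewrite divr_ge0// exprn_ge0.
  rewrite mulr_ge0 ?mulr_ge0// subr_ge0.
  by rewrite invf_le1 ?exprn_gt0// exprn_ege1 ?ler1n.
(* This [k] exceeds M / c, and 2^k exceeds [k]. *)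
pose k := (Num.trunc (M / c)).+1.
exists (2 * c * (1 - 2^-1 ^+ k) + M / 2 ^+ k) => //.
have p0 : 0 < (2 : R) ^+ k by rewrite exprn_gt0.
have p1 : 2^-1 ^+ k <= 1 :> R by rewrite exprVn invf_le1// exprn_ege1 ?ler1n.
have p2 : 0 <= 2^-1 ^+ k :> R by rewrite exprn_ge0.
have Mc : M / 2 ^+ k <= c.
  rewrite ler_pdivrMr// mulrC -ler_pdivrMr//.
  apply: le_trans (ltW (truncnS_gt _)) _.
  by rewrite -natrX ler_nat ltnW// ltn_expl.
apply/andP; split; last first.
  have : 0 <= 2 * c * 2^-1 ^+ k by rewrite mulr_ge0 ?mulr_ge0.
  by move: Mc; lra.
apply: addr_ge0; last exact: divr_ge0 M0 (ltW p0).
by apply: mulr_ge0; [exact: mulr_ge0|rewrite subr_ge0].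
Qed.

End asymptotics.

Section dominating_kernels2.
Context {R : realType}.
Local Notation mu := (@lebesgue_measure R).

Lemma ge0_integralD_le (D : set (measurableTypeR R)) (f1 f2 : R -> R) (e1 e2 : R) :
  measurable D ->
  measurable_fun [set: R] f1 -> measurable_fun [set: R] f2 ->
  (forall t, 0 <= f1 t) -> (forall t, 0 <= f2 t) ->
  (\int[mu]_(t in D) (f1 t)%:E <= e1%:E)%E -> (\int[mu]_(t in D) (f2 t)%:E <= e2%:E)%E ->
  (\int[mu]_(t in D) (f1 t + f2 t)%:E <= (e1 + e2)%:E)%E.
Proof.
move=> mD mf1 mf2 f10 f20 le1 le2.
under eq_integral do rewrite EFinD.
rewrite ge0_integralD//; first by rewrite EFinD; exact: leeD.
- by move=> t _; rewrite lee_fin.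
- by apply: measurable_funTS; apply/measurable_EFinP.
- by move=> t _; rewrite lee_fin.
- by apply: measurable_funTS; apply/measurable_EFinP.
Qed.

Variables (H T beta g : R) (K : nat -> R) (rho : nat -> nat -> R) (c1 c2 : R).
Hypotheses (H_range : 0 < H < 2^-1) (T_gt0 : 0 < T)
  (beta_def : beta = (10 - 6 * H) / (13 - 6 * H))
  (g_def : g = (13 - 6 * H) / (15 - 6 * H))
  (beta01 : 0 < beta < 1) (K_gt1 : forall n, (0 < n)%N -> 1 < K n)
  (c1_gt0 : 0 < c1)
  (K_bounds : forall n, (0 < n)%N -> c1 * n%:R `^ g <= K n <= c2 * n%:R `^ g)
  (rho_in_cell : forall n i, (1 <= i <= n)%N -> cell beta (K n) n i (rho n i)).
Variables (d : nat) (M1 M2 : R -> 'M[R]_d).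
Hypotheses (M1_bounded : bounded_on_Rplus M1) (M2_bounded : bounded_on_Rplus M2)
  (M1_C4 : Ck_bounded_derivatives_mx 4 M1) (M2_C4 : Ck_bounded_derivatives_mx 4 M2).
Local Notation G M := (laplace_kernel (frac_measure H) M).
Local Notation Ghat n n_gt0 M :=
  (laplace_kernel (quad_measure H n beta01 (K_gt1 n_gt0) (rho n)) M).

(** The majorants of the two kernels are added. The sum of the two damping rates serves both, since
    a larger rate only decreases the damped integrals. *)
Lemma dominating_kernels2 : exists (h : R -> R) (hn : nat -> R -> R) (C : R),
  [/\ measurable_fun [set: R] h, forall t, 0 <= h t,
      forall n, measurable_fun [set: R] (hn n), forall n t, 0 <= hn n t & 0 <= C] /\
  [/\ forall t, 0 < t <= T -> frob (G M1 t) ^+ 2 <= h t /\ frob (G M2 t) ^+ 2 <= h t,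
      forall n (n_gt0 : (0 < n)%N) t, 0 < t <= T ->
        frob (Ghat n n_gt0 M1 t - G M1 t) ^+ 2 <= hn n t /\
        frob (Ghat n n_gt0 M2 t - G M2 t) ^+ 2 <= hn n t,
      forall n, (0 < n)%N ->
        (\int[mu]_(t in `[0%R, T]) (hn n t)%:E <= (C * n%:R `^ (- (2 * H * g)))%:E)%E &
      forall e, 0 < e -> exists2 theta, 0 < theta &
        (\int[mu]_(t in `[0%R, T]) (h t * expR (- (theta * t)))%:E <= e%:E)%E].
Proof.
have [h1 [hn1 [C1 [[mh1 h10 mhn1 hn10 C10] [A1 B1 D1 E1]]]]] := dominating_kernels
  H_range T_gt0 beta_def g_def beta01 K_gt1 c1_gt0 K_bounds rho_in_cell M1_bounded M1_C4.
have [h2 [hn2 [C2 [[mh2 h20 mhn2 hn20 C20] [A2 B2 D2 E2]]]]] := dominating_kernels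
  H_range T_gt0 beta_def g_def beta01 K_gt1 c1_gt0 K_bounds rho_in_cell M2_bounded M2_C4.
have mI : measurable (`[0, T] : set (measurableTypeR R)) by exact: measurable_itv.
exists (fun t => h1 t + h2 t), (fun n t => hn1 n t + hn2 n t), (C1 + C2); split; split.
- exact: measurable_funD.
- by move=> t; rewrite addr_ge0.
- by move=> n; exact: measurable_funD.
- by move=> n t; rewrite addr_ge0.
- by rewrite addr_ge0.
- move=> t tT; split.
    by apply: le_trans (A1 t tT) _; rewrite lerDl.
  by apply: le_trans (A2 t tT) _; rewrite lerDr.
- move=> n n_gt0 t tT; split.
    by apply: le_trans (B1 n n_gt0 t tT) _; rewrite lerDl.
  by apply: le_trans (B2 n n_gt0 t tT) _; rewrite lerDr.
- move=> n n0; rewrite mulrDl; apply: ge0_integralD_le => //.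
    exact: D1.
  exact: D2.
move=> e e0; have e20 : 0 < e / 2 by rewrite divr_gt0.
have [th1 th10 hth1] := E1 _ e20; have [th2 th20 hth2] := E2 _ e20.
exists (th1 + th2); first exact: addr_gt0.
have mw (k : R -> R) th : measurable_fun [set: R] k ->
    measurable_fun [set: R] (fun u => k u * expR (- (th * u))).
  move=> mk; apply: measurable_funM => //; apply: measurableT_comp => //.
  by apply: measurable_funN; exact: mulrl_measurable.
have mono (k : R -> R) th : measurable_fun [set: R] k -> (forall t, 0 <= k t) ->
    th <= th1 + th2 ->
    (\int[mu]_(t in `[0%R, T]) (k t * expR (- (th * t)))%:E <= (e / 2)%:E)%E ->
    (\int[mu]_(t in `[0%R, T]) (k t * expR (- ((th1 + th2) * t)))%:E <= (e / 2)%:E)%E.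
  move=> mk k0 thle; apply: le_trans; apply: ge0_le_integral => //.
  - by move=> t _; rewrite lee_fin mulr_ge0 ?expR_ge0.
  - by apply: measurable_funTS; apply/measurable_EFinP; exact: mw.
  - by apply: measurable_funTS; apply/measurable_EFinP; exact: mw.
  move=> t; rewrite /= in_itv/= => /andP[t0 _]; rewrite lee_fin ler_wpM2l//.
  by rewrite ler_expR lerN2 ler_wpM2r.
under eq_integral do rewrite mulrDl.
rewrite [e]splitr; apply: ge0_integralD_le => //; do ?exact: mw;
  do ?by move=> t; rewrite mulr_ge0 ?expR_ge0.
  by apply: (mono _ th1) => //; rewrite lerDl ltW.
by apply: (mono _ th2) => //; rewrite lerDr ltW.
Qed.

End dominating_kernels2.

(** On [0, T] the damping is undone at the cost of exp(theta T); this supplies the integral of [h]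
    required by [drift_finite]. *)
Lemma integrable_of_damped (R : realType) (h : R -> R) (T theta : R) :
  measurable_fun [set: R] h -> (forall t, 0 <= h t) -> 0 <= theta ->
  (\int[lebesgue_measure]_(t in `[0%R, T]) (h t * expR (- (theta * t)))%:E <= 1%:E)%E ->
  (\int[lebesgue_measure]_(t in `[0%R, T]) (h t)%:E <= (expR (theta * T))%:E)%E.
Proof.
move=> mh h0 th0 le1.
have mI : measurable (`[0, T] : set (measurableTypeR R)) by exact: measurable_itv.
have mw : measurable_fun [set: R] (fun u => (h u * expR (- (theta * u)))%:E).
  apply/measurable_EFinP; apply: measurable_funM => //; apply: measurableT_comp => //.
  by apply: measurable_funN; exact: mulrl_measurable.
have mwI : measurable_fun `[0, T] (fun u => (h u * expR (- (theta * u)))%:E).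
  exact: measurable_funTS.
rewrite -[leRHS]mule1; apply: le_trans (lee_wpmul2l _ le1); last by rewrite lee_fin expR_ge0.
have e0 : (0 <= (expR (theta * T))%:E)%E by rewrite lee_fin expR_ge0.
rewrite -ge0_integralZl//; do ?by move=> t _; rewrite lee_fin mulr_ge0 ?expR_ge0.
apply: ge0_le_integral => //.
- by move=> t _; rewrite lee_fin.
- by apply: measurable_funTS; apply/measurable_EFinP.
- exact: measurable_funeM.
move=> t; rewrite /= in_itv/= => /andP[t0 tT].
rewrite -EFinM lee_fin mulrCA ler_peMr// -expRD -expR0 ler_expR.
by rewrite -mulrBr mulr_ge0// subr_ge0.
Qed.

Section moments.
Context {R : realType} {dO : measure_display} {Omega : measurableType dO}.
Variables (P : probability Omega R) (d : nat) (Ft : R -> set (set Omega)).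
Variables (W : R -> Omega -> 'cV[R]_d) (x0 : 'cV[R]_d) (b : 'cV[R]_d -> 'cV[R]_d)
  (sigma : 'cV[R]_d -> 'M[R]_d).

Lemma volterra_second_moment (G1 G2 : R -> 'M[R]_d) (X : R -> Omega -> 'cV[R]_d) T :
  0 <= T -> volterra_solution P Ft W x0 b sigma G1 G2 X -> exists2 m, 0 <= m &
  forall t, 0 <= t <= T -> (\int[P]_w (frob (X t w) ^+ 2)%:E <= m%:E)%E.
Proof.
move=> T0 /vs_moments /(_ T T0)[m mX].
exists `|m| => // t tT; have := mX t tT; rewrite unlock => /le_trans; apply.
by rewrite lee_fin ler_norm.
Qed.

(** The bound [m] depends on the approximating solution, hence on n. It provides a finite start for
    the iteration and covers the finitely many small n. *)
Lemma difference_second_moment (G1 G2 Gh1 Gh2 : R -> 'M[R]_d)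
    (X Xh : R -> Omega -> 'cV[R]_d) T : 0 <= T ->
  volterra_solution P Ft W x0 b sigma G1 G2 X ->
  volterra_solution P Ft W x0 b sigma Gh1 Gh2 Xh -> exists2 m, 0 <= m &
  forall t, 0 <= t <= T -> (\int[P]_w (frob (Xh t w - X t w) ^+ 2)%:E <= m%:E)%E.
Proof.
move=> T0 solX solXh.
have [m m0 Xm] := volterra_second_moment T0 solX.
have [mh mh0 Xhm] := volterra_second_moment T0 solXh.
exists (2 * (mh + m)) => [|t tT]; first by rewrite mulr_ge0 ?addr_ge0.
have /andP[t0 _] := tT.
have mX := measurable_state (vs_measurable solX) t0.
have mXh := measurable_state (vs_measurable solXh) t0.
apply: (@le_trans _ _ (2%:E * (\int[P]_w (frob (Xh t w) ^+ 2)%:E +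
    \int[P]_w (frob (X t w) ^+ 2)%:E + \int[P]_w (cst 0 w))%E)%E).
  apply: ge0_integral_le3 => //.
  - by apply: measurable_frob_sqr => i j; exact: measurable_entryB.
  - exact: measurable_frob_sqr.
  - exact: measurable_frob_sqr.
  - by move=> w _; rewrite lee_fin sqr_ge0.
  - by move=> w; rewrite lee_fin sqr_ge0.
  - by move=> w; rewrite lee_fin sqr_ge0.
  move=> w _; rewrite adde0 -EFinD -EFinM lee_fin mulrDr.
  by rewrite -[in leRHS](frobN (X t w)); exact: frobD_sqr.
rewrite integral0 adde0 (EFinM 2); apply: lee_wpmul2l => //.
by rewrite EFinD; apply: leeD; [exact: Xhm|exact: Xm].
Qed.

End moments.

Theorem proposition5p1 (R : realType) (d : nat) (d_ge1 : (1 <= d)%N)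
    (dO : measure_display) (Omega : measurableType dO) (P : probability Omega R)
    (Ft : R -> set (set Omega)) (Ft_filtration : is_filtration Ft)
    (W : R -> Omega -> 'cV[R]_d) (W_brownian : brownian_motion P Ft W)
    (x0 : 'cV[R]_d) (b : 'cV[R]_d -> 'cV[R]_d) (sigma : 'cV[R]_d -> 'M[R]_d)
    (b_lip : globally_lipschitz b) (sigma_lip : globally_lipschitz sigma)
    (M1 M2 : R -> 'M[R]_d)
    (M1_bounded : bounded_on_Rplus M1) (M2_bounded : bounded_on_Rplus M2)
    (M1_C4 : Ck_bounded_derivatives_mx 4 M1)
    (M2_C4 : Ck_bounded_derivatives_mx 4 M2)
    (H : R) (H_range : 0 < H < 2^-1) (T : R) (T_gt0 : 0 < T)
    (beta : R) (beta01 : 0 < beta < 1)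
    (beta_def : beta = (10 - 6 * H) / (13 - 6 * H))
    (K : nat -> R) (K_gt1 : forall n, (0 < n)%N -> 1 < K n)
    (K_equiv : K ~_\oo (fun n => n%:R `^ ((13 - 6 * H) / (15 - 6 * H))))
    (rho : nat -> nat -> R)
    (rho_in_cell : forall n i, (1 <= i <= n)%N ->
       cell beta (K n) n i (rho n i))
    (X : R -> Omega -> 'cV[R]_d)
    (X_solution : volterra_solution P Ft W x0 b sigma
       (laplace_kernel (frac_measure H) M1)
       (laplace_kernel (frac_measure H) M2) X)
    (Xhat : nat -> R -> Omega -> 'cV[R]_d)
    (Xhat_solution : forall n (n_gt0 : (0 < n)%N),
       let lambda_hat := quad_measure H n beta01 (K_gt1 n n_gt0) (rho n) in
       volterra_solution P Ft W x0 b sigma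
         (laplace_kernel lambda_hat M1) (laplace_kernel lambda_hat M2)
         (Xhat n)) :
  exists C : R, 0 < C /\
    forall n, (0 < n)%N -> forall t : R, 0 <= t <= T ->
      ('E_P[(fun w => frob (Xhat n t w - X t w) ^+ 2)%R] <=
       (C * n%:R `^ (- (2 * H * ((13 - 6 * H) / (15 - 6 * H)))))%:E)%E.

Proof.
set g := (13 - 6 * H) / (15 - 6 * H); set r := 2 * H * g.
have H0 : 0 < H by have /andP[] := H_range.
have g0 : 0 < g.
  have /andP[_ H2] := H_range.
  by rewrite /g divr_gt0//; move: H2; lra.
have r0 : 0 < r by apply: mulr_gt0 g0; rewrite mulr_gt0.
have n_ge1 n : (0 < n)%N -> 1 <= n%:R `^ g :> R.
  by move=> n0; rewrite -[leLHS](powRr0 n%:R); apply: ler_powR; rewrite ?ler1n// ltW.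
have [c1 [c2 [c10 c20 Kb]]] := equiv_seq_bounds K_equiv K_gt1 n_ge1.
have [h [hn [C [[mh h0 mhn hn0 C0] [Gle Ghle hn_int h_small]]]]] :=
  dominating_kernels2 H_range T_gt0 beta_def (erefl g) beta01 K_gt1 c10 Kb
    rho_in_cell M1_bounded M2_bounded M1_C4 M2_C4.
have [a1 [a10 bL bG]] := lipschitz_growth b_lip.
have [a2 [a20 sL sG]] := lipschitz_growth sigma_lip.
pose a := a1 + a2; have a0 : 0 <= a by rewrite addr_ge0.
have up1 x : a1 * x ^+ 2 <= a * x ^+ 2 by rewrite ler_wpM2r ?sqr_ge0// lerDl.
have up2 x : a2 * x ^+ 2 <= a * x ^+ 2 by rewrite ler_wpM2r ?sqr_ge0// lerDr.
have up3 x : a1 * (1 + x ^+ 2) <= a * (1 + x ^+ 2).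
  by rewrite ler_wpM2r ?addr_ge0 ?sqr_ge0// lerDl.
have up4 x : a2 * (1 + x ^+ 2) <= a * (1 + x ^+ 2).
  by rewrite ler_wpM2r ?addr_ge0 ?sqr_ge0// lerDr.
have T0 := ltW T_gt0.
have [m m0 Xm] := volterra_second_moment T0 X_solution.
pose D n t := (\int[P]_w (frob (Xhat n t w - X t w) ^+ 2)%:E)%E.
pose V := @normal_second_moment R.
have V0 : 0 <= V := @normal_second_moment_ge0 R.
(* The constant of [one_step], increased by 1 to be positive. *)
pose L := 8 * a * (T + 9 * (d%:R * V)) + 1.
have L0 : 0 < L by rewrite ltr_pwDr// mulr_ge0 ?addr_ge0 ?mulr_ge0.
(* With damped mass 1 / (4 L), the kernel [h] contributes B / 4 to each step; the other quarter is
   reserved for the kernel error. *)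
have L40 : 0 < (4 * L)^-1 by rewrite invr_gt0 mulr_gt0.
have [theta th0 kappa] := h_small _ L40.
have [theta1 th10 h_int1] := h_small _ ltr01.
have h_int0 := integrable_of_damped mh h0 (ltW th10) h_int1.
(* Stated for every [n] so that [choice] applies; at n = 0 the bound is void and 0 serves. *)
have Mex n : exists M : R, 0 <= M /\ ((0 < n)%N -> forall t, 0 <= t <= T -> (D n t <= M%:E)%E).
  have [->|n_gt0] := posnP n; first by exists 0.
  have [M M0 DM] := difference_second_moment T0 X_solution (Xhat_solution n n_gt0).
  by exists M.
have /choice[M MD] := Mex.
have m10 : 0 < 1 + m by exact: ltr_pwDl.
have C10 : 0 < C + 1 by rewrite ltr_pwDr.
(* From [n0] on, L (C + 1) n^(-r) <= 1/4. The summand 1 in C + 1 makes [eta], and hence the fixed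
   term [c] of the iteration, positive. *)
have [n0 hn0'] := powRN_small r0 (divr_gt0 L40 C10).
have large n : (n0 <= n)%N -> (0 < n)%N -> forall t, 0 <= t <= T ->
    (D n t <= (3 * (L * (1 + m) * (C + 1)) * expR (theta * T) * n%:R `^ (- r))%:E)%E.
  move=> nn0 n_gt0.
  pose eta := (C + 1) * n%:R `^ (- r).
  have eta_gt0 : 0 < eta by apply: mulr_gt0 => //; rewrite powR_gt0 ?ltr0n.
  have hneta : (\int[lebesgue_measure]_(s in `[0%R, T]) (hn n s)%:E <= eta%:E)%E.
    apply: le_trans (hn_int n n_gt0) _; rewrite lee_fin ler_wpM2r ?powR_ge0//.
    by rewrite lerDl.
  have eta_small : L * eta <= 4^-1.
    have := hn0' n nn0 n_gt0; rewrite ler_pdivlMr// mulrC -/eta.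
    move=> /(ler_wpM2l (ltW L0)).
    by have -> : L * (4 * L)^-1 = 4^-1 by field; rewrite gt_eqF.
  pose c := L * (1 + m) * eta.
  have c0 : 0 < c := mulr_gt0 (mulr_gt0 L0 m10) eta_gt0.
  have [M0 DM] := MD n.
  have step B : 0 <= B ->
     (forall s, 0 <= s <= T -> (D n s <= (B * expR (theta * s))%:E)%E) ->
     (forall s, 0 <= s <= T -> (D n s <= ((c + B / 2) * expR (theta * s))%:E)%E).
    move=> B0 DB t tT.
    have := one_step Ft_filtration W_brownian b_lip sigma_lip a0
      (fun x y => le_trans (bL x y) (up1 _)) (fun x => le_trans (bG x) (up3 _))
      (fun x y => le_trans (sL x y) (up2 _)) (fun x => le_trans (sG x) (up4 _))
      mh (mhn n) h0 (hn0 n)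
      (fun t tT => (Gle t tT).1) (fun t tT => (Gle t tT).2)
      (fun t tT => (Ghle n n_gt0 t tT).1) (fun t tT => (Ghle n n_gt0 t tT).2)
      (fun i j => measurable_laplace_kernel_frac M1_bounded M1_C4 H i j)
      (fun i j => measurable_laplace_kernel_frac M2_bounded M2_C4 H i j)
      (fun i j => measurable_laplace_kernel_quad M1_bounded M1_C4 H beta01 (K_gt1 n n_gt0) i j (rho_in_cell n))
      (fun i j => measurable_laplace_kernel_quad M2_bounded M2_C4 H beta01 (K_gt1 n n_gt0) i j (rho_in_cell n))
      X_solution (Xhat_solution n n_gt0) m0 Xm h_int0 (ltW th0) B0 DB hneta kappa tT.
    move=> /le_trans; apply; rewrite lee_fin -/V mulrAC ler_wpM2r ?expR_ge0//.
    set Q := (X in _ * X); have Q0 : 0 <= Q.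
      have L4 := ltW L40; have eta0' := ltW eta_gt0.
      by apply: addr_ge0; apply: mulr_ge0 => //; apply: addr_ge0 => //; apply: addr_ge0.
    apply: (@le_trans _ _ (L * Q)); first by rewrite ler_wpM2r// lerDl.
    (* Both terms in [B] are at most B / 4, so the step has the form c + B / 2. *)
    have -> : L * Q = c + B * (L * eta) + B * (L / (4 * L)) by rewrite /Q /c; ring.
    have -> : L / (4 * L) = 4^-1 by field; rewrite gt_eqF.
    by have : B * (L * eta) <= B * 4^-1 by [rewrite ler_wpM2l|]; lra.
  have M1D : forall s, 0 <= s <= T -> (D n s <= (M n * expR (theta * s))%:E)%E.
    move=> s sT; apply: le_trans (DM n_gt0 s sT) _; rewrite lee_fin ler_peMr//.
    by rewrite -expR0 ler_expR mulr_ge0// ?(ltW th0)//; case/andP: sT.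
  have [B DB /andP[B0 B3c]] := contraction_iterate c0 M0 M1D step.
  move=> t tT; apply: le_trans (DB t tT) _; rewrite lee_fin.
  have -> : 3 * (L * (1 + m) * (C + 1)) * expR (theta * T) * n%:R `^ (- r) =
    3 * c * expR (theta * T) by rewrite /c /eta; ring.
  apply: ler_pM; rewrite ?expR_ge0//.
  by rewrite ler_expR ler_wpM2l ?(ltW th0)//; case/andP: tT.
pose C' := 3 * (L * (1 + m) * (C + 1)) * expR (theta * T).
have C'0 : 0 < C'.
  by apply: mulr_gt0 (expR_gt0 _); apply: mulr_gt0 (mulr_gt0 (mulr_gt0 L0 m10) C10).
(* For n < n0 the bound [M n] equals M n n^r times n^(-r), and its first factor is one of the
   nonnegative terms of [S]. *)
pose S := \sum_(k < n0) M k * k%:R `^ r.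
have S0 : 0 <= S by apply: sumr_ge0 => k _; rewrite mulr_ge0 ?powR_ge0//; case: (MD k).
exists (C' + S); split; first by rewrite ltr_pwDl.
move=> n n_gt0 t tT; rewrite unlock -/(D n t).
have [nn0|nn0] := leqP n0 n.
  apply: le_trans (large n nn0 n_gt0 t tT) _.
  by rewrite lee_fin ler_wpM2r ?powR_ge0// lerDl.
have [M0 DM] := MD n.
apply: le_trans (DM n_gt0 t tT) _; rewrite lee_fin.
apply: (@le_trans _ _ (S * n%:R `^ (- r))); last first.
  by rewrite ler_wpM2r ?powR_ge0// lerDr ltW.
rewrite powRN ler_pdivlMr ?powR_gt0 ?ltr0n//.
rewrite /S (bigD1 (Ordinal nn0))//= lerDl; apply: sumr_ge0 => k _.
by rewrite mulr_ge0 ?powR_ge0//; case: (MD k).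
Qed.
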